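(* Let $n\geq 3$ and $r\geq 1$ be integers, and let $x\colon (S^n,g)\to\mathbb{S}^N$ be a closed smooth minimal immersion into the unit round sphere whose induced metric $g$ is rotationally symmetric. Suppose that the Ricci tensor $\operatorname{Ric}_g$ and the sectional curvature $\sec_g$ of $(S^n,g)$ satisfy $$\operatorname{Ric}_g\geq(n-1)\frac{n}{(r+1)(r+n)}\,g,\qquad \sec_g\leq\frac{n}{r(r+n-1)}.$$ Then $$\sec_g\equiv\frac{n}{r(r+n-1)}\quad\text{or}\quad\sec_g\equiv\frac{n}{(r+1)(r+n)}.$$
   Context: $S^n$ denotes the smooth $n$-sphere, and $\mathbb{S}^N\subset\mathbb{R}^{N+1}$ the round sphere of radius $1$. The metric $g=x^*g_{\mathbb{S}^N}$ is the induced metric, and $x$ is minimal when its mean curvature vector (the trace of the second fundamental form, up to a constant factor) vanishes identically. Inequalities for $\sec_g$ are understood pointwise on all tangent two-planes; inequalities between Ricci tensors are understood pointwise as inequalities of symmetric $(0,2)$-tensors. A smooth metric $g$ on $S^n$ is rotationally symmetric if it can be written globally as $g=dt^2+f(t)^2g_{\mathbb{S}^{n-1}}$, $0\le t\le a$, where $g_{\mathbb{S}^{n-1}}$ is the unit round metric, $f>0$ on $(0,a)$, and the usual smooth pole compatibility conditions hold; in particular $f(0)=f(a)=0$, $f'(0)=1$, $f'(a)=-1$, and the Taylor expansions of $f$ at the two poles have the parity required for the warped product to extend smoothly across them. *)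

(* Defs.v *)
From HB Require Import structures.
From mathcomp Require Import all_boot all_order all_algebra.
From mathcomp Require Import all_classical all_reals all_analysis.

Set Implicit Arguments.
Unset Strict Implicit.
Unset Printing Implicit Defensive.

Import Order.TTheory GRing.Theory Num.Theory.
Import numFieldNormedType.Exports.

Local Open Scope ring_scope.
Local Open Scope classical_set_scope.

Definition dot (R : realType) (k : nat) (u v : 'rV[R]_k) : R :=
  \sum_i u 0 i * v 0 i.

Definition usphere (R : realType) (k : nat) : set 'rV[R]_k :=
  [set p | dot p p = 1].
Arguments usphere : clear implicits.

Definition basis (R : realType) (k : nat) (i : 'I_k) : 'rV[R]_k :=
  delta_mx 0 i.
Arguments basis R {k} i.

(* In finite dimension, C^k on an open set is equivalent to existence and
   continuity of all iterated directional derivatives up to order k. *)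
Fixpoint Ck (R : realType) (V W : normedModType R) (k : nat) (U : set V)
    (f : V -> W) : Prop :=
  (forall x, U x -> {for x, continuous f}) /\
  match k with
  | 0%N => True
  | k'.+1 => forall v : V,
      (forall x, U x -> derivable f x v) /\ Ck k' U ('D_v f)
  end.

Definition smooth (R : realType) (V W : normedModType R) (U : set V)
  (f : V -> W) : Prop := forall k, Ck k U f.

(* A map on the sphere S^{k-1} is represented by a function on R^k of which
   only the values on [usphere R k] matter: everything below goes through the
   extension p |-> F (p / |p|), constant along rays. *)
Definition normalize (R : realType) (k : nat) (p : 'rV[R]_k) : 'rV[R]_k :=
  (Num.sqrt (dot p p))^-1 *: p.

Definition sphere_smooth (R : realType) (k : nat) (W : normedModType R)
    (F : 'rV[R]_k -> W) : Prop :=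
  smooth [set p | p != 0] (F \o @normalize R k).

(* dF_p(v), for p on the sphere and v tangent, i.e. dot p v = 0. *)
Definition sphere_diff (R : realType) (k : nat) (W : normedModType R)
    (F : 'rV[R]_k -> W) (p v : 'rV[R]_k) : W :=
  'D_v (F \o @normalize R k) p.

Definition sphere_diffeo (R : realType) (k : nat)
    (phi : 'rV[R]_k -> 'rV[R]_k) : Prop :=
  exists psi : 'rV[R]_k -> 'rV[R]_k,
    [/\ sphere_smooth phi, sphere_smooth psi,
        (forall p, usphere R k p -> usphere R k (phi p) /\ psi (phi p) = p) &
        (forall p, usphere R k p -> usphere R k (psi p) /\ phi (psi p) = p)].

(* [g p v w] is the metric at p in S^n on the tangent vectors v, w. *)
Definition sphere_metric (R : realType) (n : nat) : Type :=
  'rV[R]_n.+1 -> 'rV[R]_n.+1 -> 'rV[R]_n.+1 -> R.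

Definition sphere_immersion (R : realType) (n N : nat)
    (x : 'rV[R]_n.+1 -> 'rV[R]_N.+1) : Prop :=
  [/\ sphere_smooth x,
      (forall p, usphere R n.+1 p -> usphere R N.+1 (x p)) &
      (forall p v, usphere R n.+1 p -> dot p v = 0 -> v != 0 ->
         sphere_diff x p v != 0)].

Definition induced_metric (R : realType) (n N : nat)
    (x : 'rV[R]_n.+1 -> 'rV[R]_N.+1) : sphere_metric R n :=
  fun p v w => dot (sphere_diff x p v) (sphere_diff x p w).

(* The two inverse stereographic projections R^n -> S^n; together their
   images cover S^n. *)
Definition stereo (R : realType) (n : nat) (eps : bool) (u : 'rV[R]_n) :
    'rV[R]_n.+1 :=
  (dot u u + 1)^-1 *:
    (row_mx ((-1) ^+ eps * (dot u u - 1))%:M (2 *: u) : 'rV[R]_(1 + n)).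

Definition in_chart (R : realType) (n : nat) (g : sphere_metric R n)
    (eps : bool) (u : 'rV[R]_n) : 'M[R]_n :=
  \matrix_(i, j) g (stereo eps u) ('D_(basis R i) (@stereo R n eps) u)
                                  ('D_(basis R j) (@stereo R n eps) u).

(* Below, G u is the matrix (g_ij) of a metric in coordinates u in R^n. *)

Definition form (R : realType) (n : nat) (A : 'M[R]_n) (v w : 'rV[R]_n) : R :=
  \sum_i \sum_j v 0 i * A i j * w 0 j.

Definition pd (R : realType) (n : nat) (i : 'I_n) (f : 'rV[R]_n -> R) :
  'rV[R]_n -> R := 'D_(basis R i) f.

(* Gamma^k_{ij} *)
Definition christoffel (R : realType) (n : nat) (G : 'rV[R]_n -> 'M[R]_n)
    (k i j : 'I_n) (u : 'rV[R]_n) : R :=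
  2^-1 * \sum_l invmx (G u) k l *
    (pd i (fun y => G y j l) u + pd j (fun y => G y i l) u
       - pd l (fun y => G y i j) u).

(* The l-th component of R(d_i, d_j) d_k, with
   R(X, Y) Z = nabla_X nabla_Y Z - nabla_Y nabla_X Z - nabla_[X,Y] Z. *)
Definition riemann (R : realType) (n : nat) (G : 'rV[R]_n -> 'M[R]_n)
    (l i j k : 'I_n) (u : 'rV[R]_n) : R :=
  pd i (christoffel G l j k) u - pd j (christoffel G l i k) u
  + \sum_m (christoffel G l i m u * christoffel G m j k u
            - christoffel G l j m u * christoffel G m i k u).

Definition curvature (R : realType) (n : nat) (G : 'rV[R]_n -> 'M[R]_n)
    (u v w z : 'rV[R]_n) : 'rV[R]_n :=
  \row_l \sum_i \sum_j \sum_k v 0 i * w 0 j * z 0 k * riemann G l i j k u.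

Definition sec (R : realType) (n : nat) (G : 'rV[R]_n -> 'M[R]_n)
    (u v w : 'rV[R]_n) : R :=
  form (G u) (curvature G u v w w) v
  / (form (G u) v v * form (G u) w w - form (G u) v w ^+ 2).

(* Ric(v, w) = tr (z |-> R(z, v) w) *)
Definition ric (R : realType) (n : nat) (G : 'rV[R]_n -> 'M[R]_n)
    (u v w : 'rV[R]_n) : R :=
  \sum_i curvature G u (basis R i) v w 0 i.

Definition ric_ge (R : realType) (n : nat) (g : sphere_metric R n) (c : R) :=
  forall eps u v,
    c * form (in_chart g eps u) v v <= ric (in_chart g eps) u v v.

Definition sec_le (R : realType) (n : nat) (g : sphere_metric R n) (c : R) :=
  forall eps u v w, row_free (col_mx v w) -> sec (in_chart g eps) u v w <= c.

Definition sec_eq (R : realType) (n : nat) (g : sphere_metric R n) (c : R) :=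
  forall eps u v w, row_free (col_mx v w) -> sec (in_chart g eps) u v w = c.

(* The second fundamental form on (d_i, d_j) of the immersion x into the unit
   sphere S^N: the orthogonal projection of d_i d_j X, where X = x o stereo,
   onto the orthogonal complement of T_p S^n inside T_{x(p)} S^N, i.e. of
   span (X, d_1 X, ..., d_n X) inside R^(N+1). Recall that X is a unit vector
   orthogonal to all d_k X. *)
Definition second_form (R : realType) (n N : nat)
    (x : 'rV[R]_n.+1 -> 'rV[R]_N.+1) (eps : bool) (i j : 'I_n)
    (u : 'rV[R]_n) : 'rV[R]_N.+1 :=
  let X : 'rV[R]_n -> 'rV[R]_N.+1 := x \o @stereo R n eps in
  let d k : 'rV[R]_n -> 'rV[R]_N.+1 := 'D_(basis R k) X in
  let h : 'rV[R]_N.+1 := 'D_(basis R i) (d j) u in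
  h - dot h (X u) *: X u
    - \sum_k \sum_l (invmx (in_chart (induced_metric x) eps u) k l
                     * dot h (d k u)) *: d l u.

Definition mean_curvature (R : realType) (n N : nat)
    (x : 'rV[R]_n.+1 -> 'rV[R]_N.+1) (eps : bool) (u : 'rV[R]_n) :
    'rV[R]_N.+1 :=
  \sum_i \sum_j
    invmx (in_chart (induced_metric x) eps u) i j *: second_form x eps i j u.

Definition minimal (R : realType) (n N : nat)
    (x : 'rV[R]_n.+1 -> 'rV[R]_N.+1) : Prop :=
  forall eps u, mean_curvature x eps u = 0.

(* The standard polar parametrization [0, a] x S^{n-1} -> S^n, which collapses
   {0} x S^{n-1} and {a} x S^{n-1} to the two poles. *)
Definition polar (R : realType) (n : nat) (a t : R) (w : 'rV[R]_n) :
    'rV[R]_n.+1 :=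
  (row_mx (cos (pi * t / a))%:M (sin (pi * t / a) *: w) : 'rV[R]_(1 + n)).

(* f is a smooth function on [0, a], given through a smooth extension to R.
   The vanishing of the even derivatives at 0 and a contains
   f 0 = f a = 0. *)
Definition warping_function (R : realType) (a : R) (f : R -> R) : Prop :=
  [/\ smooth [set: R] f,
      (forall t, 0 < t < a -> 0 < f t),
      (forall k, f^`(k.*2) 0 = 0 /\ f^`(k.*2) a = 0),
      f^`() 0 = 1 &
      f^`() a = -1].

(* g = dt^2 + f(t)^2 g_{S^{n-1}} in the polar coordinates obtained from the
   standard ones by some diffeomorphism phi of S^n. *)
Definition rotationally_symmetric (R : realType) (n : nat)
    (g : sphere_metric R n) : Prop :=
  exists (a : R) (f : R -> R) (phi : 'rV[R]_n.+1 -> 'rV[R]_n.+1),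
    [/\ 0 < a, warping_function a f, sphere_diffeo phi &
      let Phi (t : R) (w : 'rV[R]_n) : 'rV[R]_n.+1 := phi (polar a t w) in
      forall (t : R) (w xi eta : 'rV[R]_n), 0 < t < a -> usphere R n w ->
        dot w xi = 0 -> dot w eta = 0 ->
        let p : 'rV[R]_n.+1 := Phi t w in
        let dt : 'rV[R]_n.+1 := (Phi ^~ w)^`() t in
        [/\ g p dt dt = 1,
            g p dt (sphere_diff (Phi t) w xi) = 0 &
            g p (sphere_diff (Phi t) w xi) (sphere_diff (Phi t) w eta)
              = f t ^+ 2 * dot xi eta]].

(* Main.v *)
(** In the polar coordinates (t, w) of g = dt^2 + f(t)^2 g_round, minimality says
    that every component of x satisfies Delta x + n x = 0.  Averaging the height
    <x, x(pole)> over the spheres t = const therefore gives a nonzero solution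
    phi of f phi'' + (n - 1) f' phi' + n f phi = 0 regular at both poles.  The
    curvature hypotheses become c1 <= - f'' / f <= c0, where c0 and c1 are the
    curvatures of the round spheres on which n is the eigenvalue of degree r and
    of degree r + 1.  The zonal harmonics of these two round spheres, transplanted
    through z = f' / sqrt(f'^2 + c f^2), satisfy equations to which the Pruefer
    angle of phi can be compared: its total variation lies between r pi and
    (r + 1) pi.  Being a multiple of pi it equals one of the two bounds, and
    equality in the comparison forces f'' = - c f.  Then g is a multiple of the
    pullback of the round metric by the diffeomorphism giving the polar
    coordinates, and the Gauss equation for a hypersurface of R^(n+1) yields
    sec = c. *)

Require Import Defs.
From HB Require Import structures.
From mathcomp Require Import all_boot all_order all_algebra.
From mathcomp Require Import all_classical all_reals all_analysis.
From Stdlib Require Import Lia.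
From mathcomp Require Import zify ring lra.

Set Implicit Arguments.
Unset Strict Implicit.
Unset Printing Implicit Defensive.

Import Order.TTheory GRing.Theory Num.Theory.
Import numFieldNormedType.Exports.
(* Imported again, because the topology library shadows [basis]. *)
Import Defs.

Local Open Scope ring_scope.
Local Open Scope classical_set_scope.

(** * Functions of class C^k *)

(** The variable z is the cosine of an angle theta with sqrt(c) cot theta = f'/f. The transplanted
    harmonic therefore has the same friction coefficient (n - 1) f'/f as phi, and the two Pruefer
    equations differ only by a factor [speed] = (f'^2 - f f'') / (f'^2 + c f^2), where 1 - [speed]
    has the sign of f'' + c f. This sign orders the angles only if the Pruefer form of phi is
    positive, that is, if phi phi'' < phi'^2. This log-concavity is the analytic obstacle; its proof
    uses f'' < 0, which comes from c1 > 0.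

    The second obstacle is that f'/f is infinite at both poles. At each pole the singular term has
    the favourable sign, so that one-sided bounds and Gronwall's inequality suffice. The equation
    for phi, extended to the poles by continuity, forces phi' = 0 there, which is why its angle ends
    at a multiple of pi.

    Of the average over spheres only linearity, positivity and the vanishing of the mean of certain
    derivatives are used, so a limit of grid means can replace an integral. *)

Section Ck.
Variable R : realType.
Implicit Types V W : normedModType R.

Lemma Ck_cont V W k (U : set V) (f : V -> W) x :
  Ck k U f -> U x -> {for x, continuous f}.
Proof. by case: k => [|k] [fc _]; exact: fc. Qed.

Lemma Ck_der V W k (U : set V) (f : V -> W) v x :
  Ck k.+1 U f -> U x -> derivable f x v.
Proof. by move=> [_ /(_ v)[fd _]]; exact: fd. Qed.

Lemma Ck_D V W k (U : set V) (f : V -> W) v :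
  Ck k.+1 U f -> Ck k U ('D_v f).
Proof. by move=> [_ /(_ v)[]]. Qed.

Lemma CkS V W k (U : set V) (f : V -> W) : Ck k.+1 U f -> Ck k U f.
Proof.
elim: k f => [|k IH] f [fc fd]; first by split.
by split=> // v; have [fdv fD] := fd v; split=> //; exact: IH.
Qed.

Lemma CkW V W k l (U : set V) (f : V -> W) : (k <= l)%N -> Ck l U f -> Ck k U f.
Proof.
move=> /subnK <-; elim: (l - k)%N => [//|i IH].
by rewrite addSn => /CkS.
Qed.

Lemma Ck_sub V W k (U U' : set V) (f : V -> W) :
  U' `<=` U -> Ck k U f -> Ck k U' f.
Proof.
move=> UU; elim: k f => [|k IH] f [fc fd]; first by split=> // x /UU/fc.
split=> [x /UU/fc //|v]; have [fdv fD] := fd v.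
by split=> [x /UU/fdv //|]; exact: IH.
Qed.

(** The conditions in [Ck] are pointwise, so they can be checked piece by piece. This is how a
    product with a cutoff is seen to be C^k on the whole space ([cutoff_Ck]). *)
Lemma Ck_setU V W k (U U' : set V) (f : V -> W) :
  Ck k U f -> Ck k U' f -> Ck k (U `|` U') f.
Proof.
elim: k f => [|k IH] f [fc fd] [gc gd]; first by split=> // x [/fc|/gc].
split=> [x [/fc|/gc]//|v]; have [fdv fD] := fd v; have [gdv gD] := gd v.
by split=> [x [/fdv|/gdv]//|]; exact: IH.
Qed.

Lemma open_near_eq V (W : Type) (U : set V) (f g : V -> W) x : open U ->
  (forall y, U y -> f y = g y) -> U x -> \near x, f x = g x.
Proof.
by move=> Uo fg Ux; near=> y; apply: fg; near: y; exact: open_nbhs_nbhs.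
Unshelve. all: by end_near. Qed.

Lemma Ck_ext V W k (U : set V) (f g : V -> W) : open U ->
  (forall x, U x -> f x = g x) -> Ck k U f -> Ck k U g.
Proof.
move=> Uo; elim: k f g => [|k IH] f g fg [fc fd].
  split=> // x Ux; rewrite /prop_for /continuous_at -fg//.
  by apply: cvg_trans (fc _ Ux); apply: near_eq_cvg; exact: (open_near_eq Uo).
split=> [x Ux|v].
  rewrite /prop_for /continuous_at -fg//.
  by apply: cvg_trans (fc _ Ux); apply: near_eq_cvg; exact: (open_near_eq Uo).
have [fdv fD] := fd v; split=> [x Ux|].
  by apply: near_eq_derivable (fdv _ Ux); exact: (open_near_eq Uo).
apply: IH fD => x Ux; apply: near_eq_derive; exact: (open_near_eq Uo).
Qed.

Lemma derive_ext V W (U : set V) (f g : V -> W) x v : open U ->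
  (forall y, U y -> f y = g y) -> U x -> 'D_v f x = 'D_v g x.
Proof.
by move=> Uo fg Ux; apply: near_eq_derive; exact: (open_near_eq Uo).
Qed.

(** The recursive clause of [Ck] is about the function ['D_v f], of which only the values on U are
    known. Since U is open, a formula valid on U may replace it; the closure properties below mostly
    follow this pattern. *)
Lemma CkSP V W k (U : set V) (f : V -> W) (df : V -> V -> W) : open U ->
  (forall x, U x -> {for x, continuous f}) ->
  (forall v x, U x -> is_derive x v f (df v x)) ->
  (forall v, Ck k U (df v)) -> Ck k.+1 U f.
Proof.
move=> Uo fc fd dfk; split=> // v; split=> [x Ux|].
  by have [] := fd v x Ux.
by apply: Ck_ext (dfk v) => // x Ux; have [_ ->] := fd v x Ux.
Qed.

Lemma Ck_cst V W k (U : set V) (a : W) : Ck k U (fun=> a).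
Proof.
elim: k a => [|k IH] a; first by split=> // x _; exact: cvg_cst.
split=> [x _|v]; first exact: cvg_cst.
split=> [x _|]; first exact: derivable_cst.
suff -> : 'D_v (fun=> a : W) = (fun=> 0 : W) by exact: IH.
by apply/funext => x; rewrite -[LHS]/('D_v (cst a) x) derive_cst.
Qed.

Lemma CkD V W k (U : set V) (f g : V -> W) : open U ->
  Ck k U f -> Ck k U g -> Ck k U (fun x => f x + g x).
Proof.
move=> Uo; elim: k f g => [|k IH] f g fk gk.
  by split=> // x Ux; apply: cvgD; [exact: (Ck_cont fk Ux)|exact: (Ck_cont gk Ux)].
apply: (@CkSP _ _ _ _ _ (fun v x => 'D_v f x + 'D_v g x)) => //.
- by move=> x Ux; apply: cvgD; [exact: (Ck_cont fk Ux)|exact: (Ck_cont gk Ux)].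
- move=> v x Ux; apply: is_deriveD; apply: derivableP;
    [exact: (Ck_der fk)|exact: (Ck_der gk)].
- by move=> v; apply: IH; exact: Ck_D.
Qed.

Lemma CkM V k (U : set V) (f g : V -> R) : open U ->
  Ck k U f -> Ck k U g -> Ck k U (fun x => f x * g x).
Proof.
move=> Uo; elim: k f g => [|k IH] f g fk gk.
  by split=> // x Ux; apply: cvgM; [exact: (Ck_cont fk Ux)|exact: (Ck_cont gk Ux)].
apply: (@CkSP _ _ _ _ _ (fun v x => f x * 'D_v g x + g x * 'D_v f x)) => //.
- by move=> x Ux; apply: cvgM; [exact: (Ck_cont fk Ux)|exact: (Ck_cont gk Ux)].
- move=> v x Ux; apply: is_deriveM; apply: derivableP;
    [exact: (Ck_der fk)|exact: (Ck_der gk)].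
- by move=> v; apply: CkD => //; apply: IH => //; (exact: CkS || exact: Ck_D).
Qed.

Lemma Ck_sum V k (U : set V) (I : Type) (r : seq I) (P : pred I)
    (f : I -> V -> R) : open U ->
  (forall i, P i -> Ck k U (f i)) -> Ck k U (fun x => \sum_(i <- r | P i) f i x).
Proof.
move=> Uo fk; elim: r => [|i r IH].
  by apply: Ck_ext (Ck_cst k U (0:R)) => // x _; rewrite big_nil.
have [Pi|Pi] := boolP (P i).
  by apply: Ck_ext (CkD Uo (fk i Pi) IH) => // x _; rewrite big_cons Pi.
by apply: Ck_ext IH => // x _; rewrite big_cons (negPf Pi).
Qed.

Lemma Ck_prod V k (U : set V) (I : Type) (r : seq I) (P : pred I)
    (f : I -> V -> R) : open U ->
  (forall i, P i -> Ck k U (f i)) -> Ck k U (fun x => \prod_(i <- r | P i) f i x).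
Proof.
move=> Uo fk; elim: r => [|i r IH].
  by apply: Ck_ext (Ck_cst k U (1:R)) => // x _; rewrite big_nil.
have [Pi|Pi] := boolP (P i).
  by apply: Ck_ext (CkM Uo (fk i Pi) IH) => // x _; rewrite big_cons Pi.
by apply: Ck_ext IH => // x _; rewrite big_cons (negPf Pi).
Qed.

Lemma CkN V k (U : set V) (f : V -> R) : open U ->
  Ck k U f -> Ck k U (fun x => - f x).
Proof.
move=> Uo fk; apply: Ck_ext (CkM Uo (Ck_cst k U (-1 : R)) fk) => // x _.
by rewrite mulN1r.
Qed.

Lemma CkB V k (U : set V) (f g : V -> R) : open U ->
  Ck k U f -> Ck k U g -> Ck k U (fun x => f x - g x).
Proof. by move=> Uo fk gk; apply: CkD => //; exact: CkN. Qed.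

Lemma CkX V k (U : set V) (f : V -> R) i : open U ->
  Ck k U f -> Ck k U (fun x => f x ^+ i).
Proof.
move=> Uo fk; elim: i => [|i IH].
  by apply: Ck_ext (Ck_cst k U (1:R)) => // x _; rewrite expr0.
by apply: Ck_ext (CkM Uo fk IH) => // x _; rewrite exprS.
Qed.

(** Only one directional derivative of f is available, so the chain rule is applied to the function
    s |-> f (s v + x) of one real variable. *)
Lemma is_derive_comp1 V (f : V -> R) (g : R -> R) x v (df dg : R) :
  is_derive x v f df -> is_derive (f x) 1 g dg ->
  is_derive x v (fun y => g (f y)) (dg * df).
Proof.
move=> [fd fE] [gd gE].
pose h s := f (s *: v + x).
have h0 : h 0 = f x by rewrite /h scale0r add0r.
have dh : derivable h 0 1 := (derivable1P f x v).1 fd.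
have hE : 'D_1 h 0 = df.
  rewrite -fE /derive; set F := fun _ => _; set G := fun _ => _.
  by suff -> : F = G by []; apply/funext => s; rewrite /F /G /h /= scale0r add0r addr0 [s%:A]mulr1.
have dgh : derivable g (h 0) 1 by rewrite h0.
have dc : derivable (g \o h) 0 1.
  apply: (derivable1_diffP _ _).2; apply: differentiable_comp.
    exact: (derivable1_diffP _ _).1 dh.
  exact: (derivable1_diffP _ _).1 dgh.
split; first exact: (derivable1P _ _ _).2 dc.
transitivity ('D_1 (g \o h) 0).
  rewrite /derive; set F := fun _ => _; set G := fun _ => _.
  by suff -> : F = G by []; apply/funext => s; rewrite /F /G /h /= scale0r add0r addr0 [s%:A]mulr1.
by rewrite -derive1E (@derive1_comp R h g 0 dh dgh) !derive1E hE h0 gE.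
Qed.

Lemma Ck_comp1 V k (U : set V) (U' : set R) (f : V -> R) (g : R -> R) :
  open U -> (forall x, U x -> U' (f x)) ->
  Ck k U f -> Ck k U' g -> Ck k U (fun x => g (f x)).
Proof.
move=> Uo UU; elim: k f g UU => [|k IH] f g UU fk gk.
  split=> // x Ux; apply: continuous_comp; first exact: (Ck_cont fk).
  by apply: (Ck_cont gk); exact: UU.
apply: (@CkSP _ _ _ _ _ (fun v x => 'D_1 g (f x) * 'D_v f x)) => //.
- move=> x Ux; apply: continuous_comp; first exact: (Ck_cont fk).
  by apply: (Ck_cont gk); exact: UU.
- move=> v x Ux; apply: is_derive_comp1; apply: derivableP.
      exact: (Ck_der fk).
    by apply: (Ck_der gk); exact: UU.
- move=> v; apply: CkM => //; last exact: Ck_D.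
  by apply: (IH f ('D_1 g)) => //; [exact: CkS|exact: Ck_D].
Qed.

Lemma Ck_id V k (U : set V) : Ck k U (@id V).
Proof.
case: k => [|k]; first by split=> // x _; exact: cvg_id.
split=> [x _|v]; first exact: cvg_id.
split=> [x _|]; first exact: derivable_id.
suff -> : 'D_v (@id V) = (fun=> v) by exact: Ck_cst.
by apply/funext => x; rewrite derive_id.
Qed.

Lemma Ck_inv_id k : Ck k [set x : R | x != 0] (fun x => x^-1).
Proof.
have Uo : open [set x : R | x != 0] by exact: open_neq.
elim: k => [|k IH]; first by split=> // x; exact: inv_continuous.
apply: (@CkSP (R : normedModType R) (R : normedModType R) _ _ _ (fun v x => - (x^-1 * x^-1) * v)) => //.
- by move=> x; exact: inv_continuous.
- move=> v x x0; have := derivableP (@derivable_id R R x v); rewrite derive_id => h.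
  have := is_deriveV x0 h.
  by rewrite scaleNr mulNr -invfM expr2.
- move=> v; apply: CkM => //; last exact: Ck_cst.
  by apply: CkN => //; exact: CkM.
Qed.

Lemma CkV V k (U : set V) (f : V -> R) : open U -> (forall x, U x -> f x != 0) ->
  Ck k U f -> Ck k U (fun x => (f x)^-1).
Proof. by move=> Uo f0 fk; apply: (Ck_comp1 (U' := [set x : R | x != 0])) => //; exact: Ck_inv_id. Qed.

End Ck.

(** * Restriction to lines and the mean value theorem *)

Section Lines.
Variable R : realType.
Implicit Types V W : normedModType R.

Lemma line_is_derive V W (f : V -> W) (y v : V) (s : R) :
  derivable f (y + s *: v) v ->
  is_derive s 1 (fun s => f (y + s *: v)) ('D_v f (y + s *: v)).
Proof.
move=> fd.
have E : (fun h : R => h^-1 *: (((fun s => f (y + s *: v)) \o shift s) (h *: (1 : R)) - f (y + s *: v)))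
   = (fun h => h^-1 *: ((f \o shift (y + s *: v)) (h *: v) - f (y + s *: v))).
  by apply/funext => h; rewrite /= [h%:A]mulr1 scalerDl addrCA.
by split; rewrite /derivable /derive E.
Qed.

Lemma MVT_line V (f : V -> R) (y v : V) (s : R) :
  (forall c : R, `|c| <= `|s| -> derivable f (y + c *: v) v) ->
  exists2 c : R, `|c| <= `|s| & f (y + s *: v) - f y = s * 'D_v f (y + c *: v).
Proof.
move=> fd; pose g (c : R) := f (y + c *: v); pose dg (c : R) : R := 'D_v f (y + c *: v).
have gd (c : R) : `|c| <= `|s| -> is_derive c (1 : R) g (dg c).
  by move=> cs; apply: line_is_derive; exact: fd.
have gc a b : (forall c, c \in `[a, b]%R -> `|c| <= `|s|) -> {within `[a, b], continuous g}.
  move=> H; apply: derivable_within_continuous => c /H cs.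
  by have [] := gd c cs.
have [s0|s0] := leP 0 s.
  have H c : c \in `[0, s]%R -> `|c| <= `|s|.
    by rewrite in_itv /= => /andP[c0 cs]; rewrite !ger0_norm.
  have [||c cs E] := @MVT_segment R g dg 0 s s0.
  - move=> c cs; apply: gd; apply: H; exact: subset_itv_oo_cc.
  - exact: gc.
  exists c; first exact: H.
  by rewrite mulrC -[X in _ * X]subr0 -E /g scale0r addr0.
have H c : c \in `[s, 0]%R -> `|c| <= `|s|.
  by rewrite in_itv /= => /andP[c0 cs]; rewrite !ler0_norm ?lerN2// ltW.
have [||c cs E] := @MVT_segment R g dg s 0 (ltW s0).
- move=> c cs; apply: gd; apply: H; exact: subset_itv_oo_cc.
- exact: gc.
exists c; first exact: H.
apply/eqP; rewrite -eqr_opp opprB mulrC -mulrN -[X in _ == _ * X]sub0r -E /g.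
by rewrite scale0r addr0.
Qed.

End Lines.

(** * Matrix-valued functions, entry by entry *)

Section Matrix.
Variable R : realType.
Implicit Types V W : normedModType R.

Lemma derive_coord V m n (f : V -> 'M[R]_(m, n)) x v i j :
  derivable f x v -> 'D_v (fun y => f y i j) x = ('D_v f x) i j.
Proof. by move=> fd; rewrite derive_mx// mxE. Qed.

Lemma is_derive_coord m n (x v : 'M[R]_(m, n)) i j :
  is_derive x v (fun y : 'M[R]_(m, n) => y i j) (v i j).
Proof.
have idd : derivable (fun y : 'M[R]_(m, n) => y) x v by exact: derivable_id.
split; first by have := (derivable_mxP _ _ _).1 idd i j.
by rewrite (derive_coord _ _ idd) derive_id.
Qed.

Lemma Ck_coord m n k (U : set 'M[R]_(m, n)) i j : open U ->
  Ck k U (fun y : 'M[R]_(m, n) => y i j : R).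
Proof.
move=> Uo; case: k => [|k].
  by split=> // x _; exact: coord_continuous.
apply: (@CkSP R _ (R : normedModType R) k U _ (fun v x => v i j)) => //.
- by move=> x _; exact: coord_continuous.
- by move=> v x _; exact: is_derive_coord.
- by move=> v; exact: Ck_cst.
Qed.

Lemma mx_continuous V m n (f : V -> 'M[R]_(m, n)) x :
  (forall i j, {for x, continuous (fun y => f y i j)}) -> {for x, continuous f}.
Proof.
move=> fc; apply/cvgrPdist_le => /= e e0; near=> y.
rewrite /Num.Def.normr/= mx_normrE (bigmax_le _ (ltW e0))//= => i _.
rewrite !mxE/=; move: i; near: y; apply: filter_forall => /= i.
exact: ((cvgrPdist_le _ _).1 (fc i.1 i.2)).
Unshelve. all: by end_near. Qed.

Lemma Ck_mxP V m n k (U : set V) (f : V -> 'M[R]_(m, n)) : open U ->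
  Ck k U f <-> forall i j, Ck k U (fun x => f x i j).
Proof.
move=> Uo; elim: k f => [|k IH] f; split.
- move=> [fc _] i j; split=> // x Ux.
  apply: (@continuous_comp _ _ _ f (fun M : 'M[R]_(m, n) => M i j)); first exact: fc.
  exact: coord_continuous.
- move=> fc; split=> // x Ux; apply: mx_continuous => i j; exact: (Ck_cont (fc i j)).
- move=> fk i j; apply: (@CkSP R _ (R : normedModType R) k U _ (fun v x => ('D_v f x) i j)) => //.
  + move=> x Ux; apply: (@continuous_comp _ _ _ f (fun M : 'M[R]_(m, n) => M i j)).
      exact: (Ck_cont fk Ux).
    exact: coord_continuous.
  + move=> v x Ux; have fd := Ck_der (v := v) fk Ux.
    split; first by have := (derivable_mxP _ _ _).1 fd i j.
    by rewrite derive_coord.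
  + by move=> v; apply: (IH _).1; exact: Ck_D.
- move=> fk; apply: (@CkSP _ _ _ _ _ _ (fun v x => \matrix_(i, j) 'D_v (fun x => f x i j) x)) => //.
  + by move=> x Ux; apply: mx_continuous => i j; exact: (Ck_cont (fk i j)).
  + move=> v x Ux.
    have fd : derivable f x v.
      by apply/derivable_mxP => i j; exact: (Ck_der (fk i j)).
    split=> //; exact: derive_mx.
  + move=> v; apply: (IH _).2 => i j.
    apply: Ck_ext (Ck_D v (fk i j)) => // x _; by rewrite mxE.
Qed.

End Matrix.

(** * Total differentials, the chain rule and symmetry of second derivatives *)

Section Chain.
Variable R : realType.
Implicit Types V W : normedModType R.

Lemma coord_norm_le m (h : 'rV[R]_m) i : `|h 0 i| <= `|h|.
Proof. by rewrite [leRHS]/Num.Def.normr/= mx_normrE; exact: (le_bigmax _ _ (0, i)). Qed.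

Lemma mx_norm_le m (h : 'rV[R]_m) (e : R) : 0 <= e ->
  (forall i, `|h 0 i| <= e) -> `|h| <= e.
Proof.
move=> e0 H; rewrite /Num.Def.normr/= mx_normrE (bigmax_le _ e0)//= => -[i j] _.
by rewrite ord1; exact: H.
Qed.

(** The vertices of the path from 0 to h that follows the coordinate axes one after the other. *)
Definition trunc m (h : 'rV[R]_m) (k : nat) : 'rV[R]_m :=
  \row_i (if (i < k)%N then h 0 i else 0).

Lemma truncS m (h : 'rV[R]_m) (i : 'I_m) :
  trunc h i.+1 = trunc h i + h 0 i *: basis R i.
Proof.
apply/rowP => j; rewrite !mxE ltnS leq_eqVlt eqxx /=.
have [->|ji] := eqVneq j i; first by rewrite eqxx ltnn add0r mulr1.
by rewrite (inj_eq val_inj) (negPf ji) mulr0 addr0.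
Qed.

(** The increment is telescoped along the path [trunc]. Each edge changes one coordinate, and the
    mean value theorem together with the continuity of that partial derivative bounds its error. *)
Lemma C1_increment m (U : set 'rV[R]_m) (f : 'rV[R]_m -> R) x (e : R) :
  open U -> Ck 1 U f -> U x -> 0 < e ->
  \forall h \near (0 : 'rV[R]_m),
    `|f (x + h) - f x - \sum_i h 0 i * 'D_(basis R i) f x| <= e * `|h|.
Proof.
move=> Uo fk Ux e0.
(* The error is shared among the m edges; m + 1 keeps the denominator nonzero for m = 0. *)
pose e' := e / (m.+1)%:R.
have e'0 : 0 < e' by rewrite divr_gt0.
have [d /= d0 dU] : exists2 d : R, 0 < d & forall h : 'rV[R]_m, `|h| < d ->
    U (x + h) /\ forall i, `|'D_(basis R i) f (x + h) - 'D_(basis R i) f x| <= e'.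
  have HU : \forall y \near x, U y by exact: open_nbhs_nbhs.
  have HD : \forall y \near x, forall i, `|'D_(basis R i) f y - 'D_(basis R i) f x| <= e'.
    apply: (@filter_forall _ _ (fun i y => `|'D_(basis R i) f y - 'D_(basis R i) f x| <= e') (nbhs x) _) => i.
    have c := Ck_cont (Ck_D (basis R i) fk) Ux.
    by apply: filterS ((cvgrPdist_le _ _).1 c _ e'0) => y; rewrite distrC.
  have [d d0 H] := (nbhs_normP _ _).1 (filterI HU HD).
  exists d => // h hd; have := H (x + h); rewrite /ball_ /= opprD addNKr normrN => /(_ hd).
  by [].
apply/nbhs_normP; exists d => // h; rewrite /ball_ /= sub0r normrN => hd.
have tr0 : trunc h 0 = 0 by apply/rowP => i; rewrite !mxE.
have trm : trunc h m = h by apply/rowP => i; rewrite !mxE ltn_ord.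
have -> : f (x + h) - f x = \sum_(i < m) (f (x + trunc h i.+1) - f (x + trunc h i)).
  rewrite -{1}trm -[X in _ - f X]addr0 -tr0.
  by rewrite -(big_mkord xpredT (fun i => f (x + trunc h i.+1) - f (x + trunc h i))) telescope_sumr.
rewrite -sumrB; apply: le_trans (ler_norm_sum _ _ _) _.
apply: (@le_trans _ _ (\sum_(i < m) e' * `|h|)); last first.
  rewrite sumr_const card_ord -[leLHS]mulr_natr mulrAC ler_wpM2r//.
  by rewrite /e' mulrAC ler_pdivrMr// ler_wpM2l ?ler_nat// ltW.
apply: ler_sum => i _; rewrite truncS addrA.
have seg (c : R) : `|c| <= `|h 0 i| -> `|trunc h i + c *: basis R i| < d.
  move=> ch; apply: le_lt_trans hd; apply: mx_norm_le => // j; rewrite !mxE eqxx /=.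
  have [->|ji] := eqVneq j i.
    by rewrite ltnn add0r mulr1 (le_trans ch)// coord_norm_le.
  by rewrite mulr0 addr0; case: ifP => _; [exact: coord_norm_le|rewrite normr0].
have [|c ch ->] := @MVT_line R _ f (x + trunc h i) (basis R i) (h 0 i).
  move=> c ch; rewrite -addrA; apply: (Ck_der fk); exact: (dU _ (seg _ ch)).1.
rewrite -mulrBr normrM mulrC; apply: ler_pM => //; last exact: coord_norm_le.
by rewrite -addrA; exact: (dU _ (seg _ ch)).2.
Qed.

(** [Ck] only supplies directional derivatives. This passes to the total differential, and so makes
    ['D_v f x] linear in v. *)
Lemma C1_differentiable m (U : set 'rV[R]_m) (f : 'rV[R]_m -> R) x :
  open U -> Ck 1 U f -> U x ->
  differentiable f x /\ forall v, 'D_v f x = \sum_i v 0 i * 'D_(basis R i) f x.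
Proof.
move=> Uo fk Ux.
pose df (h : 'rV[R]_m) : R := \sum_i h 0 i * 'D_(basis R i) f x.
have df_lin : linear df.
  move=> a u v; rewrite /df scaler_sumr -big_split; apply: eq_bigr => i _ /=.
  by rewrite !mxE mulrDl -mulrA.
pose dfM := GRing.isLinear.Build _ _ _ _ _ df_lin.
pose dfL : {linear 'rV[R]_m -> R} := HB.pack df dfM.
have dfc : continuous dfL.
  move=> y; rewrite /dfL /= /df.
  apply: (@Ck_cont R _ (R : normedModType R) 0 setT) => //.
  apply: Ck_sum => [|i _]; first exact: openT.
  by apply: CkM; [exact: openT|apply: Ck_coord; exact: openT|exact: Ck_cst].
have dE : 'd f x = dfL :> (_ -> _).
  apply: diff_unique => //; apply/eqaddoP => e e0.
  apply: filterS (C1_increment Uo fk Ux e0) => h /=.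
  by rewrite -[X in _ -> `|X| <= _]/(f (h + x) - (f x + df h)) opprD addrA [h + x]addrC.
have fd : differentiable f x.
  apply/diff_locallyP; rewrite dE; split=> //; apply/eqaddoP => e e0.
  apply: filterS (C1_increment Uo fk Ux e0) => h /=.
  by rewrite -[X in _ -> `|X| <= _]/(f (h + x) - (f x + df h)) opprD addrA [h + x]addrC.
by split=> // v; rewrite deriveE// dE.
Qed.

Lemma chain_is_derive V m (U : set 'rV[R]_m) (g : 'rV[R]_m -> R)
    (f : V -> 'rV[R]_m) x v w :
  open U -> Ck 1 U g -> U (f x) -> is_derive x v f w ->
  is_derive x v (fun y => g (f y)) ('D_w g (f x)).
Proof.
move=> Uo gk Ux [fd fE].
have [gd gE] := C1_differentiable Uo gk Ux.
pose h (s : R) := f (s *: v + x).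
have h0 : h 0 = f x by rewrite /h scale0r add0r.
have dh : derivable h 0 1 := (derivable1P f x v).1 fd.
have dh' : differentiable h 0 := (derivable1_diffP _ _).1 dh.
have shift1 (W : normedModType R) (k : V -> W) :
    'D_1 (fun s : R => k (s *: v + x)) 0 = 'D_v k x.
  rewrite /derive; set F := fun _ => _; set G := fun _ => _.
  by suff -> : F = G by []; apply/funext => s; rewrite /F /G /= scale0r add0r addr0 [s%:A]mulr1.
have gd' : differentiable g (h 0) by rewrite h0.
have dc : differentiable (g \o h) 0 := differentiable_comp dh' gd'.
split; first exact: (derivable1P _ _ _).2 ((derivable1_diffP _ _).2 dc).
transitivity ('D_1 (g \o h) 0); first by rewrite -(shift1 _ (g \o f)).
have e1 : 'D_1 h 0 = w by rewrite shift1.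
by rewrite (deriveE _ dc) (diff_comp dh' gd') -h0 (deriveE w gd') -e1 (deriveE (1 : R) dh').
Qed.

Lemma derive_basis m (U : set 'rV[R]_m) (f : 'rV[R]_m -> R) x v :
  open U -> Ck 1 U f -> U x ->
  'D_v f x = \sum_i v 0 i * 'D_(basis R i) f x.
Proof. by move=> Uo fk Ux; exact: (C1_differentiable Uo fk Ux).2. Qed.

Lemma Ck_comp V m k (U : set V) (U' : set 'rV[R]_m) (f : V -> 'rV[R]_m)
    (g : 'rV[R]_m -> R) :
  open U -> open U' -> (forall x, U x -> U' (f x)) ->
  Ck k U f -> Ck k U' g -> Ck k U (fun x => g (f x)).
Proof.
move=> Uo Uo' UU; elim: k f g UU => [|k IH] f g UU fk gk.
  split=> // x Ux; apply: continuous_comp; first exact: (Ck_cont fk).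
  by apply: (Ck_cont gk); exact: UU.
have g1 : Ck 1 U' g by apply: CkW gk.
apply: (@CkSP R _ (R : normedModType R) k U _
   (fun v x => \sum_i ('D_v f x) 0 i * 'D_(basis R i) g (f x))) => //.
- move=> x Ux; apply: continuous_comp; first exact: (Ck_cont fk).
  by apply: (Ck_cont gk); exact: UU.
- move=> v x Ux; rewrite -(derive_basis _ Uo' g1); last exact: UU.
  apply: (chain_is_derive Uo' g1); first exact: UU.
  by apply: derivableP; exact: (Ck_der fk).
- move=> v; apply: Ck_sum => // i _; apply: CkM => //.
    by apply: ((Ck_mxP k ('D_v f) Uo).1 _ 0 i); exact: Ck_D.
  by apply: (IH f ('D_(basis R i) g)) => //; [exact: CkS|exact: Ck_D].
Qed.

(** The second difference on the left is symmetric in v and w, while the mixed derivative on the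
    right has a definite order; [Schwarz] follows by exchanging the roles. The mean value theorem is
    used first for the increment [F] in direction w, then for ['D_v f]. *)
Lemma second_difference V (U : set V) (f : V -> R) x v w (r : R) :
  Ck 2 U f -> (forall a b : R, `|a| <= `|r| -> `|b| <= `|r| -> U (x + a *: v + b *: w)) ->
  exists a b : R, [/\ `|a| <= `|r|, `|b| <= `|r| &
    f (x + r *: v + r *: w) - f (x + r *: v) - f (x + r *: w) + f x =
    r ^+ 2 * 'D_w ('D_v f) (x + a *: v + b *: w)].
Proof.
move=> fk HU.
have r0 : `|0 : R| <= `|r| by rewrite normr0.
pose F y := f (y + r *: w) - f y.
have Fd (a : R) : `|a| <= `|r| -> is_derive (x + a *: v) v F
   ('D_v f (x + a *: v + r *: w) - 'D_v f (x + a *: v)).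
  move=> ar; apply: is_deriveB; last first.
    by apply: derivableP; apply: (Ck_der fk); rewrite -[_ + _]addr0 -[X in _ + X](scale0r w); exact: HU.
  have fd : derivable f (x + a *: v + r *: w) v by apply: (Ck_der fk); exact: HU.
  have E : (fun h : R => h^-1 *: (((fun y => f (y + r *: w)) \o shift (x + a *: v)) (h *: v) - f (x + a *: v + r *: w)))
    = (fun h => h^-1 *: ((f \o shift (x + a *: v + r *: w)) (h *: v) - f (x + a *: v + r *: w))).
    by apply/funext => h; rewrite /= !addrA.
  by split; rewrite /derivable /derive E.
have [|a ar aE] := @MVT_line R _ F x v r.
  by move=> c cr; have [] := Fd c cr.
have [|b br bE] := @MVT_line R _ ('D_v f) (x + a *: v) w r.
  by move=> c cr; apply: (Ck_der (Ck_D v fk)); exact: HU.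
exists a, b; split=> //.
have [_ FE] := Fd a ar.
transitivity (F (x + r *: v) - F x); first by rewrite /F; ring.
by rewrite aE FE bE mulrA expr2.
Qed.

Lemma near_line V (P : set V) (x v w : V) : nbhs x P ->
  \forall r \near (0 : R), forall a b : R, `|a| <= `|r| -> `|b| <= `|r| ->
    P (x + a *: v + b *: w).
Proof.
move=> /nbhs_normP[d /= d0 dP].
pose M := `|v| + `|w| + 1.
have M0 : 0 < M by rewrite /M ltr_wpDl// addr_ge0.
apply/nbhs_normP; exists (d / M) => /=; first by rewrite divr_gt0.
move=> r; rewrite /ball_ /= sub0r normrN ltr_pdivlMr// => rd a b ar br.
apply: dP; rewrite /ball_ /= -addrA opprD addNKr normrN.
apply: le_lt_trans rd; apply: le_trans (ler_normD _ _) _; rewrite !normrZ.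
rewrite /M !mulrDr mulr1; have := normr_ge0 r.
have := ler_wpM2r (normr_ge0 v) ar; have := ler_wpM2r (normr_ge0 w) br; lra.
Qed.

Lemma Schwarz V (U : set V) (f : V -> R) x v w : open U ->
  Ck 2 U f -> U x -> 'D_w ('D_v f) x = 'D_v ('D_w f) x.
Proof.
move=> Uo fk Ux.
have c1 : {for x, continuous ('D_w ('D_v f))} by apply: (Ck_cont (Ck_D w (Ck_D v fk))).
have c2 : {for x, continuous ('D_v ('D_w f))} by apply: (Ck_cont (Ck_D v (Ck_D w fk))).
apply/eqP; rewrite -subr_eq0 -normr_eq0 eq_le normr_ge0 andbT.
apply/ler_addgt0Pr => e e0; rewrite add0r.
have e20 : 0 < e / 2 by rewrite divr_gt0.
have n1 : \forall y \near x, `|'D_w ('D_v f) x - 'D_w ('D_v f) y| <= e / 2.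
  exact: ((cvgrPdist_le _ _).1 c1 _ e20).
have n2 : \forall y \near x, `|'D_v ('D_w f) x - 'D_v ('D_w f) y| <= e / 2.
  exact: ((cvgrPdist_le _ _).1 c2 _ e20).
have nU : \forall y \near x, U y by exact: open_nbhs_nbhs.
have nA : nbhs x (U `&` ((fun y => `|'D_w ('D_v f) x - 'D_w ('D_v f) y| <= e / 2) `&`
    (fun y => `|'D_v ('D_w f) x - 'D_v ('D_w f) y| <= e / 2))).
  exact: filterI nU (filterI n1 n2).
have h1 := near_line v w nA; have h2 := near_line w v nA.
have [d /= d0 dP] := (nbhs_normP _ _).1 (filterI h1 h2).
pose r := d / 2.
have r0 : r != 0 by rewrite gt_eqF// divr_gt0.
have [] := dP r.
  by rewrite /ball_ /= sub0r normrN gtr0_norm ?divr_gt0// /r; lra.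
move=> H1 H2.
have [|a [b [ar br E1]]] := @second_difference _ U f x v w r fk.
  by move=> a b ar br; exact: (H1 a b ar br).1.
have [|a' [b' [ar' br' E2]]] := @second_difference _ U f x w v r fk.
  by move=> a' b' ar' br'; exact: (H2 a' b' ar' br').1.
(* The same second difference, read in both orders, equates the two mixed derivatives at two points
   close to x; continuity then brings both to x. *)
have E : 'D_w ('D_v f) (x + a *: v + b *: w) = 'D_v ('D_w f) (x + a' *: w + b' *: v).
  apply: (mulfI (x := r ^+ 2)); first by rewrite expf_neq0.
  have sw (p q s t : R) : p - q - s + t = p - s - q + t by rewrite [p - q - s]addrAC.
  have vw : x + r *: w + r *: v = x + r *: v + r *: w by exact: addrAC.
  by apply: (etrans (esym E1)); apply: (etrans _ E2); rewrite vw; exact: sw.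
have := (H1 a b ar br).2.1; rewrite E => A1; have A2 := (H2 a' b' ar' br').2.2.
have {}A2 : `|'D_v ('D_w f) (x + a' *: w + b' *: v) - 'D_v ('D_w f) x| <= e / 2 by rewrite distrC.
have := le_trans (ler_normD _ _) (lerD A1 A2); rewrite addrA subrK => H.
by rewrite (splitr e).
Qed.

End Chain.

(** * Differentiation rules with explicit values *)

Section Combinators.
Variables (R : realType) (V : normedModType R).
Implicit Types (f g : V -> R) (x v : V) (a b : R).

Lemma isdD f g x v a b : is_derive x v f a -> is_derive x v g b ->
  is_derive x v (fun y => f y + g y) (a + b).
Proof. exact: is_deriveD. Qed.

Lemma isdN f x v a : is_derive x v f a -> is_derive x v (fun y => - f y) (- a).
Proof. exact: is_deriveN. Qed.

Lemma isdB f g x v a b : is_derive x v f a -> is_derive x v g b ->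
  is_derive x v (fun y => f y - g y) (a - b).
Proof. exact: is_deriveB. Qed.

Lemma isdM f g x v a b : is_derive x v f a -> is_derive x v g b ->
  is_derive x v (fun y => f y * g y) (a * g x + f x * b).
Proof.
by move=> fa gb; have := is_deriveM fa gb; rewrite addrC [g x *: a]mulrC.
Qed.

Lemma isdC x v a : is_derive x v (fun=> a) 0.
Proof. exact: is_derive_cst. Qed.

Lemma isdX f x v a n : is_derive x v f a ->
  is_derive x v (fun y => f y ^+ n.+1) (n.+1%:R * f x ^+ n * a).
Proof.
move=> fa; elim: n => [|n IH].
  by rewrite expr0 mulr1 mul1r.
rewrite (_ : (fun y => _) = (fun y => f y * f y ^+ n.+1)); last first.
  by apply/funext => y; rewrite exprS.
apply: is_derive_eq (isdM fa IH) _.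
by rewrite exprS -[n.+2]addn1 natrD; ring.
Qed.

Lemma isdV f x v a : is_derive x v f a -> f x != 0 ->
  is_derive x v (fun y => (f y)^-1) (- a / f x ^+ 2).
Proof.
move=> [fd fE] f0; split; first exact: derivableV.
by rewrite deriveV// fE -[LHS]/(_ * _) !mulNr mulrC.
Qed.

Lemma isd_sum (I : Type) (r : seq I) (P : pred I) (f : I -> V -> R) x v (a : I -> R) :
  (forall i, P i -> is_derive x v (f i) (a i)) ->
  is_derive x v (fun y => \sum_(i <- r | P i) f i y) (\sum_(i <- r | P i) a i).
Proof.
move=> fa; elim: r => [|i r IH].
  rewrite big_nil (_ : (fun y => _) = (fun=> 0)); first exact: isdC.
  by apply/funext => y; rewrite big_nil.
rewrite big_cons; case: ifP => Pi.
  rewrite (_ : (fun y => _) = (fun y => f i y + \sum_(j <- r | P j) f j y)).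
    by apply: isdD => //; exact: fa.
  by apply/funext => y; rewrite big_cons Pi.
rewrite (_ : (fun y => _) = (fun y => \sum_(j <- r | P j) f j y)) //.
by apply/funext => y; rewrite big_cons Pi.
Qed.

Lemma isd_unique (W : normedModType R) (f : V -> W) x v (a b : W) :
  is_derive x v f a -> is_derive x v f b -> a = b.
Proof. by move=> [_ <-] [_ <-]. Qed.

End Combinators.

Section Combinators1.
Variable R : realType.
Implicit Types (f g : R -> R) (t a b : R).

Lemma isd_sin f t a : is_derive t (1 : R) f a ->
  is_derive t (1 : R) (fun s => sin (f s)) (cos (f t) * a).
Proof. by move=> fa; exact: is_derive_comp1 fa (is_derive_sin _). Qed.

Lemma isd_cos f t a : is_derive t (1 : R) f a ->
  is_derive t (1 : R) (fun s => cos (f s)) (- sin (f t) * a).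
Proof. by move=> fa; exact: is_derive_comp1 fa (is_derive_cos _). Qed.

Lemma isd_exp f t a : is_derive t (1 : R) f a ->
  is_derive t (1 : R) (fun s => expR (f s)) (expR (f t) * a).
Proof. by move=> fa; exact: is_derive_comp1 fa (is_derive_expR _). Qed.

Lemma isd_id t : is_derive t (1 : R) (fun s => s) 1.
Proof. by have := derivableP (@derivable_id R R t 1); rewrite derive_id. Qed.

End Combinators1.

(** * One-variable calculus *)

Section RealLine.
Variable R : realType.
Implicit Types (f g df : R -> R) (a b s t : R).

Lemma within_cont f a b : (forall t, a <= t <= b -> {for t, continuous f}) ->
  {within `[a, b], continuous f}.
Proof.
by move=> fc; apply: continuous_in_subspaceT => t /[1!inE] /=; rewrite in_itv /=; exact: fc.
Qed.

Lemma is_derive_cont f t (d : R) : is_derive t (1 : R) f d -> {for t, continuous f}.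
Proof. by move=> [fd _]; apply/differentiable_continuous/derivable1_diffP. Qed.

Lemma MVT_pt f df a b : a < b ->
  (forall t, a < t < b -> is_derive t (1 : R) f (df t)) ->
  (forall t, a <= t <= b -> {for t, continuous f}) ->
  exists2 c, a < c < b & f b - f a = df c * (b - a).
Proof.
move=> ab fd fc.
have H t : t \in `]a, b[%R -> is_derive t (1 : R) f (df t).
  by rewrite in_itv /=; exact: fd.
have [c] := MVT ab H (within_cont fc).
by rewrite in_itv /= => cab E; exists c.
Qed.

Lemma der_ge0_le f df a b : a <= b ->
  (forall t, a < t < b -> is_derive t (1 : R) f (df t)) ->
  (forall t, a <= t <= b -> {for t, continuous f}) ->
  (forall t, a < t < b -> 0 <= df t) -> f a <= f b.
Proof.
rewrite le_eqVlt => /predU1P[->//|ab] fd fc d0.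
have [c cab E] := MVT_pt ab fd fc.
by rewrite -subr_ge0 E mulr_ge0 ?d0// subr_ge0 ltW.
Qed.

Lemma der_gt0_lt f df a b : a < b ->
  (forall t, a < t < b -> is_derive t (1 : R) f (df t)) ->
  (forall t, a <= t <= b -> {for t, continuous f}) ->
  (forall t, a < t < b -> 0 < df t) -> f a < f b.
Proof.
move=> ab fd fc d0.
have [c cab E] := MVT_pt ab fd fc.
by rewrite -subr_gt0 E mulr_gt0 ?d0// subr_gt0.
Qed.

Lemma der_eq0_cst f df a b : a <= b ->
  (forall t, a < t < b -> is_derive t (1 : R) f (df t)) ->
  (forall t, a <= t <= b -> {for t, continuous f}) ->
  (forall t, a < t < b -> df t = 0) -> f b = f a.
Proof.
rewrite le_eqVlt => /predU1P[->//|ab] fd fc d0.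
have [c cab E] := MVT_pt ab fd fc.
by apply/eqP; rewrite -subr_eq0 E d0// mul0r.
Qed.

Lemma IVT_pt f a b (v : R) : a <= b ->
  (forall t, a <= t <= b -> {for t, continuous f}) -> f a <= v <= f b ->
  exists2 c, a <= c <= b & f c = v.
Proof.
move=> ab fc /andP[av vb].
have [||c] := @IVT R f a b v ab; first exact: within_cont.
  by rewrite ge_min av /= le_max vb orbT.
by rewrite in_itv /= => cab E; exists c.
Qed.

Lemma near_right t (P : R -> Prop) b : (\forall s \near t, P s) -> t < b ->
  exists2 e, t < e <= b & forall s, t <= s <= e -> P s.
Proof.
move=> /nbhs_normP[d /= d0 dP] tb.
exists (Order.min b (t + d / 2)).
  by rewrite lt_min tb ge_min lexx ltrDl divr_gt0.
move=> s; rewrite le_min => /andP[ts /andP[_ sd]]; apply: dP.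
rewrite /ball_ /= distrC ger0_norm ?subr_ge0//; lra.
Qed.

Lemma near_left t (P : R -> Prop) b : (\forall s \near t, P s) -> b < t ->
  exists2 e, b <= e < t & forall s, e <= s <= t -> P s.
Proof.
move=> /nbhs_normP[d /= d0 dP] bt.
exists (Order.max b (t - d / 2)).
  by rewrite gt_max bt le_max lexx /= ltrBlDr ltrDl divr_gt0.
move=> s; rewrite ge_max => /andP[/andP[_ sd] st]; apply: dP.
rewrite /ball_ /= ger0_norm ?subr_ge0//; lra.
Qed.

Lemma cont_gt0_near f t : {for t, continuous f} -> 0 < f t -> \forall s \near t, 0 < f s.
Proof.
move=> fc ft; apply: filterS ((cvgrPdist_lt _ _).1 fc _ ft) => s.
by rewrite ltr_distlC subrr => /andP[].
Qed.

(** t0 is the largest element of the compact set where f is nonnegative. A positive value there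
    would persist a little to the right, against maximality. *)
Lemma last_ge0 f a b : continuous f -> a <= b -> 0 <= f a -> f b < 0 ->
  exists t0, [/\ a <= t0 < b, f t0 = 0 & forall t, t0 < t <= b -> f t < 0].
Proof.
move=> fc ab fa fb.
pose A := `[a, b]%classic `&` f @^-1` [set y | 0 <= y].
have Ac : compact A.
  apply: compact_closedI; first exact: segment_compact.
  by apply: (closed_comp (f := f)) => [t _|]; [exact: fc|exact: closed_ge].
have [||c] := @compact_EVT_max R R id A _ Ac.
- by exists a; split=> //=; rewrite in_itv /= lexx.
- by apply: continuous_subspaceT => t; exact: cvg_id.
rewrite inE => -[/=]; rewrite in_itv /= => /andP[ac cb] fc0 cmax.
have cb' : c < b.
  by rewrite lt_neqAle cb andbT; apply: contraTneq fc0 => ->; rewrite -ltNge.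
have neg t : c < t <= b -> f t < 0.
  move=> /andP[ct tb]; rewrite ltNge; apply/negP => ft.
  have : t <= c.
    by apply: cmax; rewrite inE; split=> //=; rewrite in_itv /= tb (le_trans ac (ltW ct)).
  by rewrite leNgt ct.
exists c; split=> //; first by rewrite ac.
apply/eqP; rewrite eq_le fc0 andbT leNgt; apply/negP => fcp.
have [e /andP[ce eb] eP] := @near_right c _ b (cont_gt0_near (fc c) fcp) cb'.
have := eP e; rewrite (ltW ce) lexx => /(_ isT).
by rewrite ltNge ltW// neg// ce.
Qed.

Lemma first_le0 f a b : continuous f -> a <= b -> 0 < f a -> f b <= 0 ->
  exists t0, [/\ a < t0 <= b, f t0 = 0 & forall t, a <= t < t0 -> 0 < f t].
Proof.
move=> fc ab fa fb.
have [||||t0 [/andP[t0b t0a] ft0 H]] := @last_ge0 (fun t => - f (- t)) (- b) (- a).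
- move=> t; apply: continuousN; apply: continuous_comp; last exact: fc.
  by apply: continuousN; exact: cvg_id.
- by rewrite lerN2.
- by rewrite opprK oppr_ge0.
- by rewrite opprK oppr_lt0.
exists (- t0); split; first by rewrite ltrNr t0a lerNl t0b.
  by apply/eqP; rewrite -oppr_eq0; apply/eqP.
move=> t /andP[at_ tt0]; have := H (- t); rewrite opprK oppr_lt0; apply.
by rewrite ltrNr tt0 lerN2 at_.
Qed.

Lemma antiderivative g a : 0 < a -> continuous g ->
  exists F, (forall t, 0 <= t <= a -> is_derive t (1 : R) F (g t)).
Proof.
move=> a0 gc.
(* Integration over [-1, a + 1] makes 0 and a interior points, so that F has two-sided derivatives
   there. *)
pose F (x : R) := (\int[lebesgue_measure]_(t in [set` `[(-1 : R), x]]) (g t))%R.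
exists F => t /andP[t0 ta].
have H := @continuous_FTC1_closed R g (-1) t (a + 1).
have [||||fd fE] := H.
- lra.
- by apply: continuous_compact_integrable; [exact: segment_compact|exact: continuous_subspaceT].
- lra.
- exact: gc.
by rewrite derive1E in fE; split.
Qed.

(** Retraction of the line onto [0, a]. Composing with it extends functions whose continuity is
    known on the segment only. *)
Definition clamp a t : R := Order.max 0 (Order.min t a).

Lemma clamp_in a t : 0 < a -> 0 <= clamp a t <= a.
Proof.
by move=> a0; rewrite /clamp le_max lexx /= ge_max (ltW a0) /= ge_min lexx orbT.
Qed.

Lemma clamp_id a t : 0 <= t <= a -> clamp a t = t.
Proof. by move=> /andP[t0 ta]; rewrite /clamp min_l// max_r. Qed.

Lemma clamp_cont a : continuous (clamp a).
Proof.
move=> t; apply: (@continuous_max R R (fun=> 0) (fun t => Order.min t a)).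
  exact: cst_continuous.
by apply: (@continuous_min R R id (fun=> a)); [exact: cvg_id|exact: cst_continuous].
Qed.

Lemma comp_clamp_cont a g : 0 < a -> (forall t, 0 <= t <= a -> {for t, continuous g}) ->
  continuous (fun t => g (clamp a t)).
Proof.
move=> a0 gc t; apply: continuous_comp; first exact: clamp_cont.
by apply: gc; exact: clamp_in.
Qed.

End RealLine.

(** * A continuous choice of angle *)

Section Angle.
Variable R : realType.
Implicit Types (u y du dy f : R -> R) (a t : R).

(* A continuous determination of minus the argument of u + i y. *)
Lemma angle u y du dy a : 0 < a ->
  (forall t, 0 <= t <= a -> {for t, continuous u}) ->
  (forall t, 0 <= t <= a -> {for t, continuous y}) ->
  (forall t, 0 <= t <= a -> {for t, continuous du}) ->
  (forall t, 0 <= t <= a -> {for t, continuous dy}) ->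
  (forall t, 0 < t < a -> is_derive t (1 : R) u (du t)) ->
  (forall t, 0 < t < a -> is_derive t (1 : R) y (dy t)) ->
  (forall t, 0 <= t <= a -> 0 < u t ^+ 2 + y t ^+ 2) -> y 0 = 0 ->
  exists al : R -> R, [/\ continuous al, al 0 = 0,
    (forall t, 0 < t < a -> is_derive t (1 : R) al
       ((y t * du t - u t * dy t) / (u t ^+ 2 + y t ^+ 2))) &
    (forall t, 0 <= t <= a ->
      exists W, [/\ W ^+ 2 = u t ^+ 2 + y t ^+ 2, u t = W * cos (al t) & y t = - (W * sin (al t))])].
Proof.
move=> a0 uc yc duc dyc ud yd p0 y0.
pose g t := (y t * du t - u t * dy t) / (u t ^+ 2 + y t ^+ 2).
have cX (h : R -> R) t : {for t, continuous h} -> {for t, continuous (fun t => h t ^+ 2)}.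
  by move=> hc; apply: (@cvgM _ _ _ _ h h).
have gc t : 0 <= t <= a -> {for t, continuous g}.
  move=> ta; apply: cvgM.
    by apply: cvgB; apply: cvgM; [exact: yc|exact: duc|exact: uc|exact: dyc].
  apply: cvgV; first by rewrite gt_eqF// p0.
  by apply: cvgD; apply: cX; [exact: uc|exact: yc].
have [F FD] := antiderivative a0 (comp_clamp_cont a0 gc).
have Fc t : 0 <= t <= a -> {for t, continuous F}.
  by move=> ta; have := FD t ta; exact: is_derive_cont.
pose al t := F (clamp a t) - F 0.
have alE t : 0 <= t <= a -> al t = F t - F 0 by move=> ta; rewrite /al clamp_id.
have zz : 0 <= (0 : R) <= a by rewrite lexx ltW.
have alc : continuous al.
  by move=> t; apply: cvgB; [exact: comp_clamp_cont|exact: cvg_cst].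
have al0 : al 0 = 0 by rewrite alE// subrr.
have ald t : 0 < t < a -> is_derive t (1 : R) al (g t).
  move=> /andP[t0 ta].
  have tt : 0 <= t <= a by rewrite !ltW.
  have H : is_derive t (1 : R) (fun t => F t - F 0) (g t).
    have h1 := FD t tt; rewrite clamp_id// in h1.
    have h2 := is_deriveB h1 (is_derive_cst (F 0) t (1 : R)).
    by rewrite subr0 in h2.
  apply: near_eq_is_derive H.
  near=> s; rewrite alE//; apply/andP; split; near: s.
    by apply: filterS (lt_nbhsr t0) => s /ltW.
  by apply: filterS (lt_nbhsl ta) => s /ltW.
exists al; split=> //.
(* W + i Z is the product of u + i y with exp (i al). It is shown to be real through [Q], which
   starts at 0 and has derivative 0. *)
pose Z t := u t * sin (al t) + y t * cos (al t).
pose W t := u t * cos (al t) - y t * sin (al t).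
pose Q t := Z t ^+ 2 / (u t ^+ 2 + y t ^+ 2).
have sc t : {for t, continuous (fun t => sin (al t))}.
  by apply: continuous_comp; [exact: alc|exact: continuous_sin].
have cc t : {for t, continuous (fun t => cos (al t))}.
  by apply: continuous_comp; [exact: alc|exact: continuous_cos].
have Q0 t : 0 <= t <= a -> Q t = 0.
  move=> /andP[t0 ta].
  have sub s : 0 < s < t -> 0 < s < a by move=> /andP[-> st]; rewrite (lt_le_trans st).
  have <- : Q 0 = 0 by rewrite /Q /Z al0 sin0 y0 mulr0 mul0r addr0 expr0n mul0r.
  apply: (@der_eq0_cst R Q (fun=> 0) 0 t) => // s.
    move=> /sub sa; have ss : 0 <= s <= a by move/andP: sa => [s0 s1]; rewrite !ltW.
    have pn0 : u s ^+ 2 + y s ^+ 2 != 0 by rewrite gt_eqF// p0.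
    have h1 := ud s sa; have h2 := yd s sa; have h3 := ald s sa.
    have hs : is_derive s (1 : R) (fun t => sin (al t)) (cos (al s) * g s).
      exact: isd_sin.
    have hc : is_derive s (1 : R) (fun t => cos (al t)) (- sin (al s) * g s).
      exact: isd_cos.
    have hZ := isdD (isdM h1 hs) (isdM h2 hc).
    have hp := isdD (isdX 1 h1) (isdX 1 h2).
    have hQ := isdM (isdX 1 hZ) (isdV hp pn0).
    by apply: is_derive_eq hQ _; rewrite /g; field.
  move=> /andP[s0 st]; have ss : 0 <= s <= a by rewrite s0 (le_trans st).
  apply: cvgM.
    by apply: cX; apply: cvgD; apply: cvgM; [exact: uc|exact: sc|exact: yc|exact: cc].
  apply: cvgV; first by rewrite gt_eqF// p0.
  by apply: cvgD; apply: cX; [exact: uc|exact: yc].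
move=> t ta; exists (W t).
have Z0 : Z t = 0.
  have := Q0 t ta => /eqP; rewrite mulf_eq0 invr_eq0 (gt_eqF (p0 t ta)) orbF expf_eq0 /=.
  by move/eqP.
have cs := cos2Dsin2 (al t).
split.
- rewrite -[RHS]mulr1 -cs -[LHS]addr0 -[X in _ + X](expr0n _ 2) -Z0 /W /Z; ring.
- rewrite -[LHS]mulr1 -cs -[LHS]subr0 -[X in _ - X](mul0r (sin (al t))) -Z0 /W /Z; ring.
- rewrite -[LHS]mulr1 -cs -[LHS]subr0 -[X in _ - X](mul0r (cos (al t))) -Z0 /W /Z; ring.
Unshelve. all: by end_near. Qed.

End Angle.

(** * The warping function and the radial equation *)

Section Sign.
Variable R : realType.
Implicit Types (f d l e D S H : R -> R) (a t C : R).

Lemma sin_le (x : R) : 0 <= x -> sin x <= x.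
Proof.
move=> x0; rewrite -subr_ge0.
have dd t : 0 < t < x -> is_derive t (1 : R) (fun t => t - sin t) (1 - cos t).
  by move=> _; apply: isdB.
have cc t : 0 <= t <= x -> {for t, continuous (fun t : R => t - sin t)}.
  by move=> _; apply: cvgB; [exact: cvg_id|exact: continuous_sin].
have := der_ge0_le x0 dd cc; rewrite sin0 subrr; apply=> t _.
by rewrite subr_ge0 cos_le1.
Qed.

(* If d' = l sin d + e with e >= 0 and l bounded above just to the right of the
   zeros of d, Gronwall's inequality prevents d from becoming negative. *)
Lemma stays_ge0 d l e a : 0 < a -> continuous d -> d 0 = 0 ->
  (forall t, 0 < t < a -> is_derive t (1 : R) d (l t * sin (d t) + e t)) ->
  (forall t, 0 < t < a -> 0 <= e t) ->
  (forall t0, 0 <= t0 < a -> d t0 = 0 -> exists C, exists2 b, t0 < b <= a &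
     forall t, t0 < t < b -> l t <= C) ->
  forall t, 0 <= t <= a -> 0 <= d t.
Proof.
move=> a0 dc d0 dd e0 lC t1 /andP[t10 t1a]; rewrite leNgt; apply/negP => dt1.
have [|t0 [/andP[t00 t01] dt0 neg]] := @last_ge0 R d 0 t1 dc t10 _ dt1; first by rewrite d0.
have [|C0 [b /andP[tb ba] CP]] := lC t0 _ dt0; first by rewrite t00 (lt_le_trans t01).
pose C := Order.max 0 C0.
have CC t : t0 < t < b -> l t <= C by move=> /CP h; rewrite le_max h orbT.
have C_ge0 : 0 <= C by rewrite le_max lexx.
have npi : \forall t \near t0, 0 < d t + pi.
  apply: (@cont_gt0_near R (fun t => d t + pi)); last by rewrite dt0 add0r pi_gt0.
  by apply: cvgD; [exact: dc|exact: cvg_cst].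
have t0m : t0 < Order.min b t1 by rewrite lt_min tb.
have [t2 /andP[t02 t2m] dpi] := near_right npi t0m.
move: t2m; rewrite le_min => /andP[t2b t21].
have rng t : t0 < t < t2 -> [/\ 0 < t < a, t0 < t < b, d t < 0 & - pi < d t].
  move=> /andP[tt0 tt2]; split.
  - by rewrite (le_lt_trans t00 tt0) (lt_le_trans tt2)// (le_trans t21).
  - by rewrite tt0 (lt_le_trans tt2).
  - by apply: neg; rewrite tt0 (le_trans (ltW tt2)).
  - by have := dpi t; rewrite !ltW// => /(_ isT); lra.
(* On ]t0, t2[ one has - pi < d < 0, hence d <= sin d <= 0 and d' >= C sin d >= C d. So d exp (- C
   t) does not decrease from its value 0 at t0, which is impossible for d < 0. *)
have : d t0 * expR (- C * t0) <= d t2 * expR (- C * t2).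
  apply: (@der_ge0_le R (fun t => d t * expR (- C * t))
    (fun t => (l t * sin (d t) + e t) * expR (- C * t) + d t * (expR (- C * t) * (- C)))).
  - exact: ltW.
  - move=> t /rng[ta _ _ _]; apply: isdM; first exact: dd.
    apply: isd_exp; apply: is_derive_eq (isdM (isdC t (1 : R) (- C)) (isd_id t)) _.
    by rewrite mul0r add0r mulr1.
  - move=> t _; apply: cvgM; first exact: dc.
    apply: continuous_comp; last exact: continuous_expR.
    by apply: cvgM; [exact: cvg_cst|exact: cvg_id].
  - move=> t /rng[ta tb' dn dp].
    have E : 0 < expR (- C * t) by exact: expR_gt0.
    have sn : sin (d t) <= 0.
      by rewrite -oppr_ge0 -sinN sin_ge0_pi// oppr_ge0 ltW//= lerNl ltW.
    have sd : d t <= sin (d t).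
      by rewrite -lerN2 -sinN sin_le// oppr_ge0 ltW.
    have h1 : C * sin (d t) <= l t * sin (d t) by rewrite ler_wnM2r// CC.
    have h2 : C * d t <= C * sin (d t) by rewrite ler_wpM2l.
    rewrite (_ : _ + _ = expR (- C * t) * (l t * sin (d t) + e t - C * d t)); last by ring.
    by apply: mulr_ge0; [exact: ltW|have := e0 t ta; lra].
rewrite dt0 mul0r leNgt pmulr_llt0 ?expR_gt0//.
by rewrite neg// t02 t21.
Qed.

(** The counterpart of [stays_ge0] for the right end. A positive value of d cannot return to 0,
    because l is bounded below just to the left of the zeros of d; [d a = 0] thus excludes positive
    values. *)
Lemma stays_gt0 d l e a : 0 < a -> continuous d ->
  (forall t, 0 < t < a -> is_derive t (1 : R) d (l t * sin (d t) + e t)) ->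
  (forall t, 0 < t < a -> 0 <= e t) ->
  (forall t0, 0 < t0 <= a -> d t0 = 0 -> exists C, exists2 b, 0 <= b < t0 &
     forall t, b < t < t0 -> C <= l t) ->
  d a = 0 -> forall t, 0 <= t <= a -> d t <= 0.
Proof.
move=> a0 dc dd e0 lC da t1 /andP[t10 t1a]; rewrite leNgt; apply/negP => dt1.
have [|t0 [/andP[t01 t0a] dt0 pos]] := @first_le0 R d t1 a dc t1a dt1; first by rewrite da.
have [|C0 [b /andP[b0 bt] CP]] := lC t0 _ dt0; first by rewrite (le_lt_trans t10 t01).
pose C := Order.max 0 (- C0).
have CC t : b < t < t0 -> - C <= l t.
  by move=> /CP h; apply: le_trans h; rewrite lerNl le_max lexx orbT.
have C_ge0 : 0 <= C by rewrite le_max lexx.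
have npi : \forall t \near t0, 0 < pi - d t.
  apply: (@cont_gt0_near R (fun t => pi - d t)); last by rewrite dt0 subr0 pi_gt0.
  by apply: cvgB; [exact: cvg_cst|exact: dc].
have t0m : Order.max b t1 < t0 by rewrite gt_max bt.
have [t2 /andP[t2m t20] dpi] := near_left npi t0m.
move: t2m; rewrite ge_max => /andP[t2b t21].
have rng t : t2 < t < t0 -> [/\ 0 < t < a, b < t < t0, 0 < d t & d t < pi].
  move=> /andP[tt2 tt0]; split.
  - by rewrite (le_lt_trans _ tt2) ?(le_trans t10)//= (lt_le_trans tt0).
  - by rewrite tt0 (le_lt_trans t2b).
  - by apply: pos; rewrite tt0 (le_trans t21)// ltW.
  - by have := dpi t; rewrite !ltW// => /(_ isT); lra.
have : d t2 * expR (C * t2) <= d t0 * expR (C * t0).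
  apply: (@der_ge0_le R (fun t => d t * expR (C * t))
    (fun t => (l t * sin (d t) + e t) * expR (C * t) + d t * (expR (C * t) * C))).
  - exact: ltW.
  - move=> t /rng[ta _ _ _]; apply: isdM; first exact: dd.
    apply: isd_exp; apply: is_derive_eq (isdM (isdC t (1 : R) C) (isd_id t)) _.
    by rewrite mul0r add0r mulr1.
  - move=> t _; apply: cvgM; first exact: dc.
    apply: continuous_comp; last exact: continuous_expR.
    by apply: cvgM; [exact: cvg_cst|exact: cvg_id].
  - move=> t /rng[ta tb' dn dp].
    have E : 0 < expR (C * t) by exact: expR_gt0.
    have sn : 0 <= sin (d t) by rewrite sin_ge0_pi// !ltW.
    have sd : sin (d t) <= d t by rewrite sin_le// ltW.
    have h1 : - C * sin (d t) <= l t * sin (d t) by rewrite ler_wpM2r// CC.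
    have h2 : C * sin (d t) <= C * d t by rewrite ler_wpM2l.
    rewrite (_ : _ + _ = expR (C * t) * (l t * sin (d t) + e t + C * d t)); last by ring.
    by apply: mulr_ge0; [exact: ltW|have := e0 t ta; lra].
rewrite dt0 mul0r leNgt pmulr_lgt0 ?expR_gt0//.
by rewrite pos// t21 t20.
Qed.

Lemma cont_bounded f t : {for t, continuous f} ->
  \forall s \near t, `|f s| <= `|f t| + 1.
Proof.
move=> fc; apply: filterS ((cvgrPdist_le _ _).1 fc _ ltr01) => s h.
rewrite -[f s](subrK (f t)) addrC; apply: le_trans (ler_normD _ _) _.
by rewrite lerD2l distrC.
Qed.

End Sign.

(** * Zeros of the sine *)

Section SinZeros.
Variable R : realType.
Implicit Types x : R.

Lemma sinD_natpi x (j : nat) : `|sin (x + j%:R * pi)| = `|sin x|.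
Proof.
elim: j => [|j IH]; first by rewrite mul0r addr0.
by rewrite -[j.+1]addn1 natrD mulrDl mul1r addrA sinDpi normrN.
Qed.

Lemma sinD_intpi x (j : int) : `|sin (x + j%:~R * pi)| = `|sin x|.
Proof.
case: j => j; first exact: sinD_natpi.
by rewrite NegzE mulrNz mulNr -(sinD_natpi _ j.+1) subrK.
Qed.

Lemma sin_eq0_int x : sin x = 0 -> exists j : int, x = j%:~R * pi.
Proof.
move=> sx; have p0 : (0 : R) < pi by exact: pi_gt0.
exists (Num.floor (x / pi)); set j := Num.floor _.
pose y := x - j%:~R * pi.
have /andP[l u] : j%:~R <= x / pi < (j + 1)%:~R by rewrite floor_le_tmp floorD1_gt.
have y0 : 0 <= y by rewrite subr_ge0 -ler_pdivlMr.
have yp : y < pi.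
  by move: u; rewrite intrD ltr_pdivrMr// mulrDl mul1r /y; lra.
have sy : sin y = 0.
  apply/eqP; rewrite -normr_eq0.
  by rewrite -(sinD_intpi _ j) subrK sx normr0.
have : ~~ (0 < y).
  by apply/negP => y1; have := sin_gt0_pi (introT andP (conj y1 yp)); rewrite sy ltxx.
rewrite -leNgt => y2; have /eqP : y = 0 by apply/eqP; rewrite eq_le y0 y2.
by rewrite subr_eq0 => /eqP.
Qed.

End SinZeros.

(* The Gegenbauer polynomial of degree k on S^n, normalized at the pole and
   written in the variable 1 - cos. *)
Section Gegenbauer.
Variables (R : realType) (n : nat).
Hypothesis n0 : (0 < n)%N.

(** The eigenvalue of spherical harmonics of degree k on the unit n-sphere; curvature c multiplies
    it by c. *)
Definition geg_eig (k : nat) : R := k%:R * (k%:R + n%:R - 1).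

(** The power series solution at 0 of the equation in [geg_ode]. The factor [geg_eig k - geg_eig i']
    stops it after degree k. *)
Fixpoint geg_coef (k i : nat) : R :=
  if i is i'.+1 then
    - (geg_eig k - geg_eig i') * geg_coef k i' / (i'.+1%:R * (2 * i'%:R + n%:R))
  else 1.

Definition geg (k : nat) : {poly R} := \poly_(i < k.+1) geg_coef k i.

Lemma geg_coef_gt k i : (k < i)%N -> geg_coef k i = 0.
Proof.
elim: i => [//|i IH]; rewrite ltnS leq_eqVlt => /predU1P[->|/IH/= ->].
  by rewrite /= subrr oppr0 !mul0r.
by rewrite mulr0 mul0r.
Qed.

Lemma coef_geg k i : (geg k)`_i = geg_coef k i.
Proof.
rewrite coef_poly; case: ltnP => // ki; by rewrite geg_coef_gt.
Qed.

Lemma geg_neq0 k : geg k != 0.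
Proof. by apply/eqP => /(congr1 (fun p : {poly R} => p`_0)); rewrite coef_geg coef0 /=; apply/eqP/oner_neq0. Qed.

Lemma geg_horner0 k : (geg k).[0] = 1.
Proof. by rewrite horner_coef0 coef_geg. Qed.

Lemma geg_ode k : 'X * (2%:P - 'X) * (geg k)^`()^`() + n%:R%:P * (1 - 'X) * (geg k)^`() +
  (geg_eig k)%:P * geg k = 0.
Proof.
apply/polyP => i; rewrite coef0.
rewrite (_ : _ + _ + _ = (2%:P * ('X * (geg k)^`()^`()) - 'X * ('X * (geg k)^`()^`())) +
  (n%:R%:P * (geg k)^`() - n%:R%:P * ('X * (geg k)^`())) + (geg_eig k)%:P * geg k); last by ring.
rewrite !(coefD, coefN, coefCM, coefXM, coef_deriv, coef_geg).
have rec j : j.+1%:R * (2 * j%:R + n%:R) * geg_coef k j.+1 = - (geg_eig k - geg_eig j) * geg_coef k j.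
  rewrite /= [RHS]mulrC; field.
  have h1 : 0 < (n%:R : R) by rewrite ltr0n.
  have h2 : 0 <= (j%:R : R) by [].
  by apply/andP; split; rewrite gt_eqF//; lra.
move: (geg_coef k) rec => b rec.
have fin j A : A = j.+1%:R * (2 * j%:R + n%:R) * b j.+1 + (geg_eig k - geg_eig j) * b j -> A = 0.
  by move=> ->; rewrite rec; ring.
case: i => [|[|i]] /=; [apply: (fin 0%N)|apply: (fin 1%N)|apply: (fin i.+2)]; rewrite /geg_eig; ring.
Qed.

Lemma geg_odeE k x : x * (2 - x) * (geg k)^`()^`().[x] + n%:R * (1 - x) * (geg k)^`().[x] +
  geg_eig k * (geg k).[x] = 0.
Proof. by have := congr1 (fun p : {poly R} => p.[x]) (geg_ode k); rewrite !hornerE. Qed.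

End Gegenbauer.

(** * Pruefer angles along the profile of a warped product *)

Section Profile.
Variables (R : realType) (a : R) (f f1 f2 : R -> R) (k : R).
Implicit Types (t : R) (D u y dy al be e d S : R -> R) (lam : R).
Hypothesis a0 : 0 < a.
Hypothesis fd : forall t, is_derive t (1 : R) f (f1 t).
Hypothesis f1d : forall t, is_derive t (1 : R) f1 (f2 t).
Hypothesis f2c : continuous f2.
Hypothesis fp : forall t, 0 < t < a -> 0 < f t.
Hypothesis f00 : f 0 = 0.
Hypothesis f10 : f1 0 = 1.
Hypothesis fa0 : f a = 0.
Hypothesis f1a : f1 a = -1.
Hypothesis f2n : forall t, 0 < t < a -> f2 t < 0.
Hypothesis k0 : 0 <= k.

Lemma f_cont : continuous f. Proof. by move=> t; exact: is_derive_cont (fd t). Qed.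
Lemma f1_cont : continuous f1. Proof. by move=> t; exact: is_derive_cont (f1d t). Qed.

(** The coefficient l in d' = l sin d + e, when d is a difference of two Pruefer angles, S is their
    sum and [kap] is 1 - lam; see [pruefer_diff]. *)
Definition slope (kap : R) D S t := D t * (kap * sin (S t) - k * (f1 t / f t) * cos (S t)).

Lemma slope_cont kap D S t : 0 < t < a -> {for t, continuous D} -> continuous S ->
  {for t, continuous (slope kap D S)}.
Proof.
move=> ta Dc Sc; apply: cvgM; first exact: Dc.
apply: cvgB.
  apply: cvgM; first exact: cvg_cst.
  by apply: continuous_comp; [exact: Sc|exact: continuous_sin].
apply: cvgM; last by apply: continuous_comp; [exact: Sc|exact: continuous_cos].
apply: cvgM; first exact: cvg_cst.
apply: cvgM; first exact: f1_cont.
by apply: cvgV; [rewrite gt_eqF// fp|exact: f_cont].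
Qed.

Lemma cos_near1 S t : continuous S -> cos (S t) = 1 -> \forall s \near t, 0 < cos (S s).
Proof.
move=> Sc St; apply: (@cont_gt0_near R (fun s => cos (S s))); last by rewrite St.
by apply: continuous_comp; [exact: Sc|exact: continuous_cos].
Qed.

Lemma slope_term kap D S t C : 0 <= D t -> `|D t| <= C -> 0 <= C ->
  `|D t * (kap * sin (S t))| <= C * `|kap|.
Proof.
move=> D0 DC C0; rewrite !normrM ler_pM//.
by rewrite ler_piMr ?sin_max.
Qed.

(** Inside the interval [slope] is continuous. Near the pole 0, f'/f is large and positive and cos S
    is positive, so the singular term enters [slope] negatively and an upper bound, which is all
    [stays_ge0] asks for, survives. *)
Lemma compare_ge kap D S d e :
  (forall t, 0 <= t <= a -> {for t, continuous D}) ->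
  (forall t, 0 < t < a -> 0 <= D t) ->
  continuous S -> cos (S 0) = 1 -> continuous d -> d 0 = 0 ->
  (forall t, 0 < t < a -> is_derive t (1 : R) d (slope kap D S t * sin (d t) + e t)) ->
  (forall t, 0 < t < a -> 0 <= e t) ->
  forall t, 0 <= t <= a -> 0 <= d t.
Proof.
move=> Dc D0 Sc S0 dc d0 dd e0; apply: (stays_ge0 a0 dc d0 dd e0) => t0 /andP[t00 t0a] _.
move: t00; rewrite le_eqVlt => /predU1P[t00|t00]; last first.
  have ta : 0 < t0 < a by rewrite t00.
  have lc : {for t0, continuous (slope kap D S)}.
    by apply: slope_cont => //; apply: Dc; rewrite !ltW.
  have [b tb P] := near_right (cont_bounded lc) t0a.
  exists (`|slope kap D S t0| + 1); exists b => // t /andP[t1 t2].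
  by apply: le_trans (ler_norm _) _; apply: P; rewrite !ltW.
have zz : 0 <= (0 : R) <= a by rewrite lexx ltW.
have n1 := cont_bounded (Dc 0 zz).
have n2 := cos_near1 Sc S0.
have n3 : \forall t \near (0 : R), 0 < f1 t by apply: cont_gt0_near; [exact: f1_cont|rewrite f10].
have [b tb P] := near_right (filterI n1 (filterI n2 n3)) a0.
exists ((`|D 0| + 1) * `|kap|); exists b => //; first by rewrite -t00.
move=> t; rewrite -t00 => /andP[t1 t2].
have ta : 0 < t < a by rewrite t1 (lt_le_trans t2)//; case/andP: tb.
have [p1 [p2 p3]] := P t (introT andP (conj (ltW t1) (ltW t2))).
rewrite /slope mulrBr; apply: (@le_trans _ _ (D t * (kap * sin (S t)))).
  rewrite gerBl; apply: mulr_ge0; first exact: D0.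
  apply: mulr_ge0; last exact: ltW.
  by apply: mulr_ge0 => //; rewrite ltW// divr_gt0// fp.
by apply: le_trans (ler_norm _) _; apply: slope_term; rewrite ?D0// addr_ge0.
Qed.

(** Near the pole a the quotient f'/f is large and negative. As cos S is positive there, [slope] is
    bounded below, which is the side required by [stays_gt0]. *)
Lemma compare_le kap D S d e :
  (forall t, 0 <= t <= a -> {for t, continuous D}) ->
  (forall t, 0 < t < a -> 0 <= D t) ->
  continuous S -> cos (S a) = 1 -> continuous d -> d a = 0 ->
  (forall t, 0 < t < a -> is_derive t (1 : R) d (slope kap D S t * sin (d t) + e t)) ->
  (forall t, 0 < t < a -> 0 <= e t) ->
  forall t, 0 <= t <= a -> d t <= 0.
Proof.
move=> Dc D0 Sc Sa dc da dd e0; apply: (stays_gt0 a0 dc dd e0) => // t0 /andP[t00 t0a] _.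
move: t0a; rewrite le_eqVlt => /predU1P[t0a|t0a]; last first.
  have ta : 0 < t0 < a by rewrite t00.
  have lc : {for t0, continuous (slope kap D S)}.
    by apply: slope_cont => //; apply: Dc; rewrite !ltW.
  have [b tb P] := near_left (cont_bounded lc) t00.
  exists (- (`|slope kap D S t0| + 1)); exists b => // t /andP[t1 t2].
  by rewrite lerNl; apply: le_trans (ler_norm _) _; rewrite normrN; apply: P; rewrite !ltW.
have aa : 0 <= a <= a by rewrite lexx ltW.
have n1 := cont_bounded (Dc a aa).
have n2 := cos_near1 Sc Sa.
have n3 : \forall t \near a, 0 < - f1 t.
  apply: (@cont_gt0_near R (fun t => - f1 t)); first by apply: cvgN; exact: f1_cont.
  by rewrite f1a opprK.
have [b tb P] := near_left (filterI n1 (filterI n2 n3)) a0.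
exists (- ((`|D a| + 1) * `|kap|)); exists b => //; first by rewrite t0a.
move=> t; rewrite t0a => /andP[t1 t2].
have ta : 0 < t < a by rewrite t2 andbT (le_lt_trans _ t1)//; case/andP: tb.
have [p1 [p2 p3]] := P t (introT andP (conj (ltW t1) (ltW t2))).
rewrite /slope mulrBr; apply: (@le_trans _ _ (D t * (kap * sin (S t)))).
  rewrite lerNl; apply: le_trans (ler_norm _) _; rewrite normrN.
  by apply: slope_term; rewrite ?D0// addr_ge0.
rewrite lerDl -mulrN -mulNr -mulrN -mulNr.
by rewrite !mulr_ge0 ?D0// ?(ltW p3)// ?(ltW p2)// ltW// invr_gt0 fp.
Qed.

(** The derivative of the angle x for the system u' = y, y' = - k (f'/f) y - lam u, in the polar
    form u = W cos x, y = - W sin x. *)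
Definition pruefer lam t x := sin x ^+ 2 - k * (f1 t / f t) * (sin x * cos x) + lam * cos x ^+ 2.

(** A quadratic form in cos x and sin x is a combination of 1, cos 2x and sin 2x, so a difference of
    two values contains the factor sin (x - z). *)
Lemma pruefer_diff lam t x z : pruefer lam t x - pruefer lam t z =
  sin (x - z) * ((1 - lam) * sin (x + z) - k * (f1 t / f t) * cos (x + z)).
Proof.
rewrite /pruefer sinB sinD cosD.
have := cos2Dsin2 x; have := cos2Dsin2 z.
set sx := sin x; set cx := cos x; set sz := sin z; set cz := cos z; set H := f1 t / f t.
move=> /eqP; rewrite -subr_eq0 => /eqP Ez /eqP; rewrite -subr_eq0 => /eqP Ex.
apply/eqP; rewrite -subr_eq0; apply/eqP.
(* Multiplying each form by cos^2 + sin^2 of the other angle makes the identity homogeneous, hence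
   polynomial. *)
transitivity ((sz ^+ 2 - k * H * (sz * cz) + lam * cz ^+ 2) * (cx ^+ 2 + sx ^+ 2 - 1)
  - (sx ^+ 2 - k * H * (sx * cx) + lam * cx ^+ 2) * (cz ^+ 2 + sz ^+ 2 - 1)); first by ring.
by rewrite Ex Ez !mulr0 subr0.
Qed.

Lemma zero_deriv d e t : (forall t, 0 <= t <= a -> d t = 0) -> 0 < t < a ->
  is_derive t (1 : R) d (e t) -> e t = 0.
Proof.
move=> dz /andP[t0 ta] dd.
apply: (isd_unique dd); apply: near_eq_is_derive (isdC t (1 : R) (0 : R)).
near=> s; apply/esym/dz; apply/andP; split; near: s.
  by apply: filterS (lt_nbhsr t0) => s /ltW.
by apply: filterS (lt_nbhsl ta) => s /ltW.
Unshelve. all: by end_near. Qed.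

(* [s] is a sign, so that both comparisons are treated at once. *)
Lemma pruefer_compare lam D al be e (s : bool) :
  (forall t, 0 <= t <= a -> {for t, continuous D}) ->
  (forall t, 0 < t < a -> 0 <= D t) ->
  continuous al -> continuous be -> al 0 = 0 -> be 0 = 0 ->
  (forall t, 0 < t < a -> is_derive t (1 : R) be (D t * pruefer lam t (be t))) ->
  (forall t, 0 < t < a -> is_derive t (1 : R) al (D t * pruefer lam t (al t) + e t)) ->
  (forall t, 0 < t < a -> 0 <= (-1) ^+ s * e t) ->
  (forall t, 0 <= t <= a -> 0 <= (-1) ^+ s * (al t - be t)) /\
  (al a = be a -> cos (al a + be a) = 1 -> forall t, 0 < t < a -> e t = 0).
Proof.
move=> Dc D0 alc bec al0 be0 bed ald e0.
pose S t := al t + be t; pose d t := (-1) ^+ s * (al t - be t).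
have Sc : continuous S by move=> t; apply: cvgD; [exact: alc|exact: bec].
have dc : continuous d.
  by move=> t; apply: cvgM; [exact: cvg_cst|apply: cvgB; [exact: alc|exact: bec]].
have sgn_sin x : sin ((-1) ^+ s * x) = (-1) ^+ s * sin x.
  by case: s {d dc e0}; rewrite ?expr0 ?expr1 ?mul1r// !mulN1r sinN.
have dd t : 0 < t < a -> is_derive t (1 : R) d
    (slope (1 - lam) D S t * sin (d t) + (-1) ^+ s * e t).
  move=> ta; apply: is_derive_eq (isdM (isdC t (1 : R) ((-1) ^+ s)) (isdB (ald t ta) (bed t ta))) _.
  rewrite mul0r add0r /d sgn_sin addrAC -mulrBr pruefer_diff /slope /S; ring.
have S0 : cos (S 0) = 1 by rewrite /S al0 be0 addr0 cos0.
have d0 : d 0 = 0 by rewrite /d al0 be0 subrr mulr0.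
have ge := compare_ge Dc D0 Sc S0 dc d0 dd e0.
(* When the angles also agree at a, the comparison run from the right end gives the opposite
   inequality. Then d vanishes identically, and its equation leaves e = 0. *)
split=> // E Sa t ta.
have da : d a = 0 by rewrite /d E subrr mulr0.
have le := compare_le Dc D0 Sc Sa dc da dd e0.
have dz r : 0 <= r <= a -> d r = 0 by move=> ra; apply/eqP; rewrite eq_le le// ge.
have := zero_deriv (e := fun t => slope (1 - lam) D S t * sin (d t) + (-1) ^+ s * e t) dz ta (dd t ta).
have tt : 0 <= t <= a by case/andP: ta => h1 h2; rewrite !ltW.
by rewrite dz// sin0 mulr0 add0r => /eqP; rewrite mulf_eq0 signr_eq0 /= => /eqP.
Qed.

Lemma f1_ge0_before t s : 0 <= s <= t -> t <= a -> 0 <= f1 t -> 0 <= f1 s.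
Proof.
move=> /andP[s0 st] ta f1t; apply: le_trans f1t _.
rewrite -lerN2; apply: (@der_ge0_le R (fun t => - f1 t) (fun t => - f2 t)) => //.
- by move=> r _; apply: cvgN; exact: f1_cont.
- by move=> r /andP[r1 r2]; rewrite oppr_ge0 ltW// f2n// (le_lt_trans s0)//= (lt_le_trans r2).
Qed.

(** The common form of the equation for phi, with D = 1 and y = phi', and of the transplanted zonal
    harmonics, with D = [speed]. The equation is multiplied by f and does not determine y' at the
    poles, whence the separate function [dy]. *)
Record radial_system lam D u y dy : Prop := RadialSystem {
  rs_Dc : forall t, 0 <= t <= a -> {for t, continuous D};
  rs_uc : forall t, 0 <= t <= a -> {for t, continuous u};
  rs_yc : forall t, 0 <= t <= a -> {for t, continuous y};
  rs_dyc : forall t, 0 <= t <= a -> {for t, continuous dy};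
  rs_D0 : forall t, 0 < t < a -> 0 <= D t;
  rs_Db : exists q : nat, forall t, 0 < t < a -> 2 * k * D t <= q%:R;
  rs_ud : forall t, 0 < t < a -> is_derive t (1 : R) u (D t * y t);
  rs_yd : forall t, 0 < t < a -> is_derive t (1 : R) y (dy t);
  rs_eq : forall t, 0 < t < a -> f t * dy t = - D t * (k * f1 t * y t + lam * f t * u t);
  rs_u0 : u 0 != 0;
  rs_y0 : y 0 = 0 }.

(** The energy [E] = y^2 + lam u^2 satisfies f E' = - 2 k D f' y^2. While f' >= 0 it may decrease,
    but f^(q+1) E does not, since q bounds 2 k D; once f' <= 0, [E] itself does not decrease.
    Concavity of f makes these the only two phases. *)
Lemma radial_nonvanishing lam D u y dy : 0 < lam -> radial_system lam D u y dy ->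
  forall t, 0 <= t <= a -> 0 < u t ^+ 2 + y t ^+ 2.
Proof.
move=> lam0 [Dc uc yc dyc D0 [q qD] ud yd eq u0 y0].
pose E t := y t ^+ 2 + lam * u t ^+ 2.
have cX (h : R -> R) t : {for t, continuous h} -> {for t, continuous (fun t => h t ^+ 2)}.
  by move=> hc; apply: (@cvgM _ _ _ _ h h).
have Ec t : 0 <= t <= a -> {for t, continuous E}.
  move=> ta; apply: cvgD; first by apply: cX; exact: yc.
  by apply: cvgM; [exact: cvg_cst|apply: cX; exact: uc].
suff Ep : forall t, 0 <= t <= a -> 0 < E t.
  move=> t ta; rewrite lt_neqAle eq_sym addr_ge0 ?sqr_ge0// andbT.
  apply/negP => /eqP h; have := Ep t ta.
  have := sqr_ge0 (u t); have := sqr_ge0 (y t) => h1 h2.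
  have hu : u t ^+ 2 = 0 by lra.
  have hy : y t ^+ 2 = 0 by lra.
  by rewrite /E hu hy mulr0 addr0 ltxx.
pose dE t := 2 * y t * dy t + lam * (2 * u t * (D t * y t)).
have Ed t : 0 < t < a -> is_derive t (1 : R) E (dE t).
  move=> ta; have h := isdD (isdX 1 (yd t ta)) (isdM (isdC t (1 : R) lam) (isdX 1 (ud t ta))).
  by apply: is_derive_eq h _; rewrite /dE; ring.
have fdE t : 0 < t < a -> f t * dE t = - (2 * k * D t) * f1 t * y t ^+ 2.
  move=> ta; rewrite /dE; transitivity (2 * y t * (f t * dy t) + lam * f t * (2 * u t * (D t * y t))); first by ring.
  by rewrite eq//; ring.
have E0 : 0 < E 0.
  by rewrite /E y0 expr0n add0r mulr_gt0// lt_neqAle eq_sym sqrf_eq0 u0 sqr_ge0.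
have zz : 0 <= (0 : R) <= a by rewrite lexx ltW.
have up t : 0 <= t <= a -> 0 <= f1 t -> 0 < E t.
  move=> /andP[]; rewrite le_eqVlt => /predU1P[<-//|t0] ta f1t.
  have ta' : t < a.
    by rewrite lt_neqAle ta andbT; apply: contraTneq f1t => ->; rewrite f1a -ltNge oppr_lt0.
  (* f^(q+1) E vanishes at the pole, so monotonicity has to start from a point b > 0, where [E] is
     still positive by continuity. *)
  have [b /andP[b0 bt] bP] := near_right (cont_gt0_near (Ec 0 zz) E0) t0.
  have ba : 0 < b < a by rewrite b0 (le_lt_trans bt).
  have Mle : f b ^+ q.+1 * E b <= f t ^+ q.+1 * E t.
    apply: (@der_ge0_le R (fun t => f t ^+ q.+1 * E t)
      (fun t => (q.+1%:R * f t ^+ q * f1 t) * E t + f t ^+ q.+1 * dE t)) => //.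
    - move=> s /andP[s1 s2]; apply: isdM; first exact: isdX.
      by apply: Ed; rewrite (lt_trans b0 s1) (lt_trans s2).
    - move=> s /andP[s1 s2]; apply: cvgM; last first.
        by apply: Ec; rewrite (le_trans (ltW b0) s1) (le_trans s2)// ltW.
      exact: is_derive_cont (isdX q (fd s)).
    - move=> s /andP[s1 s2].
      have sa : 0 < s < a by rewrite (lt_trans b0 s1) (lt_trans s2).
      rewrite (_ : _ + _ = f s ^+ q * (q.+1%:R * f1 s * E s + f s * dE s)); last by rewrite exprS; ring.
      rewrite fdE// (_ : _ + _ = f1 s * (q.+1%:R * E s - 2 * k * D s * y s ^+ 2)); last by ring.
      have f1s : 0 <= f1 s by apply: (@f1_ge0_before t) => //; rewrite !ltW// (lt_trans b0).
      rewrite mulr_ge0 ?exprn_ge0//; first by rewrite ltW// fp.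
      rewrite mulr_ge0// subr_ge0; apply: (@le_trans _ _ (q.+1%:R * y s ^+ 2)).
        by rewrite ler_wpM2r ?sqr_ge0//; apply: le_trans (qD s sa) _; rewrite ler_nat.
      by rewrite ler_wpM2l// lerDl mulr_ge0 ?sqr_ge0// ltW.
  have fb : 0 < f b by exact: fp.
  have : 0 < f b ^+ q.+1 * E b.
    by rewrite mulr_gt0 ?exprn_gt0// bP// lexx ltW.
  move=> /lt_le_trans/(_ Mle); rewrite pmulr_rgt0// exprn_gt0// fp//.
  by rewrite t0.
move=> t /andP[t0 ta]; have [f1t|f1t] := leP 0 (f1 t); first by apply: up => //; rewrite t0.
(* c is the summit of the profile, where the first phase hands over to the second. *)
have [|c /andP[c0 ct] fc] := @IVT_pt R (fun t => - f1 t) 0 t 0 t0 (fun s _ => cvgN (@f1_cont s)).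
  by rewrite f10 lerN10 /= oppr_ge0 ltW.
have f1c : f1 c = 0 by apply/eqP; rewrite -oppr_eq0; apply/eqP.
have Epc : 0 < E c by apply: up; rewrite ?f1c// c0 (le_trans ct).
apply: lt_le_trans Epc _.
have f1s s : c < s < t -> f1 s <= 0.
  move=> /andP[s1 s2]; rewrite leNgt; apply/negP => h.
  have : f1 s < f1 c.
    rewrite -ltrN2; apply: (@der_gt0_lt R (fun t => - f1 t) (fun t => - f2 t)) => //.
    - by move=> r _; apply: cvgN; exact: f1_cont.
    - by move=> r /andP[r1 r2]; rewrite oppr_gt0 f2n// (le_lt_trans c0 r1) (lt_le_trans (lt_trans r2 s2)).
  by rewrite f1c => /lt_trans/(_ h); rewrite ltxx.
apply: (der_ge0_le (df := dE)) => //.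
- by move=> s /andP[s1 s2]; apply: Ed; rewrite (le_lt_trans c0 s1) (lt_le_trans s2).
- by move=> s /andP[s1 s2]; apply: Ec; rewrite (le_trans c0 s1) (le_trans s2).
- move=> s sct; have /andP[s1 s2] := sct.
  have sa : 0 < s < a by rewrite (le_lt_trans c0 s1) (lt_le_trans s2).
  rewrite -(pmulr_rge0 _ (fp sa)) fdE// mulNr mulNr oppr_ge0.
  rewrite mulr_le0_ge0 ?sqr_ge0// mulr_ge0_le0 ?f1s//.
  by rewrite mulr_ge0 ?D0// mulr_ge0.
Qed.

Lemma radial_angle lam D u y dy : 0 < lam -> radial_system lam D u y dy ->
  exists al : R -> R, [/\ continuous al, al 0 = 0,
    (forall t, 0 < t < a -> is_derive t (1 : R) al (D t * pruefer lam t (al t))) &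
    (forall t, 0 <= t <= a ->
      exists W, [/\ W != 0, u t = W * cos (al t) & y t = - (W * sin (al t))])].
Proof.
move=> lam0 rs; have nv := radial_nonvanishing lam0 rs.
have [Dc uc yc dyc D0 [q qD] ud yd eq u0 y0] := rs.
have duc t : 0 <= t <= a -> {for t, continuous (fun t => D t * y t)}.
  by move=> ta; apply: cvgM; [exact: Dc|exact: yc].
have [al [alc al0 ald alW]] := angle a0 uc yc duc dyc ud yd nv y0.
exists al; split=> //; last first.
  move=> t ta; have [W [W2 Wu Wy]] := alW t ta; exists W; split=> //.
  by rewrite -sqrf_eq0 W2 gt_eqF// nv.
move=> t ta; have tt : 0 <= t <= a by case/andP: ta => h1 h2; rewrite !ltW.
apply: is_derive_eq (ald t ta) _.
have [W [W2 Wu Wy]] := alW t tt.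
have W0 : W != 0 by rewrite -sqrf_eq0 W2 gt_eqF// nv.
have f0 : f t != 0 by rewrite gt_eqF// fp.
have -> : dy t = - D t * (k * f1 t * y t + lam * f t * u t) / f t by rewrite -eq//; field.
by rewrite -W2 Wu Wy /pruefer; field; rewrite W0 f0.
Qed.

Variables (n : nat) (c c0 : R).
Hypothesis nk : n%:R = k + 1.
Hypothesis n0 : (0 < n)%N.
Hypothesis c_gt0 : 0 < c.
Hypothesis f2b : forall t, 0 < t < a -> - f2 t <= c0 * f t.

(** If f' = W cos theta and sqrt(c) f = W sin theta, then theta' = sqrt(c) [speed]. On ]0, a[ it
    equals 1 exactly where f'' = - c f. *)
Definition speed t := (f1 t ^+ 2 - f t * f2 t) / (f1 t ^+ 2 + c * f t ^+ 2).

Lemma speed_den_gt0 t : 0 <= t <= a -> 0 < f1 t ^+ 2 + c * f t ^+ 2.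
Proof.
move=> /andP[]; rewrite le_eqVlt => /predU1P[<- _|t0].
  by rewrite f00 f10 expr0n mulr0 addr0 expr1n.
rewrite le_eqVlt => /predU1P[->|ta].
  by rewrite fa0 f1a expr0n mulr0 addr0 sqrrN expr1n.
rewrite ltr_wpDl ?sqr_ge0// mulr_gt0// exprn_gt0// fp//.
by rewrite t0.
Qed.

Lemma speed_cont t : 0 <= t <= a -> {for t, continuous speed}.
Proof.
move=> ta; have c1 := @f1_cont t; have c2 := @f_cont t.
apply: cvgM.
  apply: cvgB; first by apply: (@cvgM _ _ _ _ f1 f1).
  by apply: cvgM => //; exact: f2c.
apply: cvgV; first by rewrite gt_eqF// speed_den_gt0.
apply: cvgD; first by apply: (@cvgM _ _ _ _ f1 f1).
by apply: cvgM; [exact: cvg_cst|apply: (@cvgM _ _ _ _ f f)].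
Qed.

Lemma speed_gt0 t : 0 < t < a -> 0 < speed t.
Proof.
move=> ta; rewrite divr_gt0//; last by apply: speed_den_gt0; case/andP: ta => h1 h2; rewrite !ltW.
by rewrite ltr_wpDl ?sqr_ge0// -mulrN mulr_gt0// ?fp// oppr_gt0 f2n.
Qed.

Lemma speed_le t : 0 < t < a -> speed t <= 1 + `|c0| / c.
Proof.
move=> ta; have tt : 0 <= t <= a by case/andP: ta => h1 h2; rewrite !ltW.
have N0 := speed_den_gt0 tt.
rewrite ler_pdivrMr// mulrDl mul1r.
have h1 : - (f t * f2 t) <= `|c0| * f t ^+ 2.
  rewrite -mulrN mulrC expr2 mulrA ler_wpM2r// ?(ltW (fp ta))//.
  by apply: le_trans (f2b ta) _; rewrite ler_wpM2r ?ler_norm// ltW// fp.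
have h2 : `|c0| * f t ^+ 2 <= `|c0| / c * (f1 t ^+ 2 + c * f t ^+ 2).
  rewrite mulrDr [_ * (c * _)]mulrA divfK ?gt_eqF// lerDr.
  by rewrite mulr_ge0 ?sqr_ge0// divr_ge0// ltW.
have h3 : 0 <= c * f t ^+ 2 by rewrite mulr_ge0 ?sqr_ge0// ltW.
lra.
Qed.

(** theta is the colatitude at which the round sphere of curvature c has the same quotient f'/f. *)
Lemma model_colatitude : exists th : R -> R, [/\ continuous th, th 0 = 0,
    (forall t, 0 < t < a -> is_derive t (1 : R) th (Num.sqrt c * speed t)) &
    (forall t, 0 <= t <= a -> exists W, [/\ W != 0, f1 t = W * cos (th t) &
       Num.sqrt c * f t = W * sin (th t)])].
Proof.
have sc2 : Num.sqrt c ^+ 2 = c by rewrite sqr_sqrtr// ltW.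
have nv t : 0 <= t <= a -> 0 < f1 t ^+ 2 + (- (Num.sqrt c * f t)) ^+ 2.
  by move=> ta; rewrite sqrrN exprMn sc2 speed_den_gt0.
have scf (g : R -> R) : continuous g -> continuous (fun t => - (Num.sqrt c * g t)).
  by move=> gc t; apply: cvgN; apply: cvgM; [exact: cvg_cst|exact: gc].
have d1 t : 0 < t < a -> is_derive t (1 : R) f1 (f2 t) by move=> _; exact: f1d.
have d2 t : 0 < t < a -> is_derive t (1 : R) (fun t => - (Num.sqrt c * f t)) (- (Num.sqrt c * f1 t)).
  move=> _; apply: is_derive_eq (isdN (isdM (isdC t (1 : R) (Num.sqrt c)) (fd t))) _.
  by rewrite mul0r add0r.
(* [angle] returns minus an argument, whence the minus sign in the second component. *)
have [|||||th [thc th0 thd thW]] := angle a0 _ _ _ _ d1 d2 nv.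
- by move=> t _; exact: f1_cont.
- by move=> t _; exact: (scf _ f_cont).
- by move=> t _; exact: f2c.
- by move=> t _; exact: (scf _ f1_cont).
- by rewrite f00 mulr0 oppr0.
exists th; split=> //.
  move=> t ta; have tt : 0 <= t <= a by case/andP: ta => h1 h2; rewrite !ltW.
  apply: is_derive_eq (thd t ta) _; rewrite /speed sqrrN exprMn sc2.
  by field; rewrite gt_eqF// speed_den_gt0.
move=> t ta; have [W [W2 W3 W4]] := thW t ta; exists W; split=> //.
  by rewrite -sqrf_eq0 W2 gt_eqF// nv.
by apply: oppr_inj.
Qed.

(** This is the angle of the zonal harmonic of degree kk in the colatitude theta. Its sine vanishes
    at a because y contains sin theta. If it reached (kk + 1) pi, it would pass through pi/2 + i pi
    for all i <= kk, and a polynomial of degree at most kk would have kk + 1 roots. *)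
Lemma model_angle kk : exists be : R -> R, [/\ continuous be, be 0 = 0,
    (forall t, 0 < t < a -> is_derive t (1 : R) be (speed t * pruefer (c * geg_eig R n kk) t (be t))),
    sin (be a) = 0 &
    be a < kk.+1%:R * pi].
Proof.
have p0 : 0 < (pi : R) by exact: pi_gt0.
case: kk => [|kk].
  (* In degree 0 the harmonic is constant and lam = 0, a case excluded from [radial_angle]. *)
  exists (fun=> 0); split.
  - by move=> t; exact: cvg_cst.
  - by [].
  - move=> t _; apply: is_derive_eq (isdC t (1 : R) 0) _.
    by rewrite /pruefer /geg_eig sin0; ring.
  - by rewrite sin0.
  - by rewrite mul1r.
pose kn := kk.+1; pose Q := geg R n kn; pose K := geg_eig R n kn.
have K0 : 0 < K.
  rewrite /K /geg_eig mulr_gt0 ?ltr0n// /kn.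
  have : (1 : R) <= n%:R by rewrite ler1n.
  have : (0 : R) < kk.+1%:R by rewrite ltr0n.
  lra.
have [th [thc th0 thd thW]] := model_colatitude.
have sc2 : Num.sqrt c ^+ 2 = c by rewrite sqr_sqrtr// ltW.
have sc0 : 0 < Num.sqrt c by rewrite sqrtr_gt0.
pose X t := 1 - cos (th t).
pose u t := Q.[X t].
(* y is u' divided by [speed], so that u' = D y with D = [speed]. *)
pose y t := Num.sqrt c * sin (th t) * Q^`().[X t].
pose dy t := - c * speed t * (k * cos (th t) * Q^`().[X t] + K * Q.[X t]).
have ctc t : {for t, continuous (fun t => cos (th t))}.
  by apply: continuous_comp; [exact: thc|exact: continuous_cos].
have stc t : {for t, continuous (fun t => sin (th t))}.
  by apply: continuous_comp; [exact: thc|exact: continuous_sin].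
have Xc t : {for t, continuous X} by apply: cvgB; [exact: cvg_cst|exact: ctc].
have Pc (p : {poly R}) t : {for t, continuous (fun t => p.[X t])}.
  by apply: continuous_comp; [exact: Xc|exact: continuous_horner].
have Xd t : 0 < t < a -> is_derive t (1 : R) X (sin (th t) * (Num.sqrt c * speed t)).
  move=> ta; apply: is_derive_eq (isdB (isdC t (1 : R) 1) (isd_cos (thd t ta))) _; ring.
have Pd (p : {poly R}) t : 0 < t < a ->
    is_derive t (1 : R) (fun t => p.[X t]) (p^`().[X t] * (sin (th t) * (Num.sqrt c * speed t))).
  move=> ta; have h : is_derive (X t) (1 : R) (horner p) (p^`().[X t]).
    by split; [exact: derivable_horner|rewrite derivE derive1E].
  exact: is_derive_comp1 (Xd t ta) h.
have zz : 0 <= (0 : R) <= a by rewrite lexx ltW.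
have aa : 0 <= a <= a by rewrite lexx ltW.
have rs : radial_system (c * K) speed u y dy.
  split.
  - exact: speed_cont.
  - by move=> t _; exact: Pc.
  - by move=> t _; apply: cvgM; [apply: cvgM; [exact: cvg_cst|exact: stc]|exact: Pc].
  - move=> t ta; apply: cvgM; first by apply: cvgM; [exact: cvg_cst|exact: speed_cont].
    apply: cvgD; apply: cvgM; [|exact: Pc|exact: cvg_cst|exact: Pc].
    by apply: cvgM; [exact: cvg_cst|exact: ctc].
  - by move=> t ta; rewrite ltW// speed_gt0.
  - exists (Num.bound (2 * k * (1 + `|c0| / c))) => t ta.
    apply: le_trans (ltW (archi_boundP _)).
      by rewrite ler_wpM2l ?speed_le// mulr_ge0.
    by rewrite !mulr_ge0// addr_ge0// divr_ge0// ltW.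
  - by move=> t ta; apply: is_derive_eq (Pd Q t ta) _; rewrite /y; ring.
  - move=> t ta.
    have h := isdM (isdM (isdC t (1 : R) (Num.sqrt c)) (isd_sin (thd t ta))) (Pd (deriv Q) t ta).
    apply: is_derive_eq h _; rewrite /dy.
    have ode := geg_odeE n0 kn (X t).
    have sE : sin (th t) ^+ 2 = X t * (2 - X t) by rewrite sin2cos2 /X; ring.
    rewrite -/Q -/K nk -sE in ode.
    have cE : cos (th t) = 1 - X t by rewrite /X; ring.
    transitivity (Num.sqrt c ^+ 2 * speed t * (cos (th t) * Q^`().[X t] + sin (th t) ^+ 2 * Q^`()^`().[X t])); first by ring.
    rewrite sc2 (_ : sin (th t) ^+ 2 * _ = - ((k + 1) * (1 - X t) * Q^`().[X t] + K * Q.[X t])).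
      by rewrite cE; ring.
    by apply/eqP; rewrite -subr_eq0 opprK addrA ode.
  - move=> t ta; have tt : 0 <= t <= a by case/andP: ta => h1 h2; rewrite !ltW.
    have [W [W0 W1 W2]] := thW t tt.
    have h : f1 t * y t = c * f t * cos (th t) * Q^`().[X t].
      transitivity (Num.sqrt c * (W * sin (th t)) * cos (th t) * Q^`().[X t]).
        by rewrite /y W1; ring.
      by rewrite -W2 -[in RHS]sc2; ring.
    by rewrite -[k * f1 t * y t]mulrA h /dy /u; ring.
  - by rewrite /u /X th0 cos0 subrr geg_horner0 oner_neq0.
  - by rewrite /y th0 sin0 mulr0 mul0r.
have lam0 : 0 < c * K by rewrite mulr_gt0.
have [be [bec be0 bed beW]] := radial_angle lam0 rs.
exists be; split=> //.
  have [W [W0 _ W2]] := beW a aa.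
  have [W' [W'0 _ W'2]] := thW a aa.
  have sth : sin (th a) = 0.
    by apply/eqP; move: W'2; rewrite fa0 mulr0 => /esym/eqP; rewrite mulf_eq0 (negPf W'0).
  move: W2; rewrite /y sth mulr0 mul0r => /esym/eqP; rewrite oppr_eq0 mulf_eq0 (negPf W0) /=.
  by move/eqP.
rewrite ltNge; apply/negP => big.
(* theta increases from 0 and cannot pass pi, since sin theta vanishes only with f. On [0, pi] the
   cosine is injective, so distinct times yield distinct roots. *)
have th_inc s t : 0 <= s -> s < t -> t <= a -> th s < th t.
  move=> s0 st ta; apply: (der_gt0_lt (df := fun t => Num.sqrt c * speed t)) => //.
  - by move=> r /andP[r1 r2]; apply: thd; rewrite (le_lt_trans s0 r1) (lt_le_trans r2).
  - by move=> r _; exact: thc.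
  - by move=> r /andP[r1 r2]; rewrite mulr_gt0// speed_gt0// (le_lt_trans s0 r1) (lt_le_trans r2).
have th_ge0 t : 0 <= t <= a -> 0 <= th t.
  move=> /andP[]; rewrite le_eqVlt => /predU1P[<-|t0 ta]; first by rewrite th0.
  by rewrite -th0 ltW// th_inc.
have th_lepi t : 0 <= t <= a -> th t <= pi.
  move=> /andP[t0 ta]; rewrite leNgt; apply/negP => tp.
  have [||s /andP[s0 st] sE] := @IVT_pt R th 0 t pi t0.
  - by move=> r _; exact: thc.
  - by rewrite th0 ltW//= ltW.
  have st' : s < t by rewrite lt_neqAle st andbT; apply: contraTneq tp => <-; rewrite sE ltxx.
  have s0' : 0 < s.
    by rewrite lt_neqAle s0 andbT; apply: contraTneq p0 => h; rewrite -sE -h th0 ltxx.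
  have sa : 0 < s < a by rewrite s0' (lt_le_trans st').
  have sa' : 0 <= s <= a by rewrite s0 ltW//; case/andP: sa.
  have [W [_ _ W2]] := thW s sa'.
  by move: W2; rewrite sE sinpi mulr0 => /eqP; rewrite mulf_eq0 !gt_eqF ?fp.
pose v (i : nat) : R := pi / 2 + i%:R * pi.
have vP (i : nat) : (i <= kn)%N -> exists t, 0 <= t <= a /\ be t = v i.
  move=> ik; have [||t ta tE] := @IVT_pt R be 0 a (v i) (ltW a0).
  - by move=> r _; exact: bec.
  - rewrite be0 /v addr_ge0 ?divr_ge0 ?mulr_ge0 ?(ltW p0)//=.
    apply: le_trans big.
    have -> : kk.+2%:R * pi = kn%:R * pi + pi :> R by rewrite -natr1 mulrDl mul1r.
    have : i%:R * pi <= kn%:R * pi :> R by rewrite ler_wpM2r ?(ltW p0)// ler_nat.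
    lra.
  by exists t.
have /choice[tt ttP] : forall i : nat, exists t, (i <= kn)%N -> 0 <= t <= a /\ be t = v i.
  by move=> i; have [/vP[t tP]|_] := boolP (i <= kn)%N; [exists t|exists 0].
have cosv (i : nat) : cos (v i) = 0.
  apply/eqP; rewrite -norm_sin_eq1 /v addrC.
  elim: i => [|i IH]; first by rewrite mul0r add0r sin_pihalf normr1.
  by rewrite -natr1 mulrDl mul1r addrAC sinDpi normrN.
pose rts := [seq X (tt i) | i <- iota 0 kn.+1].
have rts_root : all (root Q) rts.
  apply/allP => z /mapP[i]; rewrite mem_iota add0n ltnS => /= ik ->.
  have [ta tE] := ttP i ik.
  have [W [_ W1 _]] := beW _ ta.
  by rewrite /root -/(u (tt i)) W1 tE cosv mulr0.
have rts_uniq : uniq rts.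
  rewrite map_inj_in_uniq ?iota_uniq// => i j; rewrite !mem_iota !add0n !ltnS => /= ik jk.
  have [ta tE] := ttP i ik; have [sa sE] := ttP j jk.
  move=> /addrI/oppr_inj cE.
  have thE : th (tt i) = th (tt j).
    by apply: cos_inj => //; rewrite in_itv /= ?th_ge0 ?th_lepi.
  have ttE : tt i = tt j.
    have [/andP[i0 ia] /andP[j0 ja]] := (ta, sa).
    case: (ltgtP (tt i) (tt j)) => // h.
      by have := th_inc _ _ i0 h ja; rewrite thE ltxx.
    by have := th_inc _ _ j0 h ia; rewrite thE ltxx.
  have : v i = v j by rewrite -tE -sE ttE.
  have pn0 : pi != 0 :> R by rewrite gt_eqF.
  by move=> /addrI/(mulIf pn0)/eqP; rewrite eqr_nat => /eqP.
have := max_poly_roots (geg_neq0 R n kn) rts_root rts_uniq.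
by rewrite size_map size_iota => /leq_trans/(_ (size_poly _ _)); rewrite ltnn.
Qed.

End Profile.

Lemma int_succ_le (q : nat) (i j : int) : Posz q <= i -> i < j -> Posz q.+1 <= j.
Proof. lia. Qed.

Lemma int_squeeze (q : nat) (i : int) : Posz q <= i -> i < Posz q.+1 -> i = Posz q.
Proof. lia. Qed.

Lemma int_two (q : nat) (i : int) : Posz q <= i -> i <= Posz q.+1 ->
  i = Posz q \/ i = Posz q.+1.
Proof. lia. Qed.

(** * The angle of phi between the two models *)

Section Rigidity.
Variables (R : realType) (a : R) (f f1 f2 phi p1 p2 : R -> R) (m r : nat) (c0 c1 : R).
Hypothesis a0 : 0 < a.
Hypothesis fd : forall t : R, is_derive t (1 : R) f (f1 t).
Hypothesis f1d : forall t : R, is_derive t (1 : R) f1 (f2 t).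
Hypothesis f2c : continuous f2.
Hypothesis fp : forall t, 0 < t < a -> 0 < f t.
Hypothesis f00 : f 0 = 0.
Hypothesis f10 : f1 0 = 1.
Hypothesis fa0 : f a = 0.
Hypothesis f1a : f1 a = -1.
Let n := m.+3.
Let k : R := m.+2%:R.
Hypothesis pd : forall t : R, is_derive t (1 : R) phi (p1 t).
Hypothesis p1d : forall t : R, is_derive t (1 : R) p1 (p2 t).
Hypothesis p2c : continuous p2.
Hypothesis ode : forall t, 0 < t < a ->
  f t * p2 t + k * f1 t * p1 t + n%:R * f t * phi t = 0.
Hypothesis phi0 : phi 0 != 0.
Hypothesis p10 : p1 0 = 0.
Hypothesis p1a : p1 a = 0.
Hypothesis r0 : (0 < r)%N.
Hypothesis c1_gt0 : 0 < c1.
Hypothesis c0E : c0 * geg_eig R n r = n%:R.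
Hypothesis c1E : c1 * geg_eig R n r.+1 = n%:R.
Hypothesis f2_le : forall t, 0 < t < a -> c1 * f t <= - f2 t.
Hypothesis f2_ge : forall t, 0 < t < a -> - f2 t <= c0 * f t.

Lemma rig_f2n t : 0 < t < a -> f2 t < 0.
Proof. by move=> ta; rewrite -oppr_gt0 (lt_le_trans _ (f2_le ta))// mulr_gt0// fp. Qed.

Lemma rig_c0_gt0 : 0 < c0.
Proof.
have ta : 0 < a / 2 < a by rewrite divr_gt0//= ltr_pdivrMr// ltr_pMr// ltr1n.
rewrite -(pmulr_lgt0 _ (fp ta)); apply: lt_le_trans (f2_ge ta).
by rewrite oppr_gt0 rig_f2n.
Qed.

Lemma rig_actual : radial_system a f f1 k n%:R (fun=> 1) phi p1 p2.
Proof.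
split.
- by move=> t _; exact: cvg_cst.
- by move=> t _; exact: is_derive_cont (pd t).
- by move=> t _; exact: is_derive_cont (p1d t).
- by move=> t _; exact: p2c.
- by move=> t _; exact: ler01.
- by exists (2 * m.+2)%N => t _; rewrite mulr1 natrM.
- by move=> t _; rewrite mul1r.
- by move=> t _.
- by move=> t ta; have := ode ta; rewrite mulN1r => /eqP; rewrite -addrA addr_eq0 => /eqP.
- by [].
- by [].
Qed.

(* phi phi'' < phi'^2: the logarithm of an eigenfunction is concave between zeros.
   Its proof follows K = f^(n-1) (phi'^2 - phi phi''), whose derivative has the sign
   of - phi phi', to the nearest zero of phi phi'. *)
Lemma rig_log_concave t : 0 < t < a ->
  0 < p1 t ^+ 2 + k * (f1 t / f t) * (p1 t * phi t) + n%:R * phi t ^+ 2.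
Proof.
move=> ta; have tt : 0 <= t <= a by case/andP: ta => h1 h2; rewrite !ltW.
have n_gt0 : 0 < (n%:R : R) by rewrite ltr0n.
have nv : 0 < phi t ^+ 2 + p1 t ^+ 2.
  exact: (radial_nonvanishing a0 fd f1d fp f10 f1a rig_f2n (ler0n _ _) n_gt0 rig_actual).
(* phi'' is eliminated by the equation, and the power of f absorbs the denominator of f'/f, so that
   [K] is continuous up to the poles. *)
pose K s := f s ^+ m.+2 * p1 s ^+ 2 + k * (f s ^+ m.+1 * f1 s * p1 s * phi s) + n%:R * (f s ^+ m.+2 * phi s ^+ 2).
pose dK s := - k * f s ^+ m * (f1 s ^+ 2 - f s * f2 s) * (phi s * p1 s).
have KE s : 0 < s < a -> K s = f s ^+ m.+2 * (p1 s ^+ 2 + k * (f1 s / f s) * (p1 s * phi s) + n%:R * phi s ^+ 2).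
  by move=> sa; rewrite /K !exprS; field; rewrite gt_eqF// fp.
suff : 0 < K t by rewrite KE// pmulr_rgt0// exprn_gt0// fp.
have Kd s : 0 < s < a -> is_derive s (1 : R) K (dK s).
  move=> sa; have h := isdD (isdD (isdM (isdX m.+1 (fd s)) (isdX 1 (p1d s)))
    (isdM (isdC s (1 : R) k) (isdM (isdM (isdM (isdX m (fd s)) (f1d s)) (p1d s)) (pd s))))
    (isdM (isdC s (1 : R) n%:R) (isdM (isdX m.+1 (fd s)) (isdX 1 (pd s)))).
  apply: is_derive_eq h _; rewrite /dK.
  have fs : f s != 0 by rewrite gt_eqF// fp.
  have -> : p2 s = - (k * f1 s * p1 s + n%:R * f s * phi s) / f s.
    apply: (mulfI fs); rewrite mulrCA mulfV// mulr1; apply/eqP.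
    by rewrite -addr_eq0 addrA; apply/eqP; exact: ode.
  have -> : (n%:R : R) = k + 1 by rewrite /k natr1.
  have kE : k = m%:R + 2 :> R by rewrite /k -!natr1; ring.
  have -> : m.+1%:R = k - 1 :> R by rewrite kE -natr1; ring.
  rewrite -/k !exprS expr0; field.
  exact: fs.
have Kc s : {for s, continuous K}.
  have c1' := is_derive_cont (isdX m.+1 (fd s)); have c2' := is_derive_cont (isdX m (fd s)).
  have c3' := is_derive_cont (isdX 1 (p1d s)); have c4' := is_derive_cont (isdX 1 (pd s)).
  have c5 := is_derive_cont (pd s); have c6 := is_derive_cont (p1d s); have c7 := is_derive_cont (f1d s).
  apply: cvgD; first apply: cvgD; first by apply: cvgM.
    apply: cvgM; first exact: cvg_cst.
    by apply: cvgM => //; apply: cvgM => //; apply: cvgM.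
  by apply: cvgM; [exact: cvg_cst|apply: cvgM].
pose g s := phi s * p1 s.
have gc : continuous g.
  by move=> s; apply: cvgM; [exact: is_derive_cont (pd s)|exact: is_derive_cont (p1d s)].
have dKs s : 0 < s < a -> exists2 w, 0 < w & dK s = - w * g s.
  move=> sa; exists (k * f s ^+ m * (f1 s ^+ 2 - f s * f2 s)); last by rewrite /dK /g; ring.
  rewrite mulr_gt0//; first by rewrite mulr_gt0 ?exprn_gt0// ?fp// ltr0n.
  by rewrite ltr_wpDl ?sqr_ge0// -mulrN mulr_gt0// ?fp// oppr_gt0 rig_f2n.
have Kzero s : 0 <= s <= a -> g s = 0 -> 0 <= K s.
  move=> /andP[s0 sa] gs.
  have -> : K s = f s ^+ m.+2 * p1 s ^+ 2 + n%:R * (f s ^+ m.+2 * phi s ^+ 2).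
    have -> : K s = f s ^+ m.+2 * p1 s ^+ 2 + n%:R * (f s ^+ m.+2 * phi s ^+ 2) + k * f s ^+ m.+1 * f1 s * g s.
      by rewrite /K /g; ring.
    by rewrite gs mulr0 addr0.
  have fs : 0 <= f s.
    move: s0; rewrite le_eqVlt => /predU1P[<-|s0]; first by rewrite f00.
    move: sa; rewrite le_eqVlt => /predU1P[->|sa]; first by rewrite fa0.
    by rewrite ltW// fp// s0.
  have fm : 0 <= f s ^+ m.+2 by exact: exprn_ge0.
  apply: addr_ge0; first by apply: mulr_ge0; [|exact: sqr_ge0].
  by apply: mulr_ge0; [exact: ler0n|apply: mulr_ge0; [|exact: sqr_ge0]].
have [/andP[t0 ta'] [t0' ta'']] := (ta, andP tt).
(* The zero of g is sought to the left if g t < 0 and to the right if g t > 0, the side on which [K]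
   is smaller. It exists because phi' vanishes at both poles. *)
have [gt|gt|gt] := ltgtP (g t) 0.
- have [|s [/andP[s0 st] gs neg]] := @last_ge0 R g 0 t gc t0' _ gt; first by rewrite /g p10 mulr0.
  apply: le_lt_trans (Kzero s _ gs) _; first by rewrite s0 (le_trans (ltW st)).
  apply: (der_gt0_lt st (df := dK)) => //.
    by move=> x /andP[x1 x2]; apply: Kd; rewrite (le_lt_trans s0 x1) (lt_trans x2).
  move=> x /andP[x1 x2]; have xa : 0 < x < a by rewrite (le_lt_trans s0 x1) (lt_trans x2).
  have [w w0 ->] := dKs x xa; rewrite mulNr -mulrN mulr_gt0// oppr_gt0 neg//.
  by rewrite x1 ltW.
- have [|s [/andP[st sa] gs pos]] := @first_le0 R g t a gc ta'' gt; first by rewrite /g p1a mulr0.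
  apply: le_lt_trans (Kzero s _ gs) _; first by rewrite sa (le_trans t0' (ltW st)).
  rewrite -ltrN2; apply: (@der_gt0_lt R (fun x => - K x) (fun x => - dK x) t s st).
  + by move=> x /andP[x1 x2]; apply: isdN; apply: Kd; rewrite (lt_trans t0 x1) (lt_le_trans x2).
  + by move=> x _; apply: cvgN; exact: Kc.
  + move=> x /andP[x1 x2]; have xa : 0 < x < a by rewrite (lt_trans t0 x1) (lt_le_trans x2).
    have [w w0 ->] := dKs x xa; rewrite mulNr opprK mulr_gt0// pos//.
    by rewrite x2 ltW.
- have -> : K t = f t ^+ m.+2 * (p1 t ^+ 2 + n%:R * phi t ^+ 2).
    have -> : K t = f t ^+ m.+2 * (p1 t ^+ 2 + n%:R * phi t ^+ 2) + k * f t ^+ m.+1 * f1 t * g t.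
      by rewrite /K /g; ring.
    by rewrite gt mulr0 addr0.
  rewrite mulr_gt0 ?exprn_gt0 ?fp//.
  have := sqr_ge0 (phi t); have := sqr_ge0 (p1 t); have : 1 <= (n%:R : R) by rewrite ler1n.
  by nra.
Qed.

Theorem warping_rigidity :
  (forall t, 0 < t < a -> f2 t = - c0 * f t) \/ (forall t, 0 < t < a -> f2 t = - c1 * f t).
Proof.
have n_gt0 : 0 < (n%:R : R) by rewrite ltr0n.
have k_ge0 : 0 <= k by rewrite ler0n.
have nk : n%:R = k + 1 by rewrite /k natr1.
have p0 : 0 < (pi : R) by exact: pi_gt0.
have aa : 0 <= a <= a by rewrite lexx ltW.
have [al [alc al0 ald alW]] := radial_angle a0 fd f1d fp f10 f1a rig_f2n k_ge0 n_gt0 rig_actual.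
(* Log-concavity of phi, read off in polar form. *)
have Fpos t : 0 < t < a -> 0 < pruefer f f1 k n%:R t (al t).
  move=> ta; have tt : 0 <= t <= a by case/andP: ta => h1 h2; rewrite !ltW.
  have [W [W0 W1 W2]] := alW t tt; have := rig_log_concave ta.
  rewrite W1 W2 (_ : _ + _ = W ^+ 2 * pruefer f f1 k n%:R t (al t)); last by rewrite /pruefer; ring.
  by rewrite pmulr_rgt0// lt_neqAle eq_sym sqrf_eq0 W0 sqr_ge0.
have sal : sin (al a) = 0.
  have [W [W0 _ W2]] := alW a aa.
  by move: W2; rewrite p1a => /esym/eqP; rewrite oppr_eq0 mulf_eq0 (negPf W0) /= => /eqP.
have cos2 (x : R) : sin x = 0 -> cos (x + x) = 1.
  by move=> sx; rewrite cosD -!expr2 cos2sin2 sx expr0n subr0 subr0.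
have model c kk (cp : 0 < c) := model_angle a0 fd f1d f2c fp f00 f10 fa0 f1a rig_f2n k_ge0 nk (ltn0Sn _) cp f2_ge kk.
have Dc c (cp : 0 < c) t := @speed_cont R a f f1 f2 fd f1d f2c fp f00 f10 fa0 f1a c cp t.
have D0 c (cp : 0 < c) t := @speed_gt0 R a f f1 f2 fp f00 f10 fa0 f1a rig_f2n c cp t.
have D0' c (cp : 0 < c) t : 0 < t < a -> 0 <= speed f f1 f2 c t by move=> ta; rewrite ltW// D0.
(* Induction on the degree. The angle of degree kk + 1 dominates that of degree kk, strictly at a by
   the rigidity clause; as both end at multiples of pi, at least one more pi is gained. *)
have model_ge c kk (cp : 0 < c) be : continuous be -> be 0 = 0 ->
    (forall t, 0 < t < a -> is_derive t (1 : R) be (speed f f1 f2 c t * pruefer f f1 k (c * geg_eig R n kk) t (be t))) ->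
    sin (be a) = 0 -> kk%:R * pi <= be a.
  elim: kk be => [|kk IH] be bec be0 bed bes.
    rewrite mul0r.
    have z0 : forall t, 0 < t < a -> is_derive t (1 : R) (fun=> 0 : R) (speed f f1 f2 c t * pruefer f f1 k 0 t 0).
      move=> t _; apply: is_derive_eq (isdC t (1 : R) 0) _.
      by rewrite /pruefer sin0; ring.
    have bed' t : 0 < t < a -> is_derive t (1 : R) be (speed f f1 f2 c t * pruefer f f1 k 0 t (be t) + 0).
      move=> ta; apply: is_derive_eq (bed t ta) _.
      by rewrite /geg_eig mul0r mulr0 addr0.
    have [ge _] := pruefer_compare (s := false) a0 fd f1d fp f10 f1a k_ge0 (Dc c cp) (D0' c cp) bec (fun=> cvg_cst _) be0 erefl z0 bed' (fun _ _ => ltac:(by rewrite mulr0)).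
    by have := ge a aa; rewrite expr0 mul1r subr0.
  have [be' [bec' be0' bed' bes' _]] := model c kk cp.
  have E : geg_eig R n kk < geg_eig R n kk.+1.
    rewrite /geg_eig -natr1; have h1 : 0 <= (kk%:R : R) by [].
    have h2 : 1 <= (n%:R : R) by rewrite ler1n.
    nra.
  pose e t := speed f f1 f2 c t * (c * (geg_eig R n kk.+1 - geg_eig R n kk) * cos (be t) ^+ 2).
  have bed2 t : 0 < t < a -> is_derive t (1 : R) be (speed f f1 f2 c t * pruefer f f1 k (c * geg_eig R n kk) t (be t) + e t).
    by move=> ta; apply: is_derive_eq (bed t ta) _; rewrite /e /pruefer; ring.
  have e0 t : 0 < t < a -> 0 <= (-1) ^+ false * e t.
    move=> ta; rewrite expr0 mul1r mulr_ge0 ?D0'// mulr_ge0 ?sqr_ge0// mulr_ge0 ?(ltW cp)//.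
    by rewrite subr_ge0 ltW.
  have [ge rig] := pruefer_compare a0 fd f1d fp f10 f1a k_ge0 (Dc c cp) (D0' c cp) bec bec' be0 be0' bed' bed2 e0.
  have le1 : kk%:R * pi <= be' a by apply: IH.
  have le2 : be' a <= be a by have := ge a aa; rewrite expr0 mul1r subr_ge0.
  have ne : be' a != be a.
    apply/eqP => h.
    have ez := rig (esym h) _; rewrite h in ez.
    (* e contains the factor cos^2 be, which is positive just after 0 because be starts at 0; hence
       e does not vanish identically. *)
    have n1 := cos_near1 bec (_ : cos (be 0) = 1); rewrite be0 cos0 in n1.
    have [b /andP[b0 ba] bP] := near_right (n1 erefl) a0.
    have bh : 0 < b / 2 < a by apply/andP; split; lra.
    have := ez (cos2 _ bes) _ bh; rewrite /e => /eqP; rewrite mulf_eq0 gt_eqF ?D0//= mulf_eq0.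
    rewrite gt_eqF/=; last by rewrite mulr_gt0// subr_gt0.
    rewrite sqrf_eq0 gt_eqF//; apply: bP; apply/andP; split; lra.
  have lt : be' a < be a by rewrite lt_neqAle ne.
  have [i iE] := sin_eq0_int bes'; have [j jE] := sin_eq0_int bes.
  move: le1 lt; rewrite iE jE ler_pM2r// ltr_pM2r// -[kk%:R]/((Posz kk)%:~R) ler_int ltr_int => le1 lt1.
  rewrite ler_pM2r// -[kk.+1%:R]/((Posz kk.+1)%:~R) ler_int.
  exact: int_succ_le le1 lt1.
have [j jE] := sin_eq0_int sal.
(* The equation of al has factor 1. Splitting it as [speed] plus a remainder exposes the model
   equation, with an e whose sign is that of 1 - [speed]. *)
have ald' c t : 0 < t < a -> is_derive t (1 : R) al
   (speed f f1 f2 c t * pruefer f f1 k n%:R t (al t) + (1 - speed f f1 f2 c t) * pruefer f f1 k n%:R t (al t)).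
  by move=> ta; apply: is_derive_eq (ald t ta) _; ring.
have sp_eq c t (cp : 0 < c) : 0 < t < a -> (1 - speed f f1 f2 c t) = (c * f t + f2 t) * f t / (f1 t ^+ 2 + c * f t ^+ 2).
  move=> ta; have tt : 0 <= t <= a by case/andP: ta => h1 h2; rewrite !ltW.
  have N0 := @speed_den_gt0 R a f f1 fp f00 f10 fa0 f1a c cp t tt.
  by rewrite /speed; field; rewrite gt_eqF.
have c0p := rig_c0_gt0.
have [b0 [b0c b00 b0d b0s b0lt]] := model c0 r c0p.
have b0ge := model_ge c0 r c0p b0 b0c b00 b0d b0s.
have [b1 [b1c b10 b1d b1s b1lt]] := model c1 r.+1 c1_gt0.
have b1ge := model_ge c1 r.+1 c1_gt0 b1 b1c b10 b1d b1s.
have sgn0 t : 0 < t < a -> 0 <= 1 - speed f f1 f2 c0 t.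
  move=> ta; rewrite sp_eq//; have tt : 0 <= t <= a by case/andP: ta => h1 h2; rewrite !ltW.
  have N0 := @speed_den_gt0 R a f f1 fp f00 f10 fa0 f1a c0 c0p t tt.
  rewrite divr_ge0 ?(ltW N0)// mulr_ge0 ?(ltW (fp ta))//.
  by have := f2_ge ta; lra.
have sgn1 t : 0 < t < a -> 0 <= - (1 - speed f f1 f2 c1 t).
  move=> ta; rewrite sp_eq//; have tt : 0 <= t <= a by case/andP: ta => h1 h2; rewrite !ltW.
  have N0 := @speed_den_gt0 R a f f1 fp f00 f10 fa0 f1a c1 c1_gt0 t tt.
  rewrite -mulNr -mulNr divr_ge0 ?(ltW N0)// mulr_ge0 ?(ltW (fp ta))//.
  by have := f2_le ta; lra.
rewrite c0E in b0d; rewrite c1E in b1d.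
have [ge0 rig0] := pruefer_compare (s := false) a0 fd f1d fp f10 f1a k_ge0 (Dc c0 c0p) (D0' c0 c0p) alc b0c al0 b00 b0d (ald' c0)
  (fun t ta => ltac:(by rewrite expr0 mul1r mulr_ge0 ?sgn0// ltW// Fpos)).
have [ge1 rig1] := pruefer_compare (s := true) a0 fd f1d fp f10 f1a k_ge0 (Dc c1 c1_gt0) (D0' c1 c1_gt0) alc b1c al0 b10 b1d (ald' c1)
  (fun t ta => ltac:(by rewrite expr1 mulN1r -mulNr mulr_ge0 ?sgn1// ltW// Fpos)).
(* Equality case: the Pruefer form is positive, so [speed] = 1, which means f'' = - c f. *)
have finish c (cp : 0 < c) : (forall t, 0 < t < a -> (1 - speed f f1 f2 c t) * pruefer f f1 k n%:R t (al t) = 0) ->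
    forall t, 0 < t < a -> f2 t = - c * f t.
  move=> H t ta; have tt : 0 <= t <= a by case/andP: ta => h1 h2; rewrite !ltW.
  have N0 := @speed_den_gt0 R a f f1 fp f00 f10 fa0 f1a c cp t tt.
  have := H t ta => /eqP; rewrite sp_eq// !mulf_eq0 invr_eq0 !(gt_eqF N0, gt_eqF (fp ta), gt_eqF (Fpos t ta)) !orbF.
  by rewrite addrC addr_eq0 mulNr => /eqP.
have [j0 j0E] := sin_eq0_int b0s; have [j1 j1E] := sin_eq0_int b1s.
have natE (q : nat) : q%:R = (Posz q)%:~R :> R by [].
have A0 : j0 = Posz r.
  move: b0ge b0lt; rewrite j0E !natE ler_pM2r// ltr_pM2r// ler_int ltr_int; exact: int_squeeze.
have A1 : j1 = Posz r.+1.
  move: b1ge b1lt; rewrite j1E !natE ler_pM2r// ltr_pM2r// ler_int ltr_int; exact: int_squeeze.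
have B0 : (Posz r <= j)%R.
  have := ge0 a aa; rewrite expr0 mul1r subr_ge0 j0E jE ler_pM2r// ler_int A0; exact.
have B1 : (j <= Posz r.+1)%R.
  have := ge1 a aa; rewrite expr1 mulN1r opprB subr_ge0 j1E jE ler_pM2r// ler_int A1; exact.
have [jr|jr] := int_two B0 B1.
  left; apply: finish => //; have E : al a = b0 a by rewrite jE j0E A0 jr.
  by apply: rig0 => //; rewrite -E cos2.
right; apply: finish => //; have E : al a = b1 a by rewrite jE j1E A1 jr.
by apply: rig1 => //; rewrite -E cos2.
Qed.

End Rigidity.

(** * A radial mean in place of the integral over spheres *)

(* A translation invariant mean on the cube [-1, 1]^n: the limit along an
   ultrafilter of the averages over finer and finer grids. *)
Section Mean.
Variables (R : realType) (n Q : nat).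
Hypothesis Q0 : (0 < Q)%N.
Implicit Types (F G : 'rV[R]_n -> R) (p : 'rV[R]_n).

(** The number of grid points per axis on [-1, 1). The mesh is a fraction of 1/Q, so that the
    interval [1/Q, 2/Q) is a union of whole steps, as [mean_ge] requires. *)
Definition grid_size (k : nat) : nat := (2 * (Q * k.+1))%N.

Definition grid_step (k : nat) : R := ((Q * k.+1)%:R)^-1.

Definition grid_point (k : nat) (z : {ffun 'I_n -> 'I_(grid_size k)}) : 'rV[R]_n :=
  \row_i (-1 + (z i)%:R * grid_step k).

Definition grid_mean (k : nat) F : R :=
  ((grid_size k ^ n)%:R)^-1 * \sum_z F (@grid_point k z).

Definition in_cube p := forall i, `|p 0 i| <= 1.

Lemma grid_size_gt0 k : (0 < grid_size k)%N.
Proof. by rewrite !muln_gt0 Q0. Qed.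

Lemma grid_step_gt0 k : 0 < grid_step k.
Proof. by rewrite invr_gt0 ltr0n muln_gt0 Q0. Qed.

Lemma grid_size_step k : (grid_size k)%:R * grid_step k = 2.
Proof. by rewrite /grid_size natrM -mulrA mulfV ?mulr1// pnatr_eq0 -lt0n muln_gt0 Q0. Qed.

Lemma grid_in_cube k z : in_cube (@grid_point k z).
Proof.
move=> i; rewrite mxE ler_norml.
have h1 : 0 <= (z i)%:R * grid_step k by rewrite mulr_ge0// ltW// grid_step_gt0.
have h2 : (z i)%:R * grid_step k <= 2.
  by rewrite -(grid_size_step k) ler_wpM2r ?ler_nat ?(ltnW (ltn_ord _))// ltW// grid_step_gt0.
lra.
Qed.

Lemma grid_mean_linear k (c : R) F G :
  grid_mean k (fun p => c * F p + G p) = c * grid_mean k F + grid_mean k G.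
Proof. by rewrite /grid_mean big_split /= -mulr_sumr mulrDr mulrCA. Qed.

Lemma card_grid k : #|{ffun 'I_n -> 'I_(grid_size k)}| = (grid_size k ^ n)%N.
Proof. by rewrite card_ffun !card_ord. Qed.

Lemma grid_card_gt0 k : (0 : R) < (grid_size k ^ n)%:R.
Proof. by rewrite ltr0n expn_gt0 grid_size_gt0. Qed.

Lemma grid_mean_bound k F (B : R) : (forall p, in_cube p -> `|F p| <= B) ->
  `|grid_mean k F| <= B.
Proof.
move=> FB; rewrite normrM ger0_norm ?invr_ge0// ler_pdivrMl ?grid_card_gt0//.
apply: le_trans (ler_norm_sum _ _ _) _.
apply: (@le_trans _ _ (\sum_(z : {ffun 'I_n -> 'I_(grid_size k)}) B)).
  by apply: ler_sum => z _; apply: FB; exact: grid_in_cube.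
by rewrite sumr_const card_grid mulr_natl.
Qed.

(** A shift by one mesh permutes the grid cyclically, except on the last layer, which lands on the
    face +1 instead of -1; F is zero on both. *)
Lemma grid_mean_shift k F i : (forall p, `|p 0 i| = 1 -> F p = 0) ->
  grid_mean k (fun p => F (p + grid_step k *: basis R i)) = grid_mean k F.
Proof.
move=> F0; congr (_ * _).
have M0 := grid_size_gt0 k.
pose s (z : {ffun 'I_n -> 'I_(grid_size k)}) : {ffun 'I_n -> 'I_(grid_size k)} :=
  [ffun j => if j == i then ordS (z j) else z j].
have s_inj : injective s.
  move=> z1 z2 /ffunP E; apply/ffunP => j; have := E j; rewrite !ffunE.
  by case: eqP => // _ /ordS_inj.
rewrite [RHS](reindex_inj s_inj) /=; apply: eq_bigr => z _.
have [h|h] := ltnP (z i).+1 (grid_size k).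
  congr F; apply/rowP => j; rewrite !mxE ffunE eqxx /=.
  have [->|ji] := eqVneq j i; last by rewrite mulr0 addr0.
  have -> : nat_of_ord (ordS (z i)) = (z i).+1 by rewrite /= modn_small.
  by rewrite mulr1 -addrA -natr1 mulrDl mul1r.
have zi : (z i).+1 = grid_size k by apply/eqP; rewrite eqn_leq h ltn_ord.
rewrite !F0//.
  by rewrite !mxE ffunE eqxx /= zi modnn mul0r addr0 normrN1.
rewrite !mxE !eqxx /= mulr1 -addrA -{2}[grid_step k]mul1r -mulrDl natr1 zi grid_size_step.
by rewrite (_ : -1 + 2 = 1 :> R) ?normr1//; ring.
Qed.

Definition ultra : set_system nat := projT1 (cid (ultraFilterLemma eventually_filter)).

Lemma ultra_ultra : UltraFilter ultra.
Proof. by rewrite /ultra; case: cid => G []. Qed.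

Lemma ultra_eventually : (\oo : set_system nat) `<=` ultra.
Proof. by rewrite /ultra; case: cid => G []. Qed.

#[local] Existing Instance ultra_ultra.

Lemma ultra_filter : ProperFilter ultra.
Proof. by case: ultra_ultra. Qed.

#[local] Existing Instance ultra_filter.

Lemma ultra_fmap (T : Type) (f : nat -> T) : UltraFilter (f @ ultra).
Proof.
have FF : ProperFilter (f @ ultra) by exact: fmap_proper_filter.
refine (Build_UltraFilter FF _) => G GP sub; rewrite eqEsubset; split=> // A GA.
have [//|nA] := in_ultra_setVsetC (f @^-1` A) ultra_ultra.
have GnA : G (~` A) by apply: sub.
have G0 : G (A `&` ~` A) by exact: filterI.
by rewrite setICr in G0; case: (filter_not_empty G).
Qed.

Definition mean F : R := lim ((fun k => grid_mean k F) @ ultra).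

Definition bounded_on_cube F := exists B : R, forall p, in_cube p -> `|F p| <= B.

Lemma mean_cvg F : bounded_on_cube F -> (fun k => grid_mean k F) @ ultra --> mean F.
Proof.
move=> [B FB].
have co : compact (`[- B, B] : set R) by exact: segment_compact.
rewrite compact_ultra in co.
have FA : ((fun k => grid_mean k F) @ ultra) `[- B, B].
  apply: filterS (filterT : ultra setT) => k _ /=; rewrite in_itv /= -ler_norml.
  exact: grid_mean_bound.
have [l [_ /= ll]] := co _ (ultra_fmap _) FA.
by apply/cvg_ex; exists l.
Qed.

Lemma mean_linear (c : R) F G : bounded_on_cube F -> bounded_on_cube G ->
  mean (fun p => c * F p + G p) = c * mean F + mean G.
Proof.
move=> Fb Gb; apply: cvg_lim => //.
have -> : (fun k => grid_mean k (fun p => c * F p + G p)) =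
   (fun k => c * grid_mean k F + grid_mean k G).
  by apply/funext => k; exact: grid_mean_linear.
by apply: cvgD; [apply: cvgM; [exact: cvg_cst|exact: mean_cvg]|exact: mean_cvg].
Qed.

Lemma mean_ext F G : (forall p, in_cube p -> F p = G p) -> mean F = mean G.
Proof.
move=> FG; rewrite /mean; suff -> : grid_mean^~ F = grid_mean^~ G by [].
apply/funext => k; congr (_ * _); apply: eq_bigr => z _; apply: FG; exact: grid_in_cube.
Qed.

Lemma mean_bound F (B : R) : (forall p, in_cube p -> `|F p| <= B) -> `|mean F| <= B.
Proof.
move=> FB; have Fc : (fun k => grid_mean k F) @ ultra --> mean F by apply: mean_cvg; exists B.
have -> : mean F = lim ((fun k => grid_mean k F) @ ultra) by [].
rewrite ler_norml; apply/andP; split.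
  apply: limr_ge; first by apply/cvg_ex; exists (mean F).
  apply: filterS (filterT : ultra setT) => k _.
  by have := grid_mean_bound k FB; rewrite ler_norml => /andP[].
apply: limr_le; first by apply/cvg_ex; exists (mean F).
apply: filterS (filterT : ultra setT) => k _.
by have := grid_mean_bound k FB; rewrite ler_norml => /andP[].
Qed.

Lemma mean_cst (c : R) : mean (fun=> c) = c.
Proof.
apply: cvg_lim => //.
rewrite (_ : (fun k => _) = (fun=> c)); first exact: cvg_cst.
apply/funext => k; rewrite /grid_mean sumr_const card_grid -[X in _ * X]mulr_natl mulrA mulVf ?mul1r//.
by rewrite gt_eqF// grid_card_gt0.
Qed.

(** The box [1/Q, 2/Q)^n holds the fraction (2 Q)^(-n) of every grid. This bound is what makes phi
    nonzero at the pole. *)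
Lemma mean_ge (F : 'rV[R]_n -> R) (e : R) : (1 < Q)%N -> 0 <= e -> (forall p, in_cube p -> 0 <= F p) ->
  bounded_on_cube F ->
  (forall p, (forall i, Q%:R^-1 <= p 0 i <= 2 * Q%:R^-1) -> e <= F p) ->
  e * ((2 * Q)%:R^-1) ^+ n <= mean F.
Proof.
move=> Q1 e0 F0 Fb Fe.
apply: limr_ge; first by apply/cvg_ex; exists (mean F); exact: mean_cvg.
apply: filterS (filterT : ultra setT) => k _.
pose J : pred 'I_(grid_size k) := [pred j : 'I_(grid_size k) | (Q.+1 * k.+1 <= j < Q.+2 * k.+1)%N].
have JE : (k.+1 <= #|J|)%N.
  have lt (i : 'I_k.+1) : (Q.+1 * k.+1 + i < grid_size k)%N.
    rewrite /grid_size; have := ltn_ord i; move: (nat_of_ord i) => i'; nia.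
  pose g (i : 'I_k.+1) := Ordinal (lt i).
  have g_inj : injective g by move=> i j /(congr1 val)/= /addnI/val_inj.
  rewrite -[X in (X <= _)%N](card_ord k.+1) -(card_codom g_inj).
  apply: subset_leq_card; apply/fintype.subsetP => _ /codomP[i ->]; rewrite inE /=.
  rewrite leq_addr/=; have := ltn_ord i; nia.
have -> : grid_mean k F = ((grid_size k ^ n)%:R)^-1 * \sum_z F (@grid_point k z) by [].
rewrite mulrC ler_pdivlMl ?grid_card_gt0//.
apply: (@le_trans _ _ (\sum_(z in ffun_on J) e)); last first.
  rewrite [leRHS](bigID (mem (ffun_on J))) /= -[leLHS]addr0; apply: lerD.
    apply: ler_sum => z /ffun_onP zJ; apply: Fe => i; rewrite mxE.
    have := zJ i; rewrite inE => /andP[j1 j2].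
    have q0 : 0 < (Q * k.+1)%:R :> R by rewrite ltr0n muln_gt0 Q0.
    have qq : (Q%:R : R) != 0 by rewrite pnatr_eq0 -lt0n.
    have kk : (k.+1%:R : R) != 0 by rewrite pnatr_eq0.
    have E (m : nat) : -1 + m%:R * grid_step k = (m%:R - (Q * k.+1)%:R) / (Q * k.+1)%:R.
      by rewrite /grid_step; move: (lt0r_neq0 q0); move: ((Q * k.+1)%:R : R) => N N0; field.
    rewrite E ler_pdivlMr// ler_pdivrMr// [_ * (Q * _)%:R]mulrC.
    have E1 : (Q * k.+1)%:R * Q%:R^-1 = k.+1%:R :> R by rewrite natrM mulrAC mulfV// mul1r.
    rewrite E1 (_ : 2 / Q%:R * (Q * k.+1)%:R = 2 * ((Q * k.+1)%:R * Q%:R^-1)); last by ring.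
    rewrite E1 lerBrDr lerBlDr -natrD -natrM -natrD !ler_nat.
    move: j1 j2; rewrite !mulSn; move: (Q * k.+1)%N (nat_of_ord (z i)) => N zi j1 j2.
    by apply/andP; split; lia.
  by apply: sumr_ge0 => z _; apply: F0; exact: grid_in_cube.
rewrite sumr_const mulrA -[leRHS]mulr_natl ler_wpM2r//.
rewrite (_ : #|_| = #|J| ^ n)%N; last by rewrite card_ffun_on card_ord.
rewrite exprVn -natrX ler_pdivrMr ?ltr0n ?expn_gt0 ?muln_gt0 ?Q0//.
rewrite -natrM ler_nat -expnMn; case: (posnP n) => [->//|n0]; rewrite leq_exp2r//.
by rewrite {1}/grid_size mulnA mulnC leq_mul2r JE orbT.
Qed.

End Mean.

(** * Derivatives from quadratic remainders *)

Section Differentiation.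
Variable R : realType.

(** A remainder bounded by a constant times h^2 passes through a mean, unlike pointwise
    differentiability; derivatives of means are recognized in this way. *)
Lemma quad_is_derive (phi : R -> R) (t psi B : R) :
  (forall h, `|h| <= 1 -> `|phi (t + h) - phi t - h * psi| <= h ^+ 2 * B) ->
  is_derive t (1 : R) phi psi.
Proof.
move=> H; pose B' := `|B| + 1.
have B0 : 0 < B' by rewrite ltr_wpDl.
have L : (fun h : R => h^-1 *: ((phi \o shift t) (h *: (1 : R)) - phi t)) @ 0^' --> psi.
  apply/cvgrPdist_le => /= e e0.
  near=> h.
  have h0 : h != 0 by near: h; exact: nbhs_dnbhs_neq.
  have h1 : `|h| <= Order.min 1 (e / B').
    near: h; apply: dnbhs0_le; rewrite lt_min ltr01/= divr_gt0//.
  move: h1; rewrite le_min => /andP[h1 h2].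
  rewrite [h%:A]mulr1 distrC -[X in `|X|]mulr1 -[X in _ * X](mulVf h0) mulrC.
  rewrite -mulrA normrM normfV ler_pdivrMl ?normr_gt0// mulrBr.
  rewrite -[h * (h^-1 *: _)]/(h * (h^-1 * _)) mulrA mulfV// mul1r [h + t]addrC.
  apply: le_trans (H h h1) _; apply: (@le_trans _ _ (h ^+ 2 * B')).
    by rewrite ler_wpM2l ?sqr_ge0//; apply: le_trans (ler_norm B) _; rewrite lerDl.
  by rewrite -(real_normK (num_real h)) expr2 -mulrA ler_wpM2l// -ler_pdivlMr.
split; first by apply/cvg_ex; exists psi.
by apply: cvg_lim.
Unshelve. all: by end_near. Qed.

Lemma taylor1_line (V : normedModType R) (f : V -> R) (y v : V) (s B : R) :
  (forall c : R, `|c| <= `|s| -> [/\ derivable f (y + c *: v) v,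
     derivable ('D_v f) (y + c *: v) v & `|'D_v ('D_v f) (y + c *: v)| <= B]) ->
  `|f (y + s *: v) - f y - s * 'D_v f y| <= s ^+ 2 * B.
Proof.
move=> H.
have [|c cs ->] := @MVT_line R V f y v s; first by move=> c /H[].
have [|c' cs' E] := @MVT_line R V ('D_v f) y v c; first by move=> c' h; case: (H c' (le_trans h cs)).
rewrite -mulrBr E !normrM -[X in _ <= X * _](real_normK (num_real s)) expr2 -mulrA.
rewrite ler_wpM2l// ler_pM//.
by case: (H c' (le_trans cs' cs)).
Qed.

Lemma cont_bounded_ball m (g : 'rV[R]_m -> R) (M : R) : continuous g ->
  exists B : R, forall q, `|q| <= M -> `|g q| <= B.
Proof.
move=> gc; pose A : set 'rV[R]_m := [set q | `|q| <= M].
have [M0|M0] := ltP M 0.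
  by exists 0 => q qM; have := le_lt_trans (le_trans (normr_ge0 q) qM) M0; rewrite ltxx.
have Ac : compact A.
  apply: bounded_closed_compact.
    exists M; split; first exact: num_real.
    by move=> x xM q /= qM; apply: le_trans qM (ltW xM).
  rewrite (_ : A = (fun q : 'rV[R]_m => `|q|) @^-1` [set y | y <= M])//.
  apply: closed_comp => [q _|]; last exact: closed_le.
  exact: norm_continuous.
have A0 : A !=set0 by exists 0; rewrite /A /= normr0.
have [|c _ cP] := @EVT_max_rV R m (fun q => `|g q|) A A0 Ac.
  apply: continuous_subspaceT => q; apply: continuous_comp; first exact: gc.
  exact: norm_continuous.
by exists (`|g c|) => q qM; apply: cP; rewrite inE.
Qed.

End Differentiation.

(** * Integration by parts and differentiation under the mean *)

Section MeanDerivative.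
Variables (R : realType) (n Q : nat).
Hypothesis Q0 : (0 < Q)%N.
Local Notation mean := (@mean R n Q).

Lemma in_cubeE (p : 'rV[R]_n) : in_cube p -> `|p| <= 1.
Proof. by move=> h; apply: mx_norm_le. Qed.

Lemma cont_bounded_on_cube (G : 'rV[R]_n -> R) : continuous G -> bounded_on_cube G.
Proof.
by move=> /(cont_bounded_ball 1)[B BP]; exists B => p /in_cubeE; exact: BP.
Qed.

Lemma Ck_continuous (V W : normedModType R) k (G : V -> W) : Ck k setT G -> continuous G.
Proof. by move=> Gk x; exact: (Ck_cont Gk). Qed.

(** For h equal to the mesh, h times the grid mean of the derivative differs by O(h^2) from the grid
    mean of G (p + h e_i) - G p, which is zero by [grid_mean_shift]. *)
Lemma mean_deriv0 (G : 'rV[R]_n -> R) (i : 'I_n) : Ck 2 setT G ->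
  (forall p : 'rV[R]_n, `|p 0 i| = 1 -> G p = 0) -> mean ('D_(basis R i) G) = 0.
Proof.
move=> Gk Gz; set dG := 'D_(basis R i) G.
have dGk : Ck 1 setT dG by exact: Ck_D.
have ddGk : Ck 0 setT ('D_(basis R i) dG) by exact: Ck_D.
have [B BP] := cont_bounded_ball 2 (Ck_continuous ddGk).
have dGb : bounded_on_cube dG by apply: cont_bounded_on_cube; exact: Ck_continuous dGk.
have B0 : 0 <= B by apply: le_trans (BP 0 _); rewrite ?normr_ge0// normr0.
have est k : `|grid_mean Q k dG| <= grid_step R Q k * B.
  set h := grid_step R Q k; have h0 : 0 < h by exact: grid_step_gt0.
  have h1 : h <= 1 by rewrite /h /grid_step invf_le1 ?ltr0n ?muln_gt0 ?Q0// ler1n muln_gt0 Q0.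
  have E := grid_mean_shift Q0 k Gz.
  have L : h * grid_mean Q k dG = grid_mean Q k (fun p => h * dG p + (- 1 * G (p + h *: basis R i) + G p)).
    by rewrite !grid_mean_linear E mulN1r addNr addr0.
  rewrite -(ler_pM2l h0) -[X in X * `|_|](gtr0_norm h0) -normrM L.
  apply: grid_mean_bound => // p pc; rewrite mulrA -expr2.
  rewrite -normrN (_ : - _ = G (p + h *: basis R i) - G p - h * dG p); last by ring.
  apply: taylor1_line => c ch; split; [exact: (Ck_der Gk)|exact: (Ck_der dGk)|].
  apply: BP; apply: le_trans (ler_normD _ _) _; rewrite -[leRHS]/(1 + 1 : R).
  apply: lerD; first exact: in_cubeE.
  rewrite normrZ mulr_ile1// ?(le_trans ch)// ?gtr0_norm//.
  apply: mx_norm_le => // j; rewrite mxE; case: (_ && _); by rewrite ?normr1 ?normr0.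
have cv := mean_cvg Q0 dGb.
have z : (fun k => grid_step R Q k * B) @ \oo --> (0 : R).
  rewrite -[X in _ --> X](mul0r B); apply: cvgM; last exact: cvg_cst.
  apply/cvgrPdist_le => /= e e0; near=> k; rewrite sub0r normrN gtr0_norm ?grid_step_gt0//.
  rewrite /grid_step -[leRHS]invrK lef_pV2 ?posrE ?invr_gt0// ?ltr0n ?muln_gt0 ?Q0//.
  apply: (@le_trans _ _ k%:R); last by rewrite ler_nat; move: Q0; nia.
  by near: k; exact: nbhs_infty_ger.
have zu : (fun k => grid_step R Q k * B) @ ultra --> (0 : R).
  by move=> A /z h; apply: ultra_eventually.
have UF := ultra_filter.
suff : (fun k => grid_mean Q k dG) @ ultra --> (0 : R) by move=> h; apply: cvg_unique cv h.
apply/cvgr0Pnorm_le => e e0.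
apply: filterS ((cvgr0Pnorm_le _).1 zu e e0) => k; apply: le_trans.
by apply: le_trans (est k) _; exact: ler_norm.
Unshelve. all: by end_near. Qed.

(** Vectors of R^(1+n) are read as pairs (t, p) of a time and a space component from here on. *)
Definition slice (t : R) (p : 'rV[R]_n) : 'rV[R]_(1 + n) := row_mx t%:M p.

Definition e_time : 'rV[R]_(1 + n) := row_mx 1%:M 0.

Lemma sliceD t h p : slice (t + h) p = slice t p + h *: e_time.
Proof. by rewrite /slice /e_time scale_row_mx add_row_mx scaler0 addr0 scale_scalar_mx mulr1 raddfD. Qed.

Lemma slice_norm t p (M : R) : 0 <= M -> `|t| <= M -> `|p| <= M -> `|slice t p| <= M.
Proof.
move=> M0 tM pM; apply: mx_norm_le => // j; rewrite mxE; case: splitP => i _.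
  by rewrite ord1 mxE eqxx mulr1n.
exact: le_trans (coord_norm_le _ _) pM.
Qed.

Lemma e_time_norm : `|e_time| <= 1.
Proof.
have := @slice_norm 1 0 1 ler01; rewrite normr1 normr0 lexx ler01 => /(_ isT isT).
by rewrite /slice /e_time.
Qed.

Lemma slice_continuous t : continuous (slice t).
Proof.
move=> p; apply: mx_continuous => i j; rewrite /slice.
case: (splitP j) => j' jE.
  rewrite (_ : (fun y => _) = (fun=> t)); first exact: cst_continuous.
  apply/funext => y; rewrite (_ : j = lshift n j'); last exact: val_inj.
  by rewrite row_mxEl !ord1 mxE eqxx mulr1n.
rewrite (_ : (fun y => _) = (fun y : 'rV[R]_n => y i j')); first exact: coord_continuous.
apply/funext => y; rewrite (_ : j = rshift 1 j'); last exact: val_inj.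
by rewrite row_mxEr.
Qed.

Lemma mean_slice_derive (W : 'rV[R]_(1 + n) -> R) t : Ck 2 setT W ->
  is_derive t (1 : R) (fun t => mean (fun p => W (slice t p)))
    (mean (fun p => 'D_e_time W (slice t p))).
Proof.
move=> Wk.
have dWk : Ck 1 setT ('D_e_time W) by exact: Ck_D.
have ddWk : Ck 0 setT ('D_e_time ('D_e_time W)) by exact: Ck_D.
have sb G s : continuous G -> bounded_on_cube (fun p => G (slice s p) : R).
  move=> Gc; apply: cont_bounded_on_cube => p; apply: continuous_comp; last exact: Gc.
  exact: slice_continuous.
have Wc := Ck_continuous Wk; have dWc := Ck_continuous dWk.
(* |t| + 1 bounds the slice over the cube, and the displacement h has size at most 1. *)
have [B BP] := cont_bounded_ball (`|t| + 2) (Ck_continuous ddWk).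
apply: (@quad_is_derive _ _ _ _ B) => h h1.
pose F p := W (slice (t + h) p); pose G p := W (slice t p); pose H p := 'D_e_time W (slice t p).
have Fb : bounded_on_cube F by exact: sb.
have Gb : bounded_on_cube G by exact: sb.
have Hb : bounded_on_cube H by exact: (sb ('D_e_time W)).
have GFb : bounded_on_cube (fun p => -1 * G p + F p).
  have [B1 b1] := Fb; have [B2 b2] := Gb; exists (B2 + B1) => p pc.
  apply: le_trans (ler_normD _ _) _; apply: lerD; last exact: b1.
  by rewrite mulN1r normrN b2.
have -> : mean F - mean G - h * mean H = mean (fun p => (- h) * H p + (-1 * G p + F p)).
  by rewrite !mean_linear//; ring.
apply: mean_bound => // p pc.
rewrite (_ : _ + _ = W (slice t p + h *: e_time) - W (slice t p) - h * 'D_e_time W (slice t p)); last first.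
  by rewrite /F sliceD /G /H; ring.
apply: taylor1_line => c ch; split; [exact: (Ck_der Wk)|exact: (Ck_der dWk)|].
apply: BP; apply: le_trans (ler_normD _ _) _; rewrite -[2]/(1 + 1 : R) addrA.
apply: lerD.
  apply: slice_norm; rewrite ?addr_ge0// ?lerDl//.
  by apply: le_trans (in_cubeE pc) _; rewrite lerDr.
by rewrite normrZ mulr_ile1// ?(le_trans ch)// e_time_norm.
Qed.

Lemma slice_is_derive t p v : is_derive p v (slice t) (row_mx 0 v).
Proof.
have E (h : R) : slice t (h *: v + p) - slice t p = h *: (row_mx 0 v : 'rV[R]_(1 + n)).
  by rewrite /slice opp_row_mx add_row_mx subrr addrK scale_row_mx scaler0.
have L : (fun h : R => h^-1 *: ((slice t \o shift p) (h *: v) - slice t p)) @ 0^' --> (row_mx 0 v : 'rV[R]_(1 + n)).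
  apply: (@cvg_trans _ (((fun=> row_mx 0 v) : R -> 'rV[R]_(1 + n)) @ 0^')); last exact: cvg_cst.
  apply: near_eq_cvg; near=> h; rewrite /= E scalerA mulVf ?scale1r//.
  by near: h; exact: nbhs_dnbhs_neq.
split; first by apply/cvg_ex; exists (row_mx 0 v).
by apply: cvg_lim.
Unshelve. all: by end_near. Qed.

Lemma slice_Ck t k : Ck k setT (slice t).
Proof.
case: k => [|k]; first by split=> // p _; exact: slice_continuous.
apply: (CkSP (df := fun v _ => row_mx 0 v)); first exact: openT.
- by move=> p _; exact: slice_continuous.
- by move=> v p _; exact: slice_is_derive.
- by move=> v; exact: Ck_cst.
Qed.

Lemma mean_sum (I : Type) (r : seq I) (F : I -> 'rV[R]_n -> R) :
  (forall i, bounded_on_cube (F i)) ->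
  bounded_on_cube (fun p => \sum_(i <- r) F i p) /\
  mean (fun p => \sum_(i <- r) F i p) = \sum_(i <- r) mean (F i).
Proof.
move=> Fb; elim: r => [|i r [IHb IH]].
  rewrite big_nil; split; first by exists 0 => p _; rewrite big_nil normr0.
  by rewrite -[RHS](mean_cst n Q0); apply: (mean_ext Q0) => p _; rewrite big_nil.
split.
  have [B1 b1] := Fb i; have [B2 b2] := IHb; exists (B1 + B2) => p pc.
  by rewrite big_cons; apply: le_trans (ler_normD _ _) _; rewrite lerD// ?b1 ?b2.
rewrite big_cons -IH -[mean (F i)]mul1r -mean_linear//.
by apply: (mean_ext Q0) => p _; rewrite big_cons mul1r.
Qed.

End MeanDerivative.

(** * Truncated powers *)

Section Cutoff.
Variable R : realType.

(** The truncated power is of class C^(N-1). Finite smoothness is enough for a weight that is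
    differentiated only a few times. *)
Definition posX (N : nat) (x : R) : R := Order.max 0 x ^+ N.

Lemma posX_is_derive N x : is_derive x (1 : R) (posX N.+2) (N.+2%:R * posX N.+1 x).
Proof.
have [x0|x0|->] := ltgtP x 0.
- rewrite /posX (max_l (ltW x0)) expr0n mulr0.
  apply: near_eq_is_derive (isdC x (1 : R) (0 : R)).
  near=> y; rewrite max_l ?expr0n//; apply: ltW; near: y; exact: lt_nbhsl.
- rewrite /posX (max_r (ltW x0)) -[_ * _]mulr1.
  apply: near_eq_is_derive (isdX N.+1 (isd_id x)).
  near=> y; rewrite max_r//; apply: ltW; near: y; exact: lt_nbhsr.
- rewrite /posX maxxx expr0n mulr0; apply: (@quad_is_derive _ _ _ _ 1) => h h1.
  rewrite add0r maxxx expr0n mulr0 !subr0 mulr1.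
  have [h0|h0] := leP h 0; first by rewrite expr0n normr0 sqr_ge0.
  rewrite ger0_norm ?exprn_ge0 ?(ltW h0)//.
  rewrite (gtr0_norm h0) in h1.
  by rewrite -[N.+2]addn2 exprD ler_piMl ?sqr_ge0// exprn_ile1// ltW.
Unshelve. all: by end_near. Qed.

Lemma posX_Ck k : Ck k setT (posX k.+1).
Proof.
elim: k => [|k IH].
  split=> // x _; rewrite (_ : posX 1 = fun x => Order.max 0 x).
    by apply: (@continuous_max R R (fun=> 0) id); [exact: cst_continuous|exact: cvg_id].
  by apply/funext => y; rewrite /posX expr1.
apply: (@CkSP R (R : normedModType R) (R : normedModType R) k setT _ (fun v x => k.+2%:R * posX k.+1 x * v)).
- exact: openT.
- by move=> x _; exact: is_derive_cont (posX_is_derive k x).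
- move=> v x _; have h := derivableP (@derivable_id R R x v); rewrite derive_id in h.
  exact: is_derive_comp1 h (posX_is_derive k x).
- move=> v; apply: CkM; [exact: openT| |exact: Ck_cst].
  by apply: CkM; [exact: openT|exact: Ck_cst|].
Qed.

Lemma posX_le0 N x : x <= 0 -> posX N.+1 x = 0.
Proof. by move=> x0; rewrite /posX max_l// expr0n. Qed.

Lemma posX_ge0 N x : 0 <= posX N x.
Proof. by rewrite exprn_ge0// le_max lexx. Qed.

End Cutoff.

(** * The radial mean of a solution *)

Section SphericalMean.
Variables (R : realType) (n' : nat).
Let n := n'.+1.
Implicit Types (q : 'rV[R]_(1 + n)) (p : 'rV[R]_n).

Definition rad2 q : R := \sum_i q 0 (rshift 1 i) ^+ 2.

Definition off_axis : set 'rV[R]_(1 + n) := [set q | rsubmx q != 0].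

Definition e_space (i : 'I_n) : 'rV[R]_(1 + n) := row_mx 0 (basis R i).

Lemma rad2_gt0 q : (0 < rad2 q) = (rsubmx q != 0).
Proof.
rewrite lt_neqAle sumr_ge0 ?andbT; last by move=> i _; exact: sqr_ge0.
rewrite eq_sym; congr (~~ _); apply/idP/idP => [|/eqP h]; last first.
  rewrite /rad2 big1// => i _; have := congr1 (fun M : 'rV[R]_n => M 0 i) h.
  by rewrite !mxE => ->; rewrite expr0n.
rewrite psumr_eq0 => [/allP h|i _]; last exact: sqr_ge0.
apply/eqP/rowP => i; rewrite !mxE; apply/eqP; rewrite -sqrf_eq0.
by have := h i (mem_index_enum _).
Qed.

Lemma rad2_Ck k : Ck k setT rad2.
Proof.
apply: Ck_sum => [|i _]; first exact: openT.
by apply: CkX; [exact: openT|apply: Ck_coord; exact: openT].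
Qed.

Lemma rad2_continuous : continuous rad2.
Proof. exact: Ck_continuous (rad2_Ck 0). Qed.

Lemma open_rad2_lt (s : R) : open [set q | rad2 q < s].
Proof.
apply: (open_comp (f := rad2) (D := [set x : R | x < s])); last exact: open_lt.
by move=> q _; exact: rad2_continuous.
Qed.

Lemma off_axis_open : open off_axis.
Proof.
rewrite (_ : off_axis = rad2 @^-1` [set x : R | 0 < x]).
  by apply: open_comp => [q _|]; [exact: rad2_continuous|exact: open_gt].
by apply/seteqP; split=> q /=; rewrite /off_axis /= -rad2_gt0.
Qed.

Lemma rad2_slice t p : rad2 (slice t p) = \sum_i p 0 i ^+ 2.
Proof. by apply: eq_bigr => i _; rewrite row_mxEr. Qed.

(** With Q = 3 n, the box [1/Q, 2/Q]^n lies in the shell 2 rho <= |p|^2 <= 8 rho for rho = 1/(18 n),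
    and 8 rho <= 4/9; so the weight is bounded below on the box. *)
Definition inner_radius2 : R := (18 * n)%:R^-1.

(** A radial weight vanishing near the axis p = 0, where u need not be smooth, and on the faces of
    the cube, where integration by parts needs zeros. *)
Definition bump q : R := posX 5 ((rad2 q - inner_radius2) * (1 - rad2 q)).

Lemma inner_lt1 : inner_radius2 < 1.
Proof. by rewrite invf_lt1 ?ltr0n// ltr1n /n mulnS. Qed.

Lemma inner_gt0 : 0 < inner_radius2.
Proof. by rewrite invr_gt0 ltr0n. Qed.

Lemma bump_inner q : rad2 q < inner_radius2 -> bump q = 0.
Proof.
move=> h; have h1 := inner_lt1; apply: posX_le0.
by rewrite mulr_le0_ge0// ?subr_le0 ?subr_ge0 ltW// (lt_trans h).
Qed.

Lemma bump_outer q : 1 <= rad2 q -> bump q = 0.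
Proof.
move=> h; have h1 := inner_lt1; apply: posX_le0.
by rewrite mulr_ge0_le0// ?subr_le0// subr_ge0 ltW// (lt_le_trans h1).
Qed.

Lemma bump_Ck : Ck 4 setT bump.
Proof.
apply: (Ck_comp1 openT (U' := setT) (fun _ _ => I)); last exact: posX_Ck.
have o : open (setT : set 'rV[R]_(1 + n)) by exact: openT.
by apply: (CkM o); apply: (CkB o); (exact: rad2_Ck || exact: Ck_cst).
Qed.

Lemma cutoff_Ck k (mu G : 'rV[R]_(1 + n) -> R) : Ck k setT mu ->
  (forall q, rad2 q < inner_radius2 -> mu q = 0) -> Ck k off_axis G ->
  Ck k setT (fun q => mu q * G q).
Proof.
move=> muk mu0 Gk; have oo := off_axis_open.
have H1 : Ck k off_axis (fun q => mu q * G q).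
  by apply: CkM => //; apply: Ck_sub muk.
have H2 : Ck k [set q | rad2 q < inner_radius2] (fun q => mu q * G q).
  apply: Ck_ext (Ck_cst k _ (0 : R)) => [|q /= /mu0 ->]; last by rewrite mul0r.
  exact: open_rad2_lt.
apply: Ck_sub (Ck_setU H1 H2) => q _.
have [h|h] := ltP (rad2 q) inner_radius2; first by right.
by left; rewrite /off_axis /= -rad2_gt0 (lt_le_trans inner_gt0).
Qed.

Lemma rad2_is_derive q i : is_derive q (e_space i) rad2 (2 * q 0 (rshift 1 i)).
Proof.
have h := isd_sum (index_enum 'I_n) (P := xpredT)
  (fun j _ => isdX 1 (is_derive_coord q (e_space i) 0 (rshift 1 j))).
apply: is_derive_eq h _; rewrite (bigD1 i)//= big1 => [|j ji].
  by rewrite row_mxEr mxE !eqxx mulr1 addr0 expr1.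
by rewrite row_mxEr mxE eqxx (negPf ji) mulr0.
Qed.

Lemma e_spaceE i : e_space i = basis R (rshift 1 i).
Proof.
apply/rowP => j; rewrite !mxE eqxx /=; case: splitP => j' jE; rewrite !mxE.
  by rewrite (_ : (j == _) = false)//; apply/eqP => /(congr1 val) /=; rewrite jE ord1.
by rewrite eqxx (_ : (j == _) = (j' == i))// -(inj_eq val_inj) /= jE eqn_add2l.
Qed.

(* Integrating the Laplacian by parts against a radial weight kills it, because
   the gradient of the weight is radial and u is constant along rays. *)
Theorem spherical_mean (u : 'rV[R]_(1 + n) -> R) (f f1 : R -> R) (a k lam : R) :
  (forall K, Ck K off_axis u) ->
  (forall q, off_axis q -> 'D_(row_mx 0 (rsubmx q)) u q = 0) ->
  (forall t, 0 < t < a -> f t != 0) ->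
  (forall t p, 0 < t < a -> p != 0 ->
     f t ^+ 2 * 'D_(e_time R n) ('D_(e_time R n) u) (slice t p)
     + k * f t * f1 t * 'D_(e_time R n) u (slice t p)
     + rad2 (slice t p) * (\sum_i 'D_(e_space i) ('D_(e_space i) u) (slice t p))
     + lam * f t ^+ 2 * u (slice t p) = 0) ->
  (forall p, p != 0 -> u (slice 0 p) = 1) ->
  exists phi p1 p2 : R -> R,
    [/\ (forall t, is_derive t (1 : R) phi (p1 t)), (forall t, is_derive t (1 : R) p1 (p2 t)),
        continuous p2, (forall t, 0 < t < a -> f t * p2 t + k * f1 t * p1 t + lam * f t * phi t = 0) &
        phi 0 != 0].
Proof.
move=> uk uhom f0 pde u0.
have alg (x y z b c : R) : x ^+ 2 * b + (k * x * y * c + lam * x ^+ 2 * z) =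
    x * (x * b + k * y * c + lam * x * z) by ring.
pose Q := (3 * n)%N; have Q0 : (0 < Q)%N by [].
pose mean := @mean R n Q.
have oT : open (setT : set 'rV[R]_(1 + n)) by exact: openT.
have oo := off_axis_open.
set et := e_time R n.
pose ut := 'D_et u; pose utt := 'D_et ut; pose ui i := 'D_(e_space i) u.
have utk K : Ck K off_axis ut by apply: Ck_D.
have uttk K : Ck K off_axis utt by apply: Ck_D.
have uik i K : Ck K off_axis (ui i) by apply: Ck_D.
pose W q := bump q * u q; pose Wt q := bump q * ut q; pose Wtt q := bump q * utt q.
have Wk : Ck 4 setT W := cutoff_Ck bump_Ck bump_inner (uk 4%N).
have Wtk : Ck 4 setT Wt := cutoff_Ck bump_Ck bump_inner (utk 4%N).
have Wttk : Ck 4 setT Wtt := cutoff_Ck bump_Ck bump_inner (uttk 4%N).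
have slice_off t p : off_axis (slice t p) <-> p != 0 by rewrite /off_axis /= row_mxKr.
have bump_time q : is_derive q et bump 0.
  have h := isd_sum (index_enum 'I_n) (P := xpredT)
    (fun j _ => isdX 1 (is_derive_coord q et 0 (rshift 1 j))).
  have hr : is_derive q et rad2 0.
    by apply: is_derive_eq h _; rewrite big1// => j _; rewrite row_mxEr mxE mulr0.
  have hX := isdM (isdB hr (isdC q et inner_radius2)) (isdB (isdC q et 1) hr).
  have hb := is_derive_comp1 hX (posX_is_derive 3 _).
  by apply: is_derive_eq hb _; rewrite !subr0 mul0r mulr0 addr0 mulr0.
have time_der (G : 'rV[R]_(1 + n) -> R) : Ck 1 off_axis G ->
    forall q, 'D_et (fun q => bump q * G q) q = bump q * 'D_et G q.
  move=> Gk q; have [h|h] := ltP (rad2 q) inner_radius2.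
    rewrite bump_inner// mul0r.
    rewrite (derive_ext (g := fun=> 0) et (@open_rad2_lt inner_radius2))//.
      by have [_ ->] := isdC q et (0 : R).
    by move=> y /= yh; rewrite bump_inner// mul0r.
  have qo : off_axis q by rewrite /off_axis /= -rad2_gt0 (lt_le_trans inner_gt0).
  have hG := derivableP (Ck_der (v := et) Gk qo).
  have [_ ->] := isdM (bump_time q) hG.
  by rewrite mul0r add0r.
have WtE q : 'D_et W q = Wt q by apply: time_der; exact: uk.
have WttE q : 'D_et Wt q = Wtt q by apply: time_der; exact: utk.
pose phi t := mean (fun p => W (slice t p)).
pose p1 t := mean (fun p => Wt (slice t p)).
pose p2 t := mean (fun p => Wtt (slice t p)).
have d1 t : is_derive t (1 : R) phi (p1 t).
  have h := mean_slice_derive Q0 t (CkW (k := 2) (isT : (2 <= 4)%N) Wk).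
  apply: is_derive_eq h _; apply: (mean_ext Q0) => p _; exact: WtE.
have d2 t : is_derive t (1 : R) p1 (p2 t).
  have h := mean_slice_derive Q0 t (CkW (k := 2) (isT : (2 <= 4)%N) Wtk).
  apply: is_derive_eq h _; apply: (mean_ext Q0) => p _; exact: WttE.
have p2c : continuous p2.
  move=> t; have h := mean_slice_derive Q0 t (CkW (k := 2) (isT : (2 <= 4)%N) Wttk).
  exact: is_derive_cont h.
have sb t G : Ck 0 setT G -> bounded_on_cube (fun p => G (slice t p) : R).
  move=> Gc; apply: cont_bounded_on_cube => p; apply: continuous_comp; last exact: (Ck_cont Gc).
  exact: slice_continuous.
have bump_face t p i : `|p 0 i| = 1 -> bump (slice t p) = 0.
  move=> pi; apply: bump_outer; rewrite rad2_slice (bigD1 i)//= -[leLHS]addr0; apply: lerD.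
    by rewrite -(real_normK (num_real (p 0 i))) pi expr1n.
  by apply: sumr_ge0 => j _; exact: sqr_ge0.
(* The equation carries the space Laplacian with the factor |p|^2, so the field to be integrated by
   parts is |p|^2 times the weight times the gradient of u. *)
pose chi q := bump q * rad2 q.
have chik : Ck 4 setT chi := CkM oT bump_Ck (rad2_Ck 4).
have chi0 q : rad2 q < inner_radius2 -> chi q = 0 by move=> h; rewrite /chi bump_inner// mul0r.
pose V i q := chi q * ui i q.
have Vk i : Ck 4 setT (V i) := cutoff_Ck chik chi0 (uik i 4%N).
have Vmean t i : mean (fun p => 'D_(e_space i) (V i) (slice t p)) = 0.
  pose G p := V i (slice t p).
  have Gk : Ck 2 setT G.
    apply: (Ck_comp (U' := setT) openT oT (fun _ _ => I)); first exact: slice_Ck.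
    exact: CkW (Vk i).
  rewrite -(mean_deriv0 Q0 (G := G) (i := i) Gk).
    apply: (mean_ext Q0) => p _.
    have h := chain_is_derive oT (CkW (k := 1) (isT : (1 <= 4)%N) (Vk i)) I (slice_is_derive t p (basis R i)).
    by have [_ ->] := h.
  by move=> p pi; rewrite /G /V /chi (bump_face _ _ i)// !mul0r.
have key t p : 0 < t < a ->
    f t ^+ 2 * Wtt (slice t p) + (k * f t * f1 t * Wt (slice t p) + (lam * f t ^+ 2 * W (slice t p) +
    \sum_i 'D_(e_space i) (V i) (slice t p))) = 0.
  move=> ta; set q := slice t p; have [h|h] := ltP (rad2 q) inner_radius2.
    rewrite /Wtt /Wt /W bump_inner// !mul0r !mulr0 !add0r big1// => i _.
    rewrite (derive_ext (g := fun=> 0) (e_space i) (@open_rad2_lt inner_radius2))//.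
      by have [_ ->] := isdC q (e_space i) (0 : R).
    by move=> y /= yh; rewrite /V chi0// mul0r.
  have qo : off_axis q by rewrite /off_axis /= -rad2_gt0 (lt_le_trans inner_gt0).
  have p0 : p != 0 by apply/(slice_off t).
  pose X := (rad2 q - inner_radius2) * (1 - rad2 q).
  (* The space gradient of [chi] is c p, so its product with the gradient of u is c times the radial
     derivative of u. *)
  pose c := (5%:R * posX 4 X * ((1 - rad2 q) - (rad2 q - inner_radius2)) * rad2 q + bump q) * 2.
  have chid i : is_derive q (e_space i) chi (c * q 0 (rshift 1 i)).
    have hr := rad2_is_derive q i.
    have hX := isdM (isdB hr (isdC q (e_space i) inner_radius2)) (isdB (isdC q (e_space i) 1) hr).
    have hb := is_derive_comp1 hX (posX_is_derive 3 _).
    by apply: is_derive_eq (isdM hb hr) _; rewrite /c /bump -/X; ring.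
  have VE i : 'D_(e_space i) (V i) q = c * (q 0 (rshift 1 i) * ui i q) + chi q * 'D_(e_space i) (ui i) q.
    have hu := derivableP (Ck_der (v := e_space i) (uik i 1%N) qo).
    by have [_ ->] := isdM (chid i) hu; rewrite mulrA.
  have rad0 : \sum_i q 0 (rshift 1 i) * ui i q = 0.
    rewrite -[RHS](uhom q qo) (derive_basis _ oo (uk 1%N) qo) big_split_ord /= big_ord1 row_mxEl mxE mul0r add0r.
    by apply: eq_bigr => i _; rewrite /ui e_spaceE row_mxEr [rsubmx _ _ _]mxE.
  under eq_bigr do rewrite VE.
  rewrite big_split /= -!mulr_sumr rad0 mulr0 add0r /chi.
  have := pde t p ta p0; rewrite -/q -/et -/ut -/utt => E.
  rewrite (_ : _ + _ = bump q * (f t ^+ 2 * utt q + k * f t * f1 t * ut q +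
    rad2 q * (\sum_i 'D_(e_space i) (ui i) q) + lam * f t ^+ 2 * u q)); last by rewrite /Wtt /Wt /W; ring.
  by rewrite E mulr0.
exists phi, p1, p2; split=> //.
  move=> t ta.
  have Vb i : bounded_on_cube (fun p => 'D_(e_space i) (V i) (slice t p)).
    exact: (sb t _ (CkW (k := 0) (isT : (0 <= 3)%N) (Ck_D (e_space i) (Vk i)))).
  have [Sb SE] := mean_sum Q0 (index_enum 'I_n) Vb.
  have b1 : bounded_on_cube (fun p => Wtt (slice t p)) := sb t _ (CkW (k := 0) (isT : (0 <= 4)%N) Wttk).
  have b2 : bounded_on_cube (fun p => Wt (slice t p)) := sb t _ (CkW (k := 0) (isT : (0 <= 4)%N) Wtk).
  have b3 : bounded_on_cube (fun p => W (slice t p)) := sb t _ (CkW (k := 0) (isT : (0 <= 4)%N) Wk).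
  have lb (c : R) F G : bounded_on_cube F -> bounded_on_cube G -> bounded_on_cube (fun p : 'rV[R]_n => c * F p + G p).
    move=> [B1 h1] [B2 h2]; exists (`|c| * B1 + B2) => p pc.
    by apply: le_trans (ler_normD _ _) _; rewrite lerD ?h2// normrM ler_wpM2l// h1.
  have : mean (fun p => f t ^+ 2 * Wtt (slice t p) + (k * f t * f1 t * Wt (slice t p) +
     (lam * f t ^+ 2 * W (slice t p) + \sum_i 'D_(e_space i) (V i) (slice t p)))) = 0.
    by rewrite -[RHS](mean_cst n Q0 0); apply: (mean_ext Q0) => p _; exact: key.
  have b4 := lb (lam * f t ^+ 2) _ _ b3 Sb; have b5 := lb (k * f t * f1 t) _ _ b2 b4.
  rewrite /mean (mean_linear Q0 _ b1 b5) (mean_linear Q0 _ b2 b4) (mean_linear Q0 _ b3 Sb).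
  rewrite SE big1 => [|i _]; last exact: Vmean.
  by rewrite addr0 alg => /eqP; rewrite mulf_eq0 (negPf (f0 t ta)) => /eqP.
(* On the box of [mean_ge] the two factors in [bump] are at least [inner_radius2] and 1/2. *)
pose e := (inner_radius2 / 2) ^+ 5.
have e0 : 0 < e by rewrite exprn_gt0// divr_gt0// inner_gt0.
have W0 p : W (slice 0 p) = bump (slice 0 p).
  have [->|pn] := eqVneq p 0.
    rewrite /W bump_inner ?mul0r// rad2_slice big1 ?inner_gt0// => i _.
    by rewrite mxE expr0n.
  by rewrite /W u0// mulr1.
rewrite gt_eqF//; apply: lt_le_trans (_ : e * ((2 * Q)%:R^-1) ^+ n <= _).
  by rewrite mulr_gt0// exprn_gt0// invr_gt0 ltr0n.
apply: mean_ge; rewrite ?(ltW e0)//.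
- by rewrite /Q /n mulnS.
- by move=> p _; rewrite W0 posX_ge0.
- exact: (sb 0 _ (CkW (k := 0) (isT : (0 <= 4)%N) Wk)).
move=> p pQ; rewrite W0 /bump /posX /e.
have QR : 0 < (Q%:R : R) by rewrite ltr0n.
have n0 : 0 < (n%:R : R) by rewrite ltr0n.
have QE : (Q%:R : R) = 3 * n%:R by rewrite /Q natrM.
have sq i : Q%:R^-1 ^+ 2 <= p 0 i ^+ 2 <= (2 * Q%:R^-1) ^+ 2.
  have /andP[l r] := pQ i; have q0 : 0 <= (Q%:R^-1 : R) by rewrite invr_ge0 ltW.
  by rewrite !ler_pXn2r ?nnegrE// ?(le_trans q0 l)// ?l ?r// mulr_ge0.
have lo : n%:R * Q%:R^-1 ^+ 2 <= rad2 (slice 0 p).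
  rewrite rad2_slice -[X in X%:R * _](card_ord n) mulr_natl -sumr_const.
  by apply: ler_sum => i _; have /andP[] := sq i.
have hi : rad2 (slice 0 p) <= n%:R * (2 * Q%:R^-1) ^+ 2.
  rewrite rad2_slice -[X in X%:R * _](card_ord n) mulr_natl -sumr_const.
  by apply: ler_sum => i _; have /andP[] := sq i.
have i0 := inner_gt0.
have loE : n%:R * Q%:R^-1 ^+ 2 = inner_radius2 + inner_radius2.
  by rewrite QE /inner_radius2 natrM; field; rewrite gt_eqF.
have hiE : n%:R * (2 * Q%:R^-1) ^+ 2 = 8 * inner_radius2.
  by rewrite QE /inner_radius2 natrM; field; rewrite gt_eqF.
have i1 : inner_radius2 <= 1 / 18.
  rewrite /inner_radius2 mul1r lef_pV2 ?posrE ?ltr0n// ler_nat /n; lia.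
rewrite loE in lo; rewrite hiE in hi; rewrite lerXn2r ?nnegrE ?divr_ge0 ?(ltW i0)//.
  by rewrite le_max lexx.
rewrite le_max; apply/orP; right; apply: ler_pM; rewrite ?(ltW i0)//; lra.
Qed.

End SphericalMean.

(** * The Gauss equation *)

Section Dot.
Variables (R : realType) (m : nat).
Implicit Types (u v w : 'rV[R]_m) (a : R).

Lemma dotC u v : dot u v = dot v u.
Proof. by apply: eq_bigr => i _; rewrite mulrC. Qed.

Lemma dotDl u v w : dot (u + v) w = dot u w + dot v w.
Proof. by rewrite /dot -big_split; apply: eq_bigr => i _; rewrite mxE mulrDl. Qed.

Lemma dotDr u v w : dot w (u + v) = dot w u + dot w v.
Proof. by rewrite dotC dotDl !(dotC w). Qed.

Lemma dotZl a u v : dot (a *: u) v = a * dot u v.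
Proof. by rewrite /dot mulr_sumr; apply: eq_bigr => i _; rewrite mxE mulrA. Qed.

Lemma dotZr a u v : dot u (a *: v) = a * dot u v.
Proof. by rewrite dotC dotZl dotC. Qed.

Lemma dotNl u v : dot (- u) v = - dot u v.
Proof. by rewrite -scaleN1r dotZl mulN1r. Qed.

Lemma dotNr u v : dot u (- v) = - dot u v.
Proof. by rewrite dotC dotNl dotC. Qed.

Lemma dotBl u v w : dot (u - v) w = dot u w - dot v w.
Proof. by rewrite dotDl dotNl. Qed.

Lemma dotBr u v w : dot w (u - v) = dot w u - dot w v.
Proof. by rewrite dotDr dotNr. Qed.

Lemma dot0l u : dot 0 u = 0.
Proof. by rewrite /dot big1// => i _; rewrite mxE mul0r. Qed.

Lemma dot0r u : dot u 0 = 0.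
Proof. by rewrite dotC dot0l. Qed.

Lemma dot_suml (I : Type) (r : seq I) (P : pred I) (F : I -> 'rV[R]_m) v :
  dot (\sum_(i <- r | P i) F i) v = \sum_(i <- r | P i) dot (F i) v.
Proof.
by apply: (big_morph (fun u => dot u v)) => [x y|]; [exact: dotDl|exact: dot0l].
Qed.

Lemma dot_ge0 u : 0 <= dot u u.
Proof. by apply: sumr_ge0 => i _; rewrite -expr2 sqr_ge0. Qed.

Lemma dot_eq0 u : (dot u u == 0) = (u == 0).
Proof.
rewrite psumr_eq0 => [|i _]; last by rewrite -expr2 sqr_ge0.
apply/allP/eqP => [h|-> i _]; last by rewrite mxE mul0r eqxx.
apply/rowP => i; rewrite mxE; apply/eqP; rewrite -sqrf_eq0 expr2.
exact: implyP (h i (mem_index_enum i)) isT.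
Qed.

Lemma dot_gt0 u : (0 < dot u u) = (u != 0).
Proof. by rewrite lt_neqAle dot_ge0 andbT eq_sym dot_eq0. Qed.

Lemma dotE u v : dot u v = (u *m v^T) 0 0.
Proof. by rewrite mxE; apply: eq_bigr => i _; rewrite mxE. Qed.

Lemma dot_basisr u i : dot u (basis R i) = u 0 i.
Proof.
rewrite /dot (bigD1 i)//= big1 => [|j ji]; first by rewrite mxE !eqxx mulr1 addr0.
by rewrite mxE (negPf ji) andbF mulr0.
Qed.

Lemma dot_basisl u i : dot (basis R i) u = u 0 i.
Proof. by rewrite dotC dot_basisr. Qed.

End Dot.

(** * Calculus of vector-valued maps *)

Section VectorCalculus.
Variable R : realType.
Implicit Types V : normedModType R.

Lemma is_derive_mxP V m n (f : V -> 'M[R]_(m, n)) x v w :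
  is_derive x v f w <-> forall i j, is_derive x v (fun y => f y i j) (w i j).
Proof.
split=> [[fd fE] i j|fd].
  by split; [exact: (derivable_mxP _ _ _).1 fd i j|rewrite derive_coord// fE].
have fd' : derivable f x v.
  by apply/derivable_mxP => i j; case: (fd i j).
by split=> //; rewrite derive_mx//; apply/matrixP => i j; rewrite mxE; case: (fd i j).
Qed.

Lemma isd_dot V m (F G : V -> 'rV[R]_m) x v a b :
  is_derive x v F a -> is_derive x v G b ->
  is_derive x v (fun y => dot (F y) (G y)) (dot a (G x) + dot b (F x)).
Proof.
move=> /is_derive_mxP Fa /is_derive_mxP Gb.
have h := isd_sum (index_enum 'I_m) (P := xpredT) (fun i _ => isdM (Fa 0 i) (Gb 0 i)).
by rewrite (dotC b); apply: is_derive_eq h _; rewrite big_split.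
Qed.

Lemma isdZ_row V m (c : V -> R) (F : V -> 'rV[R]_m) x v b a :
  is_derive x v c b -> is_derive x v F a ->
  is_derive x v (fun y => c y *: F y) (b *: F x + c x *: a).
Proof.
move=> cb /is_derive_mxP Fa; apply/is_derive_mxP => i j.
rewrite !mxE (_ : (fun y => _) = (fun y => c y * F y i j)); first exact: isdM.
by apply/funext => y; rewrite mxE.
Qed.

Lemma chain_is_derive_row V m k (U : set 'rV[R]_m) (g : 'rV[R]_m -> 'rV[R]_k)
    (f : V -> 'rV[R]_m) x v w :
  open U -> Ck 1 U g -> U (f x) -> is_derive x v f w ->
  is_derive x v (fun y => g (f y)) ('D_w g (f x)).
Proof.
move=> Uo gk Ux fw; apply/is_derive_mxP => i j.
have h := chain_is_derive Uo ((Ck_mxP 1 g Uo).1 gk i j) Ux fw.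
by apply: is_derive_eq h _; apply: derive_coord; exact: Ck_der gk Ux.
Qed.

Lemma derive_basis_row m k (U : set 'rV[R]_m) (f : 'rV[R]_m -> 'rV[R]_k) x v :
  open U -> Ck 1 U f -> U x ->
  'D_v f x = \sum_i v 0 i *: 'D_(basis R i) f x.
Proof.
move=> Uo fk Ux; apply/rowP => j; rewrite summxE.
have fd w : derivable f x w by exact: Ck_der fk Ux.
rewrite -derive_coord// (derive_basis v Uo ((Ck_mxP 1 f Uo).1 fk 0 j) Ux).
by apply: eq_bigr => i _; rewrite mxE derive_coord.
Qed.

Lemma smooth_is_derive V (W : normedModType R) (U : set V) (F : V -> W) x v :
  smooth U F -> U x -> is_derive x v F ('D_v F x).
Proof. by move=> Fs Ux; apply: derivableP; exact: Ck_der (Fs 1%N) Ux. Qed.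

Lemma smooth_D V (W : normedModType R) (U : set V) (F : V -> W) v :
  smooth U F -> smooth U ('D_v F).
Proof. by move=> Fs k; apply: Ck_D. Qed.

Lemma smooth_sub V (W : normedModType R) (U U' : set V) (F : V -> W) :
  U' `<=` U -> smooth U F -> smooth U' F.
Proof. by move=> UU Fs k; apply: Ck_sub UU (Fs k). Qed.

Lemma smooth_mxP V m n (U : set V) (f : V -> 'M[R]_(m, n)) : open U ->
  smooth U f <-> forall i j, smooth U (fun x => f x i j).
Proof.
move=> Uo; split=> [fs i j k|fs k]; first exact: (Ck_mxP k f Uo).1.
by apply/Ck_mxP => // i j; exact: fs.
Qed.

Lemma smooth_comp V m k (U : set V) (U' : set 'rV[R]_m) (f : V -> 'rV[R]_m)
    (g : 'rV[R]_m -> 'rV[R]_k) :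
  open U -> open U' -> (forall x, U x -> U' (f x)) ->
  smooth U f -> smooth U' g -> smooth U (fun x => g (f x)).
Proof.
move=> Uo Uo' UU fs gs; apply/smooth_mxP => // i j K.
exact: (Ck_comp Uo Uo' UU (fs K) ((Ck_mxP K g Uo').1 (gs K) i j)).
Qed.

Lemma smooth_dot V m (U : set V) (F G : V -> 'rV[R]_m) : open U ->
  smooth U F -> smooth U G -> smooth U (fun x => dot (F x) (G x)).
Proof.
move=> Uo Fs Gs k; apply: Ck_sum => // i _; apply: CkM => //; first exact: (Ck_mxP k F Uo).1.
exact: (Ck_mxP k G Uo).1.
Qed.

Lemma smooth_scale V m (U : set V) (c : V -> R) (F : V -> 'rV[R]_m) : open U ->
  smooth U c -> smooth U F -> smooth U (fun x => c x *: F x).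
Proof.
move=> Uo cs Fs; apply/smooth_mxP => // i j k.
rewrite (_ : (fun x => _) = (fun x => c x * F x i j)); last by apply/funext => y; rewrite mxE.
by apply: CkM => //; exact: (Ck_mxP k F Uo).1.
Qed.

Lemma Schwarz_row V m (U : set V) (f : V -> 'rV[R]_m) x v w : open U ->
  smooth U f -> U x -> 'D_w ('D_v f) x = 'D_v ('D_w f) x.
Proof.
move=> Uo fs Ux; apply/rowP => j.
have key a b : ('D_a ('D_b f) x) 0 j = 'D_a ('D_b (fun y => f y 0 j)) x.
  rewrite -derive_coord; last exact: Ck_der (smooth_D b fs 1%N) Ux.
  apply: derive_ext Uo _ Ux => y Uy; symmetry; apply: derive_coord.
  exact: Ck_der (fs 1%N) Uy.
have f2 := (Ck_mxP 2 f Uo).1 (fs 2%N) 0 j.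
exact: etrans (key w v) (etrans (Schwarz v w Uo f2 Ux) (esym (key v w))).
Qed.

Lemma smooth_det V n (U : set V) (A : V -> 'M[R]_n) : open U ->
  (forall i j, smooth U (fun x => A x i j)) -> smooth U (fun x => \det (A x)).
Proof.
move=> Uo As k; apply: Ck_sum => // s _; apply: CkM => //; first exact: Ck_cst.
by apply: Ck_prod => // i _; exact: As.
Qed.

Lemma smooth_invmx V n (U : set V) (A : V -> 'M[R]_n) i j : open U ->
  (forall i j, smooth U (fun x => A x i j)) -> (forall x, U x -> A x \in unitmx) ->
  smooth U (fun x => invmx (A x) i j).
Proof.
move=> Uo As Au k.
apply: (@Ck_ext R _ _ k U (fun x => (\det (A x))^-1 * \adj (A x) i j)) => //.
  by move=> x Ux; rewrite /invmx Au//= [RHS]mxE.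
apply: CkM => //.
  apply: CkV => // [x /Au|]; last exact: smooth_det.
  by rewrite unitmxE unitfE.
rewrite (_ : (fun x => _) = (fun x => (-1) ^+ (j + i) * \det (row' j (col' i (A x))))); last first.
  by apply/funext => x; rewrite mxE /cofactor.
apply: CkM => //; first exact: Ck_cst.
apply: smooth_det => // a b; rewrite (_ : (fun x => _) = (fun x => A x (lift j a) (lift i b))) //.
by apply/funext => x; rewrite !mxE.
Qed.

End VectorCalculus.

Lemma formE (R : realType) n (A : 'M[R]_n) v w : form A v w = (v *m A *m w^T) 0 0.
Proof.
rewrite mxE; under [RHS]eq_bigr do rewrite mxE [_^T _ _]mxE mulr_suml.
by rewrite exchange_big.
Qed.

Lemma formZZ (R : realType) n (A : 'M[R]_n) (c : R) v w : form A (c *: v) (c *: w) = c ^+ 2 * form A v w.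
Proof. by rewrite !formE linearZ /= -!scalemxAl -scalemxAr scalerA mxE. Qed.

Lemma curvatureZl (R : realType) n (G : 'rV[R]_n -> 'M[R]_n) u (c : R) v w z :
  curvature G u (c *: v) w z = c *: curvature G u v w z.
Proof.
apply/rowP => l; rewrite !mxE mulr_sumr; apply: eq_bigr => i _.
rewrite mulr_sumr; apply: eq_bigr => j _; rewrite mulr_sumr; apply: eq_bigr => k _.
by rewrite mxE !mulrA.
Qed.

(** * The Ricci tensor in a tight frame *)

Section Frame.
Variables (R : realType) (n r : nat) (G : 'rV[R]_n -> 'M[R]_n) (u : 'rV[R]_n).
Variable V : 'M[R]_(r, n).
Hypothesis VG : V^T *m V *m G u = 1%:M.

(** [VG] says that the inverse of G is V^T V, so a trace is a sum over the rows of V. These may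
    outnumber the dimension. *)
Lemma ric_frame v :
  ric G u v v = \sum_a form (G u) (curvature G u (row a V) v v) (row a V).
Proof.
pose C := \matrix_(i, l) \sum_j \sum_k v 0 j * v 0 k * riemann G l i j k u.
have CE z : curvature G u z v v = z *m C.
  apply/rowP => l; rewrite !mxE; apply: eq_bigr => i _; rewrite mxE mulr_sumr.
  by apply: eq_bigr => j _; rewrite mulr_sumr; apply: eq_bigr => k _; rewrite !mulrA.
rewrite [LHS](_ : _ = \tr C); last first.
  apply: eq_bigr => i _; rewrite CE mxE (bigD1 i)//= big1 => [|j ji].
    by rewrite addr0 mxE !eqxx mul1r.
  by rewrite mxE (negPf ji) andbF mul0r.
rewrite -[C in LHS]mulmx1 -(mulmx1C VG) !mulmxA mxtrace_mulC !mulmxA.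
apply: eq_bigr => a _; rewrite CE formE.
by rewrite tr_row mxE [RHS]mxE; apply: eq_bigr => j _; rewrite -!row_mul [row _ _ _ _]mxE [col _ _ _ _]mxE.
Qed.

End Frame.

Section Perp.
Variables (R : realType) (n M : nat) (J : 'M[R]_(n, M)) (A : 'M[R]_n).
Implicit Types (h : 'rV[R]_M) (v w : 'rV[R]_n).

(* The inner product of the components normal to the rows of J, when A is the
   inverse of their Gram matrix. *)
Definition perp_dot h h' : R := (h *m (1%:M - J^T *m A *m J) *m h'^T) 0 0.

Lemma perp_dotDl h1 h2 h : perp_dot (h1 + h2) h = perp_dot h1 h + perp_dot h2 h.
Proof. by rewrite /perp_dot !mulmxDl mxE. Qed.

Lemma perp_dotDr h1 h2 h : perp_dot h (h1 + h2) = perp_dot h h1 + perp_dot h h2.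
Proof. by rewrite /perp_dot [(_ + _)^T]raddfD !mulmxDr mxE. Qed.

Lemma perp_dotZl (c : R) h h' : perp_dot (c *: h) h' = c * perp_dot h h'.
Proof. by rewrite /perp_dot -!scalemxAl mxE. Qed.

Lemma perp_dotZr (c : R) h h' : perp_dot h (c *: h') = c * perp_dot h h'.
Proof. by rewrite /perp_dot linearZ /= -!scalemxAr mxE. Qed.

Lemma perp_dot_suml (I : Type) (r : seq I) (P : pred I) (F : I -> 'rV[R]_M) h :
  perp_dot (\sum_(i <- r | P i) F i) h = \sum_(i <- r | P i) perp_dot (F i) h.
Proof.
apply: (big_morph (fun x => perp_dot x h)) => [x y|]; first exact: perp_dotDl.
by rewrite -(scale0r (0 : 'rV[R]_M)) perp_dotZl mul0r.
Qed.

Lemma perp_dot_sumr (I : Type) (r : seq I) (P : pred I) (F : I -> 'rV[R]_M) h :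
  perp_dot h (\sum_(i <- r | P i) F i) = \sum_(i <- r | P i) perp_dot h (F i).
Proof.
apply: (big_morph (perp_dot h)) => [x y|]; first exact: perp_dotDr.
by rewrite -(scale0r (0 : 'rV[R]_M)) perp_dotZr mul0r.
Qed.

Lemma perp_dotE h h' : perp_dot h h' = dot h h' -
  \sum_l dot h (row l J) * \sum_m A l m * dot h' (row m J).
Proof.
rewrite /perp_dot mulmxBr mulmx1 mulmxBl mxE [X in _ + X]mxE -dotE; congr (_ - _).
rewrite !mulmxA -(mulmxA _ J) mxE; under eq_bigr do rewrite mxE mulr_suml.
rewrite exchange_big; apply: eq_bigr => l _ /=; rewrite mulr_sumr; apply: eq_bigr => m _.
rewrite mulrA; congr (_ * _ * _); rewrite mxE; apply: eq_bigr => j _; rewrite !mxE//.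
by rewrite mulrC.
Qed.

Hypothesis AJ : A *m (J *m J^T) = 1%:M.

Lemma gram_inv_tr : A^T = A.
Proof.
have JA : (J *m J^T) *m A = 1%:M by exact: mulmx1C.
have := congr1 (fun B => A^T *m B) JA; rewrite mulmx1 => <-.
have : ((J *m J^T) *m A)^T = 1%:M by rewrite JA trmx1.
by rewrite trmx_mul trmx_mul trmxK => E; rewrite mulmxA E mul1mx.
Qed.

Lemma perp_dotC h h' : perp_dot h h' = perp_dot h' h.
Proof.
have tr0 (B : 'M[R]_1) : B 0 0 = B^T 0 0 by rewrite mxE.
rewrite /perp_dot tr0 !trmx_mul trmxK [(_ - _)^T]raddfB /= trmx1 !trmx_mul trmxK gram_inv_tr.
by rewrite !mulmxA.
Qed.

Lemma perp_dot_tangentr h v : perp_dot h (v *m J) = 0.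
Proof.
rewrite /perp_dot trmx_mul -mulmxA (mulmxA _ J^T) mulmxBl mul1mx -!mulmxA AJ mulmx1 subrr.
by rewrite mul0mx mulmx0 mxE.
Qed.

Variable B : 'I_n -> 'I_n -> 'rV[R]_M.

Definition bilin v w : 'rV[R]_M := \sum_i \sum_j (v 0 i * w 0 j) *: B i j.

Lemma perp_dot_bilin a b c e : perp_dot (bilin a b) (bilin c e) =
  \sum_i \sum_p \sum_j \sum_k a 0 i * b 0 p * c 0 j * e 0 k * perp_dot (B i p) (B j k).
Proof.
rewrite perp_dot_suml; apply: eq_bigr => i _.
rewrite perp_dot_suml; apply: eq_bigr => p _.
rewrite perp_dot_sumr; apply: eq_bigr => j _.
rewrite perp_dot_sumr; apply: eq_bigr => k _.
by rewrite perp_dotZl perp_dotZr; ring.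
Qed.

Hypothesis BC : forall i j, B i j = B j i.

Lemma bilinC v w : bilin v w = bilin w v.
Proof.
rewrite /bilin exchange_big; apply: eq_bigr => j _; apply: eq_bigr => i _.
by rewrite mulrC BC.
Qed.

Variable Rm : 'I_n -> 'I_n -> 'I_n -> 'I_n -> R.
Hypothesis gauss : forall p i j k, \sum_l (J *m J^T) p l * Rm l i j k =
  perp_dot (B i p) (B j k) - perp_dot (B j p) (B i k).

Lemma gauss_form v w :
  form (J *m J^T) (\row_l \sum_i \sum_j \sum_k v 0 i * w 0 j * w 0 k * Rm l i j k) v =
  perp_dot (bilin v v) (bilin w w) - perp_dot (bilin v w) (bilin v w).
Proof.
have JJ i j : (J *m J^T) i j = (J *m J^T) j i.
  by rewrite -[in LHS](trmxK J) -trmx_mul trmxK mxE.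
rewrite [X in _ - perp_dot X _]bilinC !perp_dot_bilin.
have -> : \sum_i \sum_p \sum_j \sum_k w 0 i * v 0 p * v 0 j * w 0 k * perp_dot (B i p) (B j k)
    = \sum_i \sum_p \sum_j \sum_k v 0 i * v 0 p * w 0 j * w 0 k * perp_dot (B j p) (B i k).
  rewrite exchange_big /=; under eq_bigr do rewrite exchange_big /=.
  rewrite exchange_big /=; apply: eq_bigr => i _; apply: eq_bigr => p _.
  by apply: eq_bigr => j _; apply: eq_bigr => k _; ring.
rewrite -sumrB; transitivity (\sum_i \sum_p v 0 p * v 0 i *
   \sum_j \sum_k w 0 j * w 0 k * \sum_l (J *m J^T) p l * Rm l i j k).
  rewrite /form exchange_big /= [RHS]exchange_big /=; apply: eq_bigr => p _.
  under eq_bigr do rewrite mxE -mulrA mulr_suml.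
  rewrite exchange_big /=; apply: eq_bigr => i _.
  rewrite mulr_sumr; under eq_bigr do rewrite mulr_suml.
  rewrite exchange_big /=; apply: eq_bigr => j _.
  rewrite mulr_sumr; under eq_bigr do rewrite mulr_suml.
  rewrite exchange_big /=; apply: eq_bigr => k _.
  rewrite !mulr_sumr; apply: eq_bigr => l _.
  by rewrite (JJ l p); ring.
apply: eq_bigr => i _; rewrite -sumrB; apply: eq_bigr => p _.
rewrite mulr_sumr -sumrB; apply: eq_bigr => j _.
rewrite mulr_sumr -sumrB; apply: eq_bigr => k _.
by rewrite gauss; ring.
Qed.

End Perp.

(** * The Gauss equation as pointwise algebra *)

Section GaussAlgebra.
Variables (R : realType) (n M : nat).
Variables (d : 'I_n -> 'rV[R]_M) (D : 'I_n -> 'I_n -> 'rV[R]_M).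
Variables (T : 'I_n -> 'I_n -> 'I_n -> 'rV[R]_M) (nd : 'rV[R]_M -> 'rV[R]_M -> R).
Variables (C : 'I_n -> 'I_n -> 'I_n -> R) (dC : 'I_n -> 'I_n -> 'I_n -> 'I_n -> R).
Hypothesis dotC_tangent : forall h i j,
  \sum_l dot h (d l) * C l i j = dot h (D i j) - nd h (D i j).
Hypothesis gramC : forall p i j, \sum_l dot (d p) (d l) * C l i j = dot (D i j) (d p).
Hypothesis derive_gramC : forall p a b c,
  \sum_l ((dot (D a p) (d l) + dot (D a l) (d p)) * C l b c + dot (d p) (d l) * dC a l b c)
  = dot (T a b c) (d p) + dot (D a p) (D b c).
Hypothesis TC : forall i j k, T i j k = T j i k.

(** d, D and T stand for the first, second and third derivatives of the immersion, C and dC for the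
    Christoffel symbols and their derivatives, nd for the normal product. [derive_gramC] is [gramC]
    differentiated; antisymmetrizing it in i and j removes T. *)
Lemma gauss_algebra p i j k :
  \sum_l dot (d p) (d l) *
    (dC i l j k - dC j l i k + \sum_m (C l i m * C m j k - C l j m * C m i k)) =
  nd (D i p) (D j k) - nd (D j p) (D i k).
Proof.
have key a b c : \sum_l dot (d p) (d l) * dC a l b c =
    dot (T a b c) (d p) + nd (D a p) (D b c) - \sum_l dot (D a l) (d p) * C l b c.
  have := derive_gramC p a b c; rewrite big_split /=.
  rewrite (_ : \sum_(i0 < n) (dot (D a p) _ + _) * _ =
    \sum_l dot (D a p) (d l) * C l b c + \sum_l dot (D a l) (d p) * C l b c); last first.
    by rewrite -big_split; apply: eq_bigr => l _; rewrite mulrDl.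
  rewrite dotC_tangent => E; lra.
transitivity (\sum_l dot (d p) (d l) * dC i l j k - \sum_l dot (d p) (d l) * dC j l i k
    + (\sum_m dot (D i m) (d p) * C m j k - \sum_m dot (D j m) (d p) * C m i k)).
  have -> : \sum_m dot (D i m) (d p) * C m j k - \sum_m dot (D j m) (d p) * C m i k =
    \sum_l dot (d p) (d l) * \sum_m (C l i m * C m j k - C l j m * C m i k).
    under [RHS]eq_bigr do rewrite mulr_sumr.
    rewrite exchange_big -sumrB; apply: eq_bigr => m _; rewrite -!gramC !mulr_suml -sumrB.
    by apply: eq_bigr => l _ /=; ring.
  rewrite -sumrB -big_split; apply: eq_bigr => l _ /=; ring.
rewrite !key (TC j i); lra.
Qed.

End GaussAlgebra.

(** * The Gauss equation of an immersed chart *)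

Section Gauss.
Variables (R : realType) (n M : nat) (X : 'rV[R]_n -> 'rV[R]_M).
Hypothesis Xs : smooth setT X.
Implicit Types (u v w : 'rV[R]_n) (h : 'rV[R]_M).

Definition jacobian u : 'M[R]_(n, M) := \matrix_i 'D_(basis R i) X u.

Definition gram u : 'M[R]_n := jacobian u *m (jacobian u)^T.

Definition partial2 u i j : 'rV[R]_M := 'D_(basis R i) ('D_(basis R j) X) u.

Lemma row_jacobian u i : row i (jacobian u) = 'D_(basis R i) X u.
Proof. exact: rowK. Qed.

Lemma gramE u i j : gram u i j = dot ('D_(basis R i) X u) ('D_(basis R j) X u).
Proof. by rewrite mxE; apply: eq_bigr => k _; rewrite !mxE. Qed.

Lemma derive_jacobian u v : 'D_v X u = v *m jacobian u.
Proof.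
rewrite (derive_basis_row v openT (Xs 1%N) I) mulmx_sum_row.
by apply: eq_bigr => i _; rewrite row_jacobian.
Qed.

Lemma gram_form u v w : form (gram u) v w = dot ('D_v X u) ('D_w X u).
Proof. by rewrite !derive_jacobian formE dotE trmx_mul /gram !mulmxA. Qed.

Lemma partial2C u i j : partial2 u i j = partial2 u j i.
Proof. exact: (Schwarz_row _ _ openT Xs I). Qed.

Lemma partial2_isd u i j : is_derive u (basis R i) ('D_(basis R j) X) (partial2 u i j).
Proof. exact: (smooth_is_derive _ (smooth_D _ Xs) I). Qed.

Lemma gram_smooth i j : smooth setT (fun u => gram u i j).
Proof.
rewrite (_ : (fun u => _) = (fun u => dot ('D_(basis R i) X u) ('D_(basis R j) X u))).
  by apply: (smooth_dot openT); exact: (smooth_D _ Xs).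
by apply/funext => u; exact: gramE.
Qed.

Lemma pd_gram i j l u : pd i (fun y => gram y j l) u =
  dot (partial2 u i j) ('D_(basis R l) X u) + dot (partial2 u i l) ('D_(basis R j) X u).
Proof.
have h := isd_dot (partial2_isd u i j) (partial2_isd u i l).
rewrite /pd (_ : (fun y => _) = (fun y => dot ('D_(basis R j) X y) ('D_(basis R l) X y))).
  by case: h.
by apply/funext => y; exact: gramE.
Qed.

Hypothesis Gu : forall u, gram u \in unitmx.

Lemma inv_gramK u : invmx (gram u) *m (jacobian u *m (jacobian u)^T) = 1%:M.
Proof. exact: mulVmx. Qed.

Lemma inv_gram_smooth i j : smooth setT (fun u => invmx (gram u) i j).
Proof. by apply: (smooth_invmx i j openT gram_smooth) => u _; exact: Gu. Qed.

(** In Koszul's combination of derivatives of the metric, symmetry of second derivatives leaves only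
    twice the product of d_i d_j X with d_l X. *)
Lemma christoffel_gram k i j u : christoffel gram k i j u =
  \sum_l invmx (gram u) k l * dot (partial2 u i j) ('D_(basis R l) X u).
Proof.
rewrite /christoffel mulr_sumr; apply: eq_bigr => l _; rewrite !pd_gram.
rewrite (partial2C u j i) (partial2C u l i) (partial2C u l j).
have alg (g a b c : R) : 2^-1 * (g * (a + b + (a + c) - (b + c))) = g * a by field.
exact: alg.
Qed.

Lemma gram_christoffel p i j u : \sum_l gram u p l * christoffel gram l i j u =
  dot (partial2 u i j) ('D_(basis R p) X u).
Proof.
transitivity (\sum_m (gram u *m invmx (gram u)) p m * dot (partial2 u i j) ('D_(basis R m) X u)).
  under eq_bigr do rewrite christoffel_gram mulr_sumr.
  rewrite exchange_big; apply: eq_bigr => m _; rewrite mxE mulr_suml.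
  by apply: eq_bigr => l _; rewrite mulrA.
rewrite mulmxV// (bigD1 p)//= big1 => [|m mp]; first by rewrite mxE eqxx mul1r addr0.
by rewrite mxE eq_sym (negPf mp) mul0r.
Qed.

Lemma christoffel_smooth k i j : smooth setT (christoffel gram k i j).
Proof.
rewrite (_ : christoffel gram k i j =
  fun u => \sum_l invmx (gram u) k l * dot (partial2 u i j) ('D_(basis R l) X u)); last first.
  by apply/funext => u; exact: christoffel_gram.
move=> K; apply: Ck_sum => [|l _]; first exact: openT.
apply: (CkM openT); first exact: inv_gram_smooth.
by apply: (smooth_dot openT); [exact: smooth_D (smooth_D _ Xs)|exact: smooth_D].
Qed.

(** Normality refers to the ambient Euclidean space. For a map into the unit sphere, X itself is
    therefore a normal vector. *)
Definition normal_dot u := perp_dot (jacobian u) (invmx (gram u)).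

Lemma dot_christoffel h i j u : \sum_l dot h ('D_(basis R l) X u) * christoffel gram l i j u =
  dot h (partial2 u i j) - normal_dot u h (partial2 u i j).
Proof.
rewrite /normal_dot perp_dotE opprB addrC subrK; apply: eq_bigr => k _.
rewrite christoffel_gram row_jacobian; congr (_ * _).
by apply: eq_bigr => l _; rewrite row_jacobian.
Qed.

Theorem gauss_equation p i j k u : \sum_l gram u p l * riemann gram l i j k u =
  normal_dot u (partial2 u i p) (partial2 u j k) - normal_dot u (partial2 u j p) (partial2 u i k).
Proof.
under eq_bigr do rewrite gramE.
apply: (gauss_algebra (D := partial2 u) (nd := normal_dot u)
  (C := fun l i j => christoffel gram l i j u) (dC := fun a l b c => pd a (christoffel gram l b c) u)
  (T := fun a b c => 'D_(basis R a) ('D_(basis R b) ('D_(basis R c) X)) u)).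
- by move=> h a b; exact: dot_christoffel.
- by move=> q a b; rewrite -gram_christoffel; apply: eq_bigr => l _; rewrite gramE.
- move=> q a b c.
  have h1 := isd_dot
    (smooth_is_derive (basis R a) (smooth_D (basis R b) (smooth_D (basis R c) Xs)) (I : setT u))
    (partial2_isd u a q).
  have h2 := isd_sum (index_enum 'I_n) (P := xpredT) (fun l _ => isdM
     (isd_dot (partial2_isd u a q) (partial2_isd u a l))
     (smooth_is_derive (basis R a) (christoffel_smooth l b c) (I : setT u))).
  (* Both sides of [gram_christoffel] are differentiated along d_a, and uniqueness of the derivative
     equates the results. *)
  have E : (fun y => \sum_l dot ('D_(basis R q) X y) ('D_(basis R l) X y) * christoffel gram l b c y) =
      (fun y => dot ('D_(basis R b) ('D_(basis R c) X) y) ('D_(basis R q) X y)).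
    apply/funext => y; rewrite -/(partial2 y b c) -gram_christoffel.
    by apply: eq_bigr => l _; rewrite gramE.
  by rewrite E in h2; exact: isd_unique h2 h1.
- by move=> a b c; exact: (Schwarz_row _ _ openT (smooth_D (basis R c) Xs) I).
Qed.

Definition hess u := bilin (partial2 u).

Theorem gauss_sectional u v w :
  form (gram u) (curvature gram u v w w) v =
  normal_dot u (hess u v v) (hess u w w) - normal_dot u (hess u v w) (hess u v w).
Proof.
apply: (gauss_form (Rm := fun l i j k => riemann gram l i j k u) (partial2C u)).
by move=> p i j k; exact: gauss_equation.
Qed.

Lemma normal_dotC u h h' : normal_dot u h h' = normal_dot u h' h.
Proof. exact: perp_dotC (inv_gramK u) _ _. Qed.

Lemma normal_dot_tangentr u h v : normal_dot u h ('D_v X u) = 0.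
Proof. by rewrite derive_jacobian; exact: perp_dot_tangentr (inv_gramK u) _ _. Qed.

End Gauss.

(** * Immersions inducing a warped product *)

Lemma derive_dot_eq (R : realType) (V : normedModType R) m (U : set V) (F G : V -> 'rV[R]_m)
    (c : V -> R) x v c' : open U -> smooth U F -> smooth U G ->
  (forall y, U y -> dot (F y) (G y) = c y) -> U x -> is_derive x v c c' ->
  dot ('D_v F x) (G x) + dot ('D_v G x) (F x) = c'.
Proof.
move=> Uo Fs Gs E Ux [_ cE].
have [_ h] := isd_dot (smooth_is_derive v Fs Ux) (smooth_is_derive v Gs Ux).
by rewrite -h -cE; exact: derive_ext Uo E Ux.
Qed.

Lemma sum_cst (R : realType) n (c : R) : \sum_(i < n) c = n%:R * c.
Proof. by rewrite sumr_const card_ord mulr_natl. Qed.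

Lemma sum_delta (R : realType) n (k : 'I_n) (c : R) : \sum_i (i == k)%:R * c = c.
Proof.
rewrite (bigD1 k)//= big1 => [|i /negPf ->]; first by rewrite eqxx mul1r addr0.
by rewrite mul0r.
Qed.

Section RoundCoefficients.
Variables (R : realType) (n' : nat).
Let n := n'.+1.
Implicit Types (q : 'rV[R]_(1 + n)).

Local Notation sp q i := (q 0 (rshift 1 i)).

(* The coefficients at q = (t, p) of the pullback of the unit round metric by
   p |-> p / |p|. *)
Definition round_coef q (i j : 'I_n) : R := (i == j)%:R / rad2 q - sp q i * sp q j / rad2 q ^+ 2.

(** |p|^2 times this matrix is the orthogonal projection onto the complement of p. The identity is a
    diagonal entry of its idempotence, and [round_coef_trace] is its rank. *)
Lemma round_coef_proj q i : off_axis q ->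
  rad2 q * \sum_j round_coef q i j ^+ 2 = round_coef q i i.
Proof.
rewrite /off_axis /= -rad2_gt0 => /gt_eqF/negbT r0.
have -> : \sum_j round_coef q i j ^+ 2 =
    \sum_j ((i == j)%:R * ((rad2 q)^-1 ^+ 2 - 2 * sp q i ^+ 2 / rad2 q ^+ 3))
    + \sum_j sp q i ^+ 2 / rad2 q ^+ 4 * sp q j ^+ 2.
  rewrite -big_split; apply: eq_bigr => j _ /=; rewrite /round_coef.
  by have [<-|ij] := eqVneq i j; rewrite ?eqxx ?(negPf ij) ?mulr1n ?mulr0n; field.
rewrite -mulr_suml -mulr_sumr -/(rad2 q) (bigD1 i)//= big1 => [|j /negPf ji]; last by rewrite eq_sym ji.
by rewrite /round_coef eqxx mulr1n; field.
Qed.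

Lemma round_coef_trace q : off_axis q -> \sum_i round_coef q i i = n'%:R / rad2 q.
Proof.
rewrite /off_axis /= -rad2_gt0 => /gt_eqF/negbT r0.
have -> : \sum_i round_coef q i i = \sum_(i < n) (rad2 q)^-1 - \sum_i sp q i ^+ 2 / rad2 q ^+ 2.
  by rewrite -sumrB; apply: eq_bigr => i _; rewrite /round_coef eqxx mulr1n; field.
rewrite sum_cst -mulr_suml -/(rad2 q) (_ : n%:R = n'%:R + 1 :> R); first by field.
by rewrite natr1.
Qed.

Definition round_coef_der q k i j : R :=
  - 2 * (i == j)%:R * sp q k / rad2 q ^+ 2
  - ((i == k)%:R * sp q j + sp q i * (j == k)%:R) / rad2 q ^+ 2
  + 4 * sp q i * sp q j * sp q k / rad2 q ^+ 3.

Lemma round_coef_is_derive q k i j : off_axis q ->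
  is_derive q (e_space R k) (fun q => round_coef q i j) (round_coef_der q k i j).
Proof.
rewrite /off_axis /= -rad2_gt0 => /gt_eqF/negbT r0.
have c l : is_derive q (e_space R k) (fun q : 'rV[R]_(1 + n) => sp q l) (l == k)%:R.
  apply: is_derive_eq (is_derive_coord q (e_space R k) 0 (rshift 1 l)) _.
  by rewrite row_mxEr mxE eqxx eq_sym.
have hr := rad2_is_derive q k.
have r2 : rad2 q ^+ 2 != 0 by rewrite expf_neq0.
have h := isdB (isdM (isdC q (e_space R k) (i == j)%:R) (isdV hr r0))
  (isdM (isdM (c i) (c j)) (isdV (isdX 1 hr) r2)).
by apply: is_derive_eq h _; rewrite /round_coef_der; field.
Qed.

Lemma round_coef_time_derive q i j : off_axis q ->
  is_derive q (e_time R n) (fun q => round_coef q i j) 0.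
Proof.
rewrite /off_axis /= -rad2_gt0 => /gt_eqF/negbT r0.
have c l : is_derive q (e_time R n) (fun q : 'rV[R]_(1 + n) => sp q l) 0.
  by apply: is_derive_eq (is_derive_coord q (e_time R n) 0 (rshift 1 l)) _; rewrite row_mxEr mxE.
have hr : is_derive q (e_time R n) (@rad2 R n') 0.
  have h := isd_sum (index_enum 'I_n) (P := xpredT) (fun j _ => isdX 1 (c j)).
  by apply: is_derive_eq h _; rewrite big1// => l _; rewrite mulr0.
have r2 : rad2 q ^+ 2 != 0 by rewrite expf_neq0.
have h := isdB (isdM (isdC q (e_time R n) (i == j)%:R) (isdV hr r0))
  (isdM (isdM (c i) (c j)) (isdV (isdX 1 hr) r2)).
by apply: is_derive_eq h _; field.
Qed.

(** This expresses that p |-> p / |p| is a harmonic map: the Euclidean Laplacian of the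
    parametrization has no component along the spheres, see [laplacian_tangent]. *)
Lemma round_coef_harmonic q k : off_axis q ->
  2 * \sum_i round_coef_der q i i k = \sum_i round_coef_der q k i i.
Proof.
rewrite /off_axis /= -rad2_gt0 => /gt_eqF/negbT r0.
have -> : \sum_i round_coef_der q i i k =
    \sum_i (i == k)%:R * (- 3 * sp q k / rad2 q ^+ 2) - \sum_(i < n) sp q k / rad2 q ^+ 2
    + \sum_i 4 * sp q k / rad2 q ^+ 3 * sp q i ^+ 2.
  rewrite -sumrB -big_split; apply: eq_bigr => i _ /=; rewrite /round_coef_der eqxx mulr1n (eq_sym k).
  by have [->|ik] := eqVneq i k; rewrite ?eqxx ?(negPf ik) ?mulr1n ?mulr0n; field.
have -> : \sum_i round_coef_der q k i i =
    \sum_i (i == k)%:R * (- 2 * sp q k / rad2 q ^+ 2) - \sum_(i < n) 2 * sp q k / rad2 q ^+ 2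
    + \sum_i 4 * sp q k / rad2 q ^+ 3 * sp q i ^+ 2.
  rewrite -sumrB -big_split; apply: eq_bigr => i _ /=; rewrite /round_coef_der eqxx mulr1n.
  by have [->|ik] := eqVneq i k; rewrite ?eqxx ?(negPf ik) ?mulr1n ?mulr0n; field.
by rewrite !sum_delta !sum_cst -!mulr_sumr -/(rad2 q); field.
Qed.

End RoundCoefficients.

(* The derivatives at one point of a map Y(t, p) inducing dt^2 + f^2 m, where m
   is the round metric; dm k i j stands for the derivative of m i j along p_k. *)
Section WarpedAlgebra.
Variables (R : realType) (n' M : nat).
Let n := n'.+1.
Variables (Yt Ytt : 'rV[R]_M) (Y1 Yt1 : 'I_n -> 'rV[R]_M) (Y2 : 'I_n -> 'I_n -> 'rV[R]_M).
Variables (f f1 f2 rho : R) (m : 'I_n -> 'I_n -> R) (dm : 'I_n -> 'I_n -> 'I_n -> R).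
Hypotheses (f0 : f != 0) (Y2C : forall i j, Y2 i j = Y2 j i).
Hypothesis Ytt_t : dot Ytt Yt = 0.
Hypothesis Yt1_t : forall i, dot (Yt1 i) Yt = 0.
Hypothesis Ytt_1 : forall i, dot Ytt (Y1 i) = 0.
Hypothesis Yt1_1 : forall i j, dot (Yt1 i) (Y1 j) = f * f1 * m i j.
Hypothesis Y2_t : forall i j, dot (Y2 i j) Yt = - (f * f1 * m i j).
Hypothesis Y2_1 : forall k i j, dot (Y2 k i) (Y1 j) + dot (Y2 k j) (Y1 i) = f ^+ 2 * dm k i j.
Hypothesis m_proj : forall i, rho * \sum_j m i j ^+ 2 = m i i.
Hypothesis m_trace : rho * \sum_i m i i = n'%:R.
Hypothesis m_harmonic : forall k, 2 * \sum_i dm i i k = \sum_i dm k i i.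
Hypothesis Ytt_ii : forall i, dot Ytt (Y2 i i) - dot (Yt1 i) (Yt1 i) = - ((f1 ^+ 2 + f * f2) * m i i).

Variable nd : 'rV[R]_M -> 'rV[R]_M -> R.
Hypothesis ndE : forall h h', nd h h' =
  dot h h' - dot h Yt * dot h' Yt - rho / f ^+ 2 * \sum_i dot h (Y1 i) * dot h' (Y1 i).

Lemma warped_radial_curvature i : nd Ytt (Y2 i i) - nd (Yt1 i) (Yt1 i) = - (f * f2 * m i i).
Proof.
rewrite !ndE Ytt_t Yt1_t !mul0r !subr0 big1 => [|j _]; last by rewrite Ytt_1 mul0r.
rewrite (eq_bigr (fun j => (f * f1) ^+ 2 * m i j ^+ 2)) => [|j _]; last by rewrite Yt1_1; ring.
have Ei := m_proj i; rewrite -mulr_sumr.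
have -> : rho / f ^+ 2 * ((f * f1) ^+ 2 * \sum_j m i j ^+ 2) =
  f1 ^+ 2 * (rho * \sum_j m i j ^+ 2) by field.
rewrite Ei; have := Ytt_ii i; lra.
Qed.

Lemma laplacian_tangent k : \sum_i dot (Y2 i i) (Y1 k) = 0.
Proof.
have E1 i : dot (Y2 i i) (Y1 k) = f ^+ 2 * dm i i k - f ^+ 2 * dm k i i / 2.
  by have := Y2_1 i i k; have := Y2_1 k i i; rewrite (Y2C i k); lra.
under eq_bigr do rewrite E1.
by rewrite sumrB -mulr_suml -!mulr_sumr -m_harmonic; field.
Qed.

(** The normal products are replaced by full ones. The removed components of [Y2 i i] along [Yt] add
    up to the friction term n' f f', and those along the [Y1 k] cancel by [laplacian_tangent]. *)
Lemma warped_laplacian lam Y : (forall h, nd Ytt h + rho / f ^+ 2 * \sum_i nd (Y2 i i) h + lam * dot Y h = 0) ->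
  forall h, f ^+ 2 * dot Ytt h + n'%:R * f * f1 * dot Yt h + rho * \sum_i dot (Y2 i i) h
    + lam * f ^+ 2 * dot Y h = 0.
Proof.
move=> H h; have := H h; rewrite ndE Ytt_t mul0r subr0 big1 => [|j _]; last by rewrite Ytt_1 mul0r.
have -> : \sum_i nd (Y2 i i) h = \sum_i dot (Y2 i i) h + f * f1 * dot Yt h * \sum_i m i i
    - rho / f ^+ 2 * \sum_k (\sum_i dot (Y2 i i) (Y1 k)) * dot h (Y1 k).
  under [X in _ - _ * X]eq_bigr do rewrite mulr_suml.
  rewrite [X in _ - _ * X]exchange_big [X in _ + X - _]mulr_sumr [X in _ - X]mulr_sumr.
  rewrite -big_split -sumrB; apply: eq_bigr => i _ /=.
  by rewrite ndE Y2_t (dotC h Yt) mulNr opprK mulrAC.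
rewrite (big1 _ _ (fun k => (\sum_i dot (Y2 i i) (Y1 k)) * dot h (Y1 k))) => [|k _]; last first.
  by rewrite laplacian_tangent mul0r.
rewrite !mulr0 !subr0 => E; apply: (mulfI (_ : f ^- 2 != 0)); first by rewrite invr_eq0 expf_neq0.
rewrite mulr0 -[RHS]E -m_trace; field.
by [].
Qed.

End WarpedAlgebra.

(** * A tight frame adapted to polar coordinates *)

Section TightFrame.
Variables (R : realType) (n M : nat) (J : 'M[R]_(n, M)).
Variables (xt : 'rV[R]_n) (x1 : 'I_n -> 'rV[R]_n) (p : 'rV[R]_n) (f rho s : R).

(** There are n + 1 vectors in dimension n, dependent through the radial relation. They treat all
    coordinates alike and avoid choosing an orthonormal basis tangent to the spheres t = const. *)
Definition tight_frame : 'M[R]_(1 + n, n) := col_mx xt (\matrix_i (s / f *: x1 i)).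

Lemma sum_tight_frame (F : 'rV[R]_n -> R) :
  \sum_a F (row a tight_frame) = F xt + \sum_i F (s / f *: x1 i).
Proof.
rewrite big_split_ord big_ord1; congr (_ + _); first by rewrite rowKu row_id.
by apply: eq_bigr => i _; rewrite rowKd rowK.
Qed.

Variables (Yt : 'rV[R]_M) (Y1 : 'I_n -> 'rV[R]_M).
Hypotheses (YtE : xt *m J = Yt) (Y1E : forall i, x1 i *m J = Y1 i).
Hypotheses (f0 : f != 0) (s0 : s != 0) (s2 : s ^+ 2 = rho) (rhoE : \sum_i p 0 i ^+ 2 = rho).
Hypotheses (Ytt : dot Yt Yt = 1) (Yt1 : forall i, dot Yt (Y1 i) = 0).
Hypothesis Y11 : forall i j,
  dot (Y1 i) (Y1 j) = f ^+ 2 * ((i == j)%:R / rho - p 0 i * p 0 j / rho ^+ 2).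
Hypothesis radial : \sum_i p 0 i *: x1 i = 0.

(* Adding the radial direction, in the kernel of the differential, completes
   the rows of the frame to an orthonormal basis. *)
Lemma tight_frameP : tight_frame^T *m tight_frame *m (J *m J^T) = 1%:M.
Proof.
set V := tight_frame; set G := J *m J^T.
pose w : 'rV[R]_(1 + n) := row_mx 0 (s^-1 *: p).
pose B : 'M[R]_(1 + n) := row_mx w^T V.
pose C : 'M[R]_(1 + n) := block_mx 1%:M 0 0 G.
have rho0 : rho != 0 by rewrite -s2 expf_neq0.
have wV : w *m V = 0.
  rewrite mul_row_col mul0mx add0r -scalemxAl mulmx_sum_row.
  rewrite (_ : \sum_i _ = (s / f) *: \sum_i p 0 i *: x1 i); first by rewrite radial !scaler0.
  by rewrite scaler_sumr; apply: eq_bigr => i _; rewrite rowK !scalerA mulrC.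
have ww : w *m w^T = 1%:M.
  rewrite tr_row_mx mul_row_col trmx0 mul0mx add0r linearZ /= -scalemxAl -scalemxAr scalerA.
  rewrite [p *m _]mx11_scalar -dotE /dot (eq_bigr (fun i => p 0 i ^+ 2)) => [|i _]; last by rewrite expr2.
  by rewrite rhoE -s2 scale_scalar_mx; congr _%:M; field.
have BT : B^T = col_mx w V^T by rewrite tr_row_mx trmxK.
(* The extended rows are orthonormal for the block metric. Moving B^T to the front turns this into a
   statement whose lower right block is the claim. *)
have BCB : B *m C *m B^T = 1%:M.
  have -> : B *m C *m B^T = w^T *m w + V *m J *m (V *m J)^T.
    rewrite BT mul_row_block mul_row_col !mulmx0 addr0 add0r mulmx1.
    by rewrite /G trmx_mul !mulmxA.
  pose S := \matrix_i (s / f *: Y1 i).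
  have SE y j : (y *m S^T) 0 j = s / f * dot y (Y1 j).
    by rewrite -dotZr mxE; apply: eq_bigr => k _; rewrite !mxE.
  have tS : Yt *m S^T = 0 by apply/rowP => j; rewrite SE Yt1 mulr0 mxE.
  have -> : V *m J = col_mx Yt S.
    rewrite mul_col_mx YtE; congr col_mx; apply/row_matrixP => i.
    by rewrite row_mul !rowK -Y1E scalemxAl.
  rewrite tr_col_mx mul_col_row tr_row_mx mul_col_row trmx0 !(mul0mx, mulmx0).
  rewrite add_block_mx !add0r [RHS]scalar_mx_block; congr block_mx.
  - by rewrite [LHS]mx11_scalar -dotE Ytt.
  - by rewrite tS.
  - by rewrite -[LHS]trmxK trmx_mul trmxK tS trmx0.
  - apply/matrixP => i j; rewrite [LHS]mxE (_ : (S *m S^T) i j = s / f * dot (s / f *: Y1 i) (Y1 j)).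
      by rewrite dotZl Y11 !mxE big_ord1 !mxE -s2; field; rewrite s0.
    by rewrite -SE -[s / f *: _](rowK (fun i => s / f *: Y1 i)) -row_mul [RHS]mxE.
have := mulmx1C BCB; rewrite mulmxA; have -> : B^T *m B = block_mx 1%:M 0 0 (V^T *m V).
  rewrite BT mul_col_row ww wV; congr block_mx.
  by rewrite -trmx_mul wV trmx0.
rewrite mulmx_block !(mul0mx, mulmx0, add0r, addr0) mulmx1 [RHS]scalar_mx_block.
by case/eq_block_mx.
Qed.

Hypothesis Gu : J *m J^T \in unitmx.

Lemma invmx_tight_frame : invmx (J *m J^T) = tight_frame^T *m tight_frame.
Proof. by rewrite -[RHS]mulmx1 -(mulmxV Gu) mulmxA tight_frameP mul1mx. Qed.

Lemma perp_dot_tight_frame h h' : perp_dot J (invmx (J *m J^T)) h h' =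
  dot h h' - dot h Yt * dot h' Yt - rho / f ^+ 2 * \sum_i dot h (Y1 i) * dot h' (Y1 i).
Proof.
rewrite invmx_tight_frame /perp_dot mulmxBr mulmx1 mulmxBl mxE [X in _ + X]mxE -dotE.
rewrite -addrA -opprD; congr (_ - _).
rewrite (_ : h *m _ *m _ = h *m (tight_frame *m J)^T *m (h' *m (tight_frame *m J)^T)^T); last first.
  by rewrite !trmx_mul !trmxK !mulmxA.
rewrite -dotE [LHS]/dot.
have E (g : 'rV[R]_M) a : (g *m (tight_frame *m J)^T) 0 a = dot g (row a tight_frame *m J).
  by rewrite -row_mul mxE; apply: eq_bigr => k _; rewrite !mxE.
under eq_bigr do rewrite !E.
rewrite (sum_tight_frame (fun z => dot h (z *m J) * dot h' (z *m J))) YtE; congr (_ + _).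
rewrite [RHS]mulr_sumr; apply: eq_bigr => i _; rewrite -scalemxAl Y1E !dotZr -s2; field.
by [].
Qed.

Lemma trace_tight_frame (B : 'I_n -> 'I_n -> 'rV[R]_M) h (A := invmx (J *m J^T)) :
  \sum_i \sum_j A i j * perp_dot J A (B i j) h =
  perp_dot J A (bilin B xt xt) h + rho / f ^+ 2 * \sum_i perp_dot J A (bilin B (x1 i) (x1 i)) h.
Proof.
pose Q z := perp_dot J A (bilin B z z) h.
have QE z : Q z = \sum_i \sum_j z 0 i * z 0 j * perp_dot J A (B i j) h.
  rewrite /Q perp_dot_suml; apply: eq_bigr => i _; rewrite perp_dot_suml.
  by apply: eq_bigr => j _; rewrite perp_dotZl.
have -> : rho / f ^+ 2 * \sum_i Q (x1 i) = \sum_i Q (s / f *: x1 i).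
  rewrite mulr_sumr; apply: eq_bigr => i _; rewrite !QE mulr_sumr; apply: eq_bigr => a _.
  by rewrite mulr_sumr; apply: eq_bigr => b _; rewrite !mxE -s2; field.
rewrite -[perp_dot _ _ (bilin B xt xt) _]/(Q xt) -sum_tight_frame.
under [RHS]eq_bigr do rewrite QE.
rewrite [RHS]exchange_big; apply: eq_bigr => i _ /=; rewrite [RHS]exchange_big /=.
apply: eq_bigr => j _; rewrite -mulr_suml; congr (_ * _).
by rewrite /A invmx_tight_frame mxE; apply: eq_bigr => a _; rewrite !mxE.
Qed.

(** The frame spans: as V^T V inverts the metric, D can be recovered from V D V^T. *)
Lemma tight_frame_form_eq0 (D : 'M[R]_n) : form D xt xt = 0 ->
  (forall i, form D xt (x1 i) = 0) -> (forall i, form D (x1 i) xt = 0) ->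
  (forall i j, form D (x1 i) (x1 j) = 0) -> D = 0.
Proof.
move=> Dtt Dt1 D1t D11; set V := tight_frame.
have VDV : V *m D *m V^T = 0.
  have Z c b v w : form D v w = 0 -> form D (c *: v) (b *: w) = 0.
    by rewrite !formE linearZ /= -!scalemxAl -scalemxAr !mxE => ->; rewrite !mulr0.
  apply/matrixP => a b; rewrite [RHS]mxE; transitivity (form D (row a V) (row b V)).
    by rewrite formE tr_row mxE [RHS]mxE; apply: eq_bigr => j _; rewrite -!row_mul [row _ _ _ _]mxE [col _ _ _ _]mxE.
  have rV c (P : 'rV[R]_n -> Prop) : P (1 *: xt) -> (forall i, P (s / f *: x1 i)) -> P (row c V).
    by rewrite scale1r; case: (split_ordP c) => d -> Pt P1; rewrite ?rowKu ?rowKd ?row_id ?rowK// ord1 row_id.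
  apply: (rV a (fun z => form D z (row b V) = 0)) => [|i].
    by apply: (rV b (fun z => form D _ z = 0)) => [|j]; exact: Z.
  by apply: (rV b (fun z => form D _ z = 0)) => [|j]; exact: Z.
have := congr1 (fun B => V^T *m B *m V) VDV; rewrite mulmx0 mul0mx.
rewrite !mulmxA -(mulmxA _ V^T) -invmx_tight_frame => E.
move: (J *m J^T) Gu E => G GU E; have := congr1 (fun B => G *m B *m G) E.
by rewrite !mulmxA mulmxV// mul1mx -(mulmxA D) mulVmx// mulmx1 mulmx0 mul0mx.
Qed.

End TightFrame.

(** * Composition with a possibly degenerate change of parameters *)

Section ChartChange.
Variables (R : realType) (n k M : nat) (X : 'rV[R]_n -> 'rV[R]_M).
Hypotheses (Xs : smooth setT X) (Gu : forall u, gram X u \in unitmx).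
Variables (W : set 'rV[R]_k) (tau : 'rV[R]_k -> 'rV[R]_n) (Y : 'rV[R]_k -> 'rV[R]_M).
Hypotheses (Wo : open W) (taus : smooth W tau) (YX : forall q, W q -> Y q = X (tau q)).

Lemma chart_smooth : smooth W Y.
Proof.
have h := smooth_comp Wo openT (fun _ _ => I) taus Xs.
by move=> K; apply: Ck_ext (h K) => // q Wq; rewrite YX.
Qed.

Lemma chart_derive v q : W q -> 'D_v Y q = 'D_('D_v tau q) X (tau q).
Proof.
move=> Wq; rewrite (derive_ext (g := fun q => X (tau q)) v Wo YX Wq).
by case: (chain_is_derive_row openT (Xs 1%N) I (smooth_is_derive v taus Wq)).
Qed.

Lemma chart_derive_jacobian v q : W q -> 'D_v Y q = 'D_v tau q *m jacobian X (tau q).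
Proof. by move=> Wq; rewrite chart_derive// derive_jacobian. Qed.

(** The second derivative of X o tau contains, besides the Hessian of X, a first derivative of X
    along ['D_w ('D_v tau)]. That term is tangent, so the normal product does not see it. *)
Lemma chart_derive2 v w q h : W q ->
  normal_dot X (tau q) ('D_w ('D_v Y) q) h =
  normal_dot X (tau q) (hess X (tau q) ('D_w tau q) ('D_v tau q)) h.
Proof.
move=> Wq; set u := tau q.
have taui z i x : W x -> is_derive x z (fun x => ('D_v tau x) 0 i) (('D_z ('D_v tau) x) 0 i).
  move=> Wx; exact: (is_derive_mxP _ _ _ _).1 (smooth_is_derive z (smooth_D v taus) Wx) 0 i.
have dX i : is_derive q w (fun x => 'D_(basis R i) X (tau x)) ('D_('D_w tau q) ('D_(basis R i) X) u).
  exact: (chain_is_derive_row openT (smooth_D (basis R i) Xs 1%N) I (smooth_is_derive w taus Wq)).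
pose F i x := ('D_v tau x) 0 i *: 'D_(basis R i) X (tau x).
have dF i : is_derive q w (F i) (('D_w ('D_v tau) q) 0 i *: 'D_(basis R i) X u +
    ('D_v tau q) 0 i *: 'D_('D_w tau q) ('D_(basis R i) X) u).
  exact: isdZ_row (taui w i q Wq) (dX i).
have dS : is_derive q w (fun x => \sum_i F i x) (\sum_i (('D_w ('D_v tau) q) 0 i *: 'D_(basis R i) X u +
    ('D_v tau q) 0 i *: 'D_('D_w tau q) ('D_(basis R i) X) u)).
  apply/is_derive_mxP => a b.
  have H := isd_sum (index_enum 'I_n) (P := xpredT) (fun i _ => (is_derive_mxP _ _ _ _).1 (dF i) a b).
  rewrite (_ : (fun y => _) = (fun y => \sum_i F i y a b)); last by apply/funext => y; rewrite summxE.
  by rewrite summxE.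
have E : 'D_w ('D_v Y) q = 'D_w (fun x => \sum_i F i x) q.
  apply: derive_ext Wo _ Wq => x Wx.
  by rewrite chart_derive// (derive_basis_row _ openT (Xs 1%N) I).
rewrite E; case: dS => _ ->; rewrite big_split /= -(derive_basis_row _ openT (Xs 1%N) I).
rewrite /normal_dot perp_dotDl [X in X + _](_ : _ = 0); last first.
  by rewrite -/(normal_dot X u _ h) normal_dotC// normal_dot_tangentr.
rewrite add0r /hess bilinC; last exact: partial2C.
congr perp_dot; apply: eq_bigr => i _.
rewrite (derive_basis_row _ openT (smooth_D (basis R i) Xs 1%N) I) scaler_sumr.
by apply: eq_bigr => j _; rewrite scalerA (partial2C Xs).
Qed.

Lemma chart_derive2_pair v w v' w' q : W q ->
  normal_dot X (tau q) ('D_w ('D_v Y) q) ('D_w' ('D_v' Y) q) =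
  normal_dot X (tau q) (hess X (tau q) ('D_w tau q) ('D_v tau q))
                       (hess X (tau q) ('D_w' tau q) ('D_v' tau q)).
Proof.
move=> Wq; set h := 'D_w' _ q; set g := hess X (tau q) ('D_w tau q) _.
apply: etrans (chart_derive2 v w h Wq) _; rewrite -/g.
exact: etrans (normal_dotC Gu _ g h) (etrans (chart_derive2 v' w' g Wq) (normal_dotC Gu _ _ g)).
Qed.

Lemma chart_sectional v w q : W q ->
  form (gram X (tau q)) (curvature (gram X) (tau q) ('D_v tau q) ('D_w tau q) ('D_w tau q)) ('D_v tau q) =
  normal_dot X (tau q) ('D_v ('D_v Y) q) ('D_w ('D_w Y) q)
  - normal_dot X (tau q) ('D_v ('D_w Y) q) ('D_v ('D_w Y) q).
Proof.
move=> Wq; apply: etrans (gauss_sectional Xs Gu (tau q) ('D_v tau q) ('D_w tau q)) _.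
exact: (esym (congr2 (fun a b => a - b) (chart_derive2_pair v v w w Wq) (chart_derive2_pair w v w v Wq))).
Qed.

End ChartChange.

Lemma half_eq0 (R : realType) (a : R) : a + a = 0 -> a = 0.
Proof. by move=> ?; lra. Qed.

Lemma warped_ti_j_alg (R : realType) (a b c x y m : R) :
  a + b = 2 * x ^+ 1 * y * m + x ^+ 2 * 0 -> a + c = 0 -> b + c = 0 -> a = x * y * m.
Proof. by move=> H1 H2 H3; lra. Qed.

Lemma warped_tt_ii_alg (R : realType) (a b c x y z m : R) :
  a + b = - ((y * y + x * z) * m + x * y * 0) -> a + c = 0 -> b - c = - ((y ^+ 2 + x * z) * m).
Proof. by move=> H1 H2; lra. Qed.

Lemma addr_eq0l (R : realType) (a b : R) : a + b = 0 -> b = 0 -> a = 0.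
Proof. by move=> + b0; rewrite b0 addr0. Qed.

(** * Differentiating the relations of the first fundamental form *)

Section WarpedIdentities.
Variables (R : realType) (V : normedModType R) (I : Type) (M : nat).
Variables (U : set V) (Y : V -> 'rV[R]_M) (et : V) (e : I -> V).
Variables (F F1 F2 : V -> R) (m : V -> I -> I -> R) (dm : V -> I -> I -> I -> R).
Hypotheses (Uo : open U) (Ys : smooth U Y).
Hypothesis Ft : forall q, is_derive q et F (F1 q).
Hypothesis F1t : forall q, is_derive q et F1 (F2 q).
Hypothesis Fe : forall q i, is_derive q (e i) F 0.
Hypothesis mt : forall q i j, U q -> is_derive q et (fun q => m q i j) 0.
Hypothesis me : forall q k i j, U q -> is_derive q (e k) (fun q => m q i j) (dm q k i j).
Hypothesis Ytt1 : forall q, U q -> dot ('D_et Y q) ('D_et Y q) = 1.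
Hypothesis Yti0 : forall q i, U q -> dot ('D_et Y q) ('D_(e i) Y q) = 0.
Hypothesis Yij : forall q i j, U q -> dot ('D_(e i) Y q) ('D_(e j) Y q) = F q ^+ 2 * m q i j.

Let swap v w q : U q -> 'D_w ('D_v Y) q = 'D_v ('D_w Y) q.
Proof. by move=> Uq; exact: Schwarz_row Uo Ys Uq. Qed.

Lemma warped_tt_t q : U q -> dot ('D_et ('D_et Y) q) ('D_et Y q) = 0.
Proof.
move=> Uq; apply: half_eq0.
exact: derive_dot_eq Uo (smooth_D et Ys) (smooth_D et Ys) Ytt1 Uq (isdC q et 1).
Qed.

Lemma warped_ti_t q i : U q -> dot ('D_et ('D_(e i) Y) q) ('D_et Y q) = 0.
Proof.
move=> Uq; apply: half_eq0.
rewrite (swap (e i) et Uq).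
exact: derive_dot_eq Uo (smooth_D et Ys) (smooth_D et Ys) Ytt1 Uq (isdC q (e i) 1).
Qed.

Lemma warped_tt_i q i : U q -> dot ('D_et ('D_et Y) q) ('D_(e i) Y q) = 0.
Proof.
move=> Uq; have h := derive_dot_eq Uo (smooth_D et Ys) (smooth_D (e i) Ys)
  (fun q => @Yti0 q i) Uq (isdC q et 0).
exact: addr_eq0l h (warped_ti_t i Uq).
Qed.

Lemma warped_ti_j_sum q i j : U q ->
  dot ('D_et ('D_(e i) Y) q) ('D_(e j) Y q) + dot ('D_(e i) ('D_(e j) Y) q) ('D_et Y q) = 0.
Proof.
move=> Uq; rewrite (swap (e i) et Uq).
exact: derive_dot_eq Uo (smooth_D et Ys) (smooth_D (e j) Ys) (fun q => @Yti0 q j) Uq (isdC q (e i) 0).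
Qed.

Lemma warped_ti_j q i j : U q ->
  dot ('D_et ('D_(e i) Y) q) ('D_(e j) Y q) = F q * F1 q * m q i j.
Proof.
move=> Uq; have hc := isdM (isdX 1 (Ft q)) (mt i j Uq).
have h := derive_dot_eq Uo (smooth_D (e i) Ys) (smooth_D (e j) Ys) (fun q => @Yij q i j) Uq hc.
have a1 := warped_ti_j_sum i j Uq; have a2 := warped_ti_j_sum j i Uq.
rewrite (swap (e i) (e j) Uq) in a2.
exact: warped_ti_j_alg h a1 a2.
Qed.

Lemma warped_ij_t q i j : U q ->
  dot ('D_(e i) ('D_(e j) Y) q) ('D_et Y q) = - (F q * F1 q * m q i j).
Proof.
move=> Uq; rewrite -(warped_ti_j i j Uq); apply/eqP; rewrite -addr_eq0 addrC; apply/eqP.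
exact: warped_ti_j_sum.
Qed.

Lemma warped_ki_j q k i j : U q -> dot ('D_(e k) ('D_(e i) Y) q) ('D_(e j) Y q) +
  dot ('D_(e k) ('D_(e j) Y) q) ('D_(e i) Y q) = F q ^+ 2 * dm q k i j.
Proof.
move=> Uq; have hc := isdM (isdX 1 (Fe q k)) (me k i j Uq).
have h := derive_dot_eq Uo (smooth_D (e i) Ys) (smooth_D (e j) Ys) (fun q => @Yij q i j) Uq hc.
by apply: etrans h _; rewrite mulr0 mul0r add0r.
Qed.

(** [warped_ij_t] is differentiated along t and [warped_ti_t] along e_i; in the difference the third
    derivatives of Y cancel. *)
Lemma warped_tt_ii q i : U q -> dot ('D_et ('D_et Y) q) ('D_(e i) ('D_(e i) Y) q) -
  dot ('D_et ('D_(e i) Y) q) ('D_et ('D_(e i) Y) q) =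
  - ((F1 q ^+ 2 + F q * F2 q) * m q i i).
Proof.
move=> Uq.
have hc := isdN (isdM (isdM (Ft q) (F1t q)) (mt i i Uq)).
have h1 := derive_dot_eq Uo (smooth_D (e i) (smooth_D (e i) Ys)) (smooth_D et Ys)
  (fun q => @warped_ij_t q i i) Uq hc.
have h2 := derive_dot_eq Uo (smooth_D et (smooth_D (e i) Ys)) (smooth_D et Ys)
  (fun q => @warped_ti_t q i) Uq (isdC q (e i) 0).
rewrite (Schwarz_row (e i) et Uo (smooth_D (e i) Ys) Uq) in h1; rewrite (swap et (e i) Uq) in h2.
exact: warped_tt_ii_alg h1 h2.
Qed.

End WarpedIdentities.

(** * Curvature and Laplacian of a warped product chart *)

Section WarpedChart.
Variables (R : realType) (n' M : nat).
Let n := n'.+1.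
Variables (X : 'rV[R]_n -> 'rV[R]_M).
Hypotheses (Xs : smooth setT X) (Gu : forall u, gram X u \in unitmx).
Variables (W : set 'rV[R]_(1 + n)) (tau : 'rV[R]_(1 + n) -> 'rV[R]_n) (Y : 'rV[R]_(1 + n) -> 'rV[R]_M).
Hypotheses (Wo : open W) (taus : smooth W tau) (YX : forall q, W q -> Y q = X (tau q)).
Variables (f f1 f2 : R -> R).
Hypotheses (fd : forall t : R, is_derive t (1 : R) f (f1 t)) (f1d : forall t : R, is_derive t (1 : R) f1 (f2 t)).

Local Notation et := (e_time R n).
Local Notation e i := (@e_space R n' i).
Definition time (q : 'rV[R]_(1 + n)) : R := q 0 (lshift n (0 : 'I_1)).

Hypothesis W_off : forall q, W q -> off_axis q.
Hypothesis f0 : forall q : 'rV[R]_(1 + n), W q -> f (time q) != 0.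
Hypothesis Ytt1 : forall q, W q -> dot ('D_et Y q) ('D_et Y q) = 1.
Hypothesis Yti0 : forall q i, W q -> dot ('D_et Y q) ('D_(e i) Y q) = 0.
Hypothesis Yij : forall q i j, W q ->
  dot ('D_(e i) Y q) ('D_(e j) Y q) = f (time q) ^+ 2 * round_coef q i j.
Hypothesis tau_radial : forall q, W q -> 'D_(row_mx 0 (rsubmx q)) tau q = 0.

Let Ys : smooth W Y := chart_smooth Xs Wo taus YX.

Let time_et (g g1 : R -> R) (q : 'rV[R]_(1 + n)) : (forall t : R, is_derive t (1 : R) g (g1 t)) ->
  is_derive q et (fun q : 'rV[R]_(1 + n) => g (time q)) (g1 (time q)).
Proof.
move=> gd; have h := is_derive_comp1 (is_derive_coord q et 0 (lshift n (0 : 'I_1))) (gd (time q)).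
by apply: is_derive_eq h _; rewrite row_mxEl mxE mulr1n mulr1.
Qed.

Let time_e (g g1 : R -> R) (q : 'rV[R]_(1 + n)) i : (forall t : R, is_derive t (1 : R) g (g1 t)) ->
  is_derive q (e i) (fun q : 'rV[R]_(1 + n) => g (time q)) 0.
Proof.
move=> gd; have h := is_derive_comp1 (is_derive_coord q (e i) 0 (lshift n (0 : 'I_1))) (gd (time q)).
by apply: is_derive_eq h _; rewrite row_mxEl mxE mulr0.
Qed.

Let Ft q := time_et q fd.
Let F1t q := time_et q f1d.
Let Fe q i := time_e q i fd.
Let mt q i j (Wq : W q) := round_coef_time_derive i j (W_off Wq).
Let me q k i j (Wq : W q) := round_coef_is_derive k i j (W_off Wq).

Let tt_t := @warped_tt_t R _ M W Y et Wo Ys Ytt1.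
Let ti_t := @warped_ti_t R _ 'I_n M W Y et (@e_space R n') Wo Ys Ytt1.
Let tt_i := @warped_tt_i R _ 'I_n M W Y et (@e_space R n') Wo Ys Ytt1 Yti0.
Let ti_j := @warped_ti_j R _ 'I_n M W Y et (@e_space R n') _ _ _ Wo Ys Ft mt Yti0 Yij.
Let tt_ii := @warped_tt_ii R _ 'I_n M W Y et (@e_space R n') _ _ _ _ Wo Ys Ft F1t mt Ytt1 Yti0 Yij.
Let ij_t := @warped_ij_t R _ 'I_n M W Y et (@e_space R n') _ _ _ Wo Ys Ft mt Yti0 Yij.
Let ki_j := @warped_ki_j R _ 'I_n M W Y (@e_space R n') _ _ _ Wo Ys Fe me Yij.

Section Point.
Variables (q : 'rV[R]_(1 + n)) (Wq : W q).
Let rho := rad2 q.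
Let s := Num.sqrt rho.

Let rho0 : 0 < rho. Proof. by rewrite rad2_gt0; exact: W_off. Qed.
Let s0 : s != 0. Proof. by rewrite gt_eqF// sqrtr_gt0. Qed.
Let s2 : s ^+ 2 = rho. Proof. by rewrite sqr_sqrtr// ltW. Qed.
Let rhoE : \sum_i (rsubmx q) 0 i ^+ 2 = rho.
Proof. by apply: eq_bigr => i _; rewrite mxE. Qed.

Local Notation J := (jacobian X (tau q)).
Local Notation xt := ('D_et tau q).
Local Notation x1 := (fun i => 'D_(e i) tau q).

Let Jxt : xt *m J = 'D_et Y q.
Proof. by rewrite (chart_derive_jacobian Xs Wo taus YX). Qed.

Let Jx1 i : x1 i *m J = 'D_(e i) Y q.
Proof. by rewrite (chart_derive_jacobian Xs Wo taus YX). Qed.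

Let radial : \sum_i (rsubmx q) 0 i *: x1 i = 0.
Proof.
have E0 : (row_mx 0 (rsubmx q) : 'rV[R]_(1 + n)) 0 (lshift n ord0) = 0 by rewrite row_mxEl mxE.
rewrite -[RHS](tau_radial Wq) (derive_basis_row _ Wo (taus 1%N) Wq) big_split_ord /= big_ord1.
rewrite E0 scale0r add0r.
by apply: eq_bigr => i _; rewrite row_mxEr e_spaceE.
Qed.

Let Y11 i j : dot ('D_(e i) Y q) ('D_(e j) Y q) =
  f (time q) ^+ 2 * ((i == j)%:R / rho - (rsubmx q) 0 i * (rsubmx q) 0 j / rho ^+ 2).
Proof. by rewrite Yij// /round_coef !mxE. Qed.

Local Notation V := (tight_frame xt x1 (f (time q)) s).

Lemma warped_normal_dot h h' : normal_dot X (tau q) h h' =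
  dot h h' - dot h ('D_et Y q) * dot h' ('D_et Y q)
  - rho / f (time q) ^+ 2 * \sum_i dot h ('D_(e i) Y q) * dot h' ('D_(e i) Y q).
Proof.
exact: (perp_dot_tight_frame Jxt Jx1 (f0 Wq) s0 s2 rhoE (Ytt1 Wq) (fun i => Yti0 i Wq) Y11 radial (Gu _)).
Qed.

Let radial_curvature i :
  normal_dot X (tau q) ('D_et ('D_et Y) q) ('D_(e i) ('D_(e i) Y) q) -
  normal_dot X (tau q) ('D_et ('D_(e i) Y) q) ('D_et ('D_(e i) Y) q) =
  - (f (time q) * f2 (time q) * round_coef q i i).
Proof.
apply: (@warped_radial_curvature R n' M ('D_et Y q) ('D_et ('D_et Y) q) (fun i => 'D_(e i) Y q)
  (fun i => 'D_et ('D_(e i) Y) q) (fun i j => 'D_(e i) ('D_(e j) Y) q) (f (time q)) (f1 (time q))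
  (f2 (time q)) rho (round_coef q) (f0 Wq) _ _ _ _ _ _ (normal_dot X (tau q)) warped_normal_dot i).
- exact: tt_t Wq.
- move=> j; exact: ti_t j Wq.
- move=> j; exact: tt_i j Wq.
- move=> j k; exact: ti_j j k Wq.
- move=> j; exact: (round_coef_proj j (W_off Wq)).
- move=> j; exact: tt_ii j Wq.
Qed.

Lemma warped_sectional i :
  form (gram X (tau q)) (curvature (gram X) (tau q) xt (x1 i) (x1 i)) xt =
  - (f (time q) * f2 (time q) * round_coef q i i).
Proof.
exact: etrans (chart_sectional Xs Gu Wo taus YX et (e i) Wq) (radial_curvature i).
Qed.

(** In the sum over the frame [xt] contributes nothing, and the trace n' / rho of the round
    coefficients turns the space vectors into n' copies of - f'' / f. *)
Lemma warped_ric : ric (gram X) (tau q) xt xt = - (n'%:R * f2 (time q) / f (time q)).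
Proof.
have K0 : form (gram X (tau q)) (curvature (gram X) (tau q) xt xt xt) xt = 0.
  exact: etrans (chart_sectional Xs Gu Wo taus YX et et Wq) (subrr _).
have Ki i : form (gram X (tau q)) (curvature (gram X) (tau q) (x1 i) xt xt) (x1 i) =
    - (f (time q) * f2 (time q) * round_coef q i i).
  apply: etrans (chart_sectional Xs Gu Wo taus YX (e i) et Wq) _.
  have S := congr1 (fun z => normal_dot X (tau q) z z) (Schwarz_row et (e i) Wo Ys Wq).
  have N := normal_dotC Gu (tau q) ('D_(e i) ('D_(e i) Y) q) ('D_et ('D_et Y) q).
  exact: etrans (congr2 (fun a b => a - b) N S) (radial_curvature i).
rewrite (ric_frame (tight_frameP Jxt Jx1 (f0 Wq) s0 s2 rhoE (Ytt1 Wq) (fun i => Yti0 i Wq) Y11 radial)).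
rewrite (sum_tight_frame _ _ _ _ (fun z => form _ (curvature _ _ z xt xt) z)) K0 add0r.
under eq_bigr do rewrite curvatureZl formZZ Ki.
rewrite -mulr_sumr sumrN -mulr_sumr round_coef_trace ?expr_div_n ?s2; last exact: W_off.
by rewrite -/rho; field; rewrite f0//= gt_eqF.
Qed.

Lemma warped_pde : (forall u h, \sum_i \sum_j invmx (gram X u) i j * normal_dot X u (partial2 X u i j) h
    + n%:R * dot (X u) h = 0) ->
  forall h, f (time q) ^+ 2 * dot ('D_et ('D_et Y) q) h
    + n'%:R * f (time q) * f1 (time q) * dot ('D_et Y q) h
    + rho * \sum_i dot ('D_(e i) ('D_(e i) Y) q) h + n%:R * f (time q) ^+ 2 * dot (Y q) h = 0.
Proof.
move=> minX h.
apply: (@warped_laplacian R n' M ('D_et Y q) ('D_et ('D_et Y) q) (fun i => 'D_(e i) Y q)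
  (fun i j => 'D_(e i) ('D_(e j) Y) q) (f (time q)) (f1 (time q)) rho (round_coef q)
  (round_coef_der q) (f0 Wq) _ _ _ _ _ _ _ (normal_dot X (tau q)) warped_normal_dot n%:R (Y q)).
- move=> i j; exact: (Schwarz_row (e j) (e i) Wo Ys Wq).
- exact: tt_t Wq.
- move=> j; exact: tt_i j Wq.
- move=> i j; exact: ij_t i j Wq.
- move=> k i j; exact: ki_j k i j Wq.
- by rewrite round_coef_trace; [rewrite mulrCA mulfV ?mulr1// gt_eqF|exact: W_off].
- move=> k; exact: (round_coef_harmonic k (W_off Wq)).
move=> {}h; have := minX (tau q) h.
rewrite (trace_tight_frame Jxt Jx1 (f0 Wq) s0 s2 rhoE (Ytt1 Wq) (fun i => Yti0 i Wq) Y11 radial (Gu _)).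
rewrite YX// => E; apply: etrans _ E; congr (_ + _ * _ + _).
  exact: (chart_derive2 Xs Gu Wo taus YX et et h Wq).
apply: eq_bigr => i _; exact: (chart_derive2 Xs Gu Wo taus YX (e i) (e i) h Wq).
Qed.

Lemma warped_form_eq0 (D : 'M[R]_n) : form D xt xt = 0 ->
  (forall i, form D xt (x1 i) = 0) -> (forall i, form D (x1 i) xt = 0) ->
  (forall i j, form D (x1 i) (x1 j) = 0) -> D = 0.
Proof.
exact: (tight_frame_form_eq0 Jxt Jx1 (f0 Wq) s0 s2 rhoE (Ytt1 Wq) (fun i => Yti0 i Wq) Y11 radial (Gu _)).
Qed.

End Point.
End WarpedChart.

(** * Charts and polar coordinates on the sphere *)

Section Smooth1.
Variable R : realType.

Lemma Ck_derive1 k (U : set R) (g g1 : R -> R) : open U ->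
  (forall x, U x -> is_derive x (1 : R) g (g1 x)) -> Ck k U g1 -> Ck k.+1 U g.
Proof.
move=> Uo gd g1k; apply: (@CkSP R (R : normedModType R) (R : normedModType R) k U g (fun v x => g1 x * v)) => //.
- by move=> x /gd; exact: is_derive_cont.
- by move=> v x /gd h; exact: is_derive_comp1 (is_derive_id x v) h.
- by move=> v; apply: CkM => //; exact: Ck_cst.
Qed.

Lemma sin_cos_Ck k : Ck k setT (@sin R) /\ Ck k setT (@cos R).
Proof.
have oT : open (setT : set R) by exact: openT.
elim: k => [|k [IHs IHc]].
  by split; split=> // x _; [exact: continuous_sin|exact: continuous_cos].
split; first exact: (Ck_derive1 oT (fun x _ => is_derive_sin x) IHc).
exact: (Ck_derive1 oT (fun x _ => is_derive_cos x) (CkN oT IHs)).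
Qed.

Lemma sqrt_Ck k : Ck k [set x : R | 0 < x] (@Num.sqrt R).
Proof.
have oP : open [set x : R | 0 < x] by exact: open_gt.
elim: k => [|k IH].
  by split=> // x _; exact: sqrt_continuous.
apply: (Ck_derive1 oP (fun x x0 => is_derive1_sqrt x0)).
apply: CkV => //; first by move=> x x0; rewrite mulf_neq0// gt_eqF// sqrtr_gt0.
by apply: CkM => //; exact: Ck_cst.
Qed.

End Smooth1.

(** * The radial projection onto the sphere *)

Section Normalize.
Variables (R : realType) (k : nat).
Implicit Types (p v w : 'rV[R]_k).

Lemma open_neq0 : open [set p : 'rV[R]_k | p != 0].
Proof.
have c : continuous (fun p : 'rV[R]_k => dot p p).
  move=> p; have s : smooth setT (fun p : 'rV[R]_k => p) by move=> K; exact: Ck_id.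
  exact: Ck_cont (smooth_dot openT s s 0%N) I.
rewrite (_ : [set p | _] = (fun p => dot p p) @^-1` [set x : R | 0 < x]).
  by apply: open_comp => [p _|]; [exact: c|exact: open_gt].
by apply/seteqP; split=> p /=; rewrite dot_gt0.
Qed.

Lemma normalize_smooth : smooth [set p : 'rV[R]_k | p != 0] (@normalize R k).
Proof.
have ids : smooth [set p : 'rV[R]_k | p != 0] (fun p => p) by move=> K; exact: Ck_id.
apply: (smooth_scale open_neq0 _ ids) => K; apply: CkV; first exact: open_neq0.
  by move=> p /= p0; rewrite gt_eqF// sqrtr_gt0 dot_gt0.
apply: (Ck_comp1 (U' := [set x : R | 0 < x])); first exact: open_neq0.
- by move=> p /= p0; rewrite dot_gt0.
- exact: (smooth_dot open_neq0 ids ids).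
- exact: sqrt_Ck.
Qed.

Lemma dot_normalize p : p != 0 -> dot (normalize p) (normalize p) = 1.
Proof.
move=> p0; have d0 : 0 < dot p p by rewrite dot_gt0.
rewrite dotZl dotZr mulrA -invfM -expr2 sqr_sqrtr ?ltW// mulVf// gt_eqF//.
Qed.

Lemma normalize_id p : dot p p = 1 -> normalize p = p.
Proof. by rewrite /normalize => ->; rewrite sqrtr1 invr1 scale1r. Qed.

Lemma normalizeK p : p != 0 -> normalize (normalize p) = normalize p.
Proof. by move=> p0; rewrite normalize_id// dot_normalize. Qed.

Lemma unit_neq0 p : dot p p = 1 -> p != 0.
Proof. by move=> p1; rewrite -dot_eq0 p1 oner_neq0. Qed.

Lemma derive_normalize p v : p != 0 -> is_derive p v (@normalize R k)
  ((Num.sqrt (dot p p))^-1 *: (v - (dot v p / dot p p) *: p)).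
Proof.
move=> p0; have d0 : 0 < dot p p by rewrite dot_gt0.
have s0 : 0 < Num.sqrt (dot p p) by rewrite sqrtr_gt0.
have hd := isd_dot (is_derive_id p v) (is_derive_id p v).
have hs := is_derive_comp1 hd (is_derive1_sqrt d0).
have h := isdZ_row (isdV hs (lt0r_neq0 s0)) (is_derive_id p v).
apply: is_derive_eq h _; rewrite scalerBr addrC scalerA; congr (_ + _).
rewrite -scaleNr; congr (_ *: _).
move: s0 (sqr_sqrtr (ltW d0)); move: (Num.sqrt (dot p p)) => s s0 <-.
by field; rewrite lt0r_neq0.
Qed.

Lemma derive_normalize_radial p : p != 0 -> 'D_p (@normalize R k) p = 0.
Proof.
move=> p0; have [_ ->] := derive_normalize p p0.
by rewrite mulfV ?dot_eq0// scale1r subrr scaler0.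
Qed.

Lemma dot_derive_normalize p v w : p != 0 ->
  dot ('D_v (@normalize R k) p) ('D_w (@normalize R k) p) =
  dot v w / dot p p - dot v p * dot w p / dot p p ^+ 2.
Proof.
move=> p0; have d0 : 0 < dot p p by rewrite dot_gt0.
have [_ ->] := derive_normalize v p0; have [_ ->] := derive_normalize w p0.
rewrite dotZl dotZr mulrA -invfM -expr2 sqr_sqrtr ?ltW//.
rewrite dotBl !dotBr !dotZl !dotZr (dotC p w); field; exact: lt0r_neq0.
Qed.

Lemma dot_normalize_derive p v : p != 0 -> dot (normalize p) ('D_v (@normalize R k) p) = 0.
Proof.
move=> p0; have d0 : 0 < dot p p by rewrite dot_gt0.
have [_ ->] := derive_normalize v p0.
by rewrite dotZl dotZr dotBr dotZr (dotC p v) divfK ?lt0r_neq0// subrr !mulr0.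
Qed.

End Normalize.

Section RowMx.
Variables (R : realType) (n : nat).

Lemma dot_row_mx (a b : R) (u v : 'rV[R]_n) :
  dot (row_mx a%:M u : 'rV[R]_(1 + n)) (row_mx b%:M v) = a * b + dot u v.
Proof.
rewrite /dot big_split_ord big_ord1 !row_mxEl !mxE !mulr1n; congr (_ + _).
by apply: eq_bigr => i _; rewrite !row_mxEr.
Qed.

Lemma row_mx_split (z : 'rV[R]_(1 + n)) : z = row_mx (z 0 (lshift n 0))%:M (rsubmx z).
Proof.
rewrite -[LHS]hsubmxK; congr row_mx; apply/rowP => j.
by rewrite ord1 !mxE.
Qed.

Lemma smooth_row_mx (V : normedModType R) (U : set V) (f : V -> R) (g : V -> 'rV[R]_n) :
  open U -> smooth U f -> smooth U g ->
  smooth U (fun x => row_mx (f x)%:M (g x) : 'rV[R]_(1 + n)).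
Proof.
move=> Uo fs gs; apply/smooth_mxP => // i j.
case: (split_ordP j) => k ->.
  rewrite (_ : (fun x => _) = f)//; apply/funext => x.
  by rewrite row_mxEl mxE !ord1 mulr1n.
rewrite (_ : (fun x => _) = (fun x => g x i k)); first exact: (smooth_mxP g Uo).1.
by apply/funext => x; rewrite row_mxEr.
Qed.

Lemma smooth_rsubmx (V : normedModType R) (U : set V) (g : V -> 'rV[R]_(1 + n)) :
  open U -> smooth U g -> smooth U (fun x => rsubmx (g x)).
Proof.
move=> Uo gs; apply/smooth_mxP => // i j.
rewrite (_ : (fun x => _) = (fun x => g x i (rshift 1 j))); first exact: (smooth_mxP g Uo).1.
by apply/funext => x; rewrite mxE.
Qed.

End RowMx.

(** * Stereographic charts and their inverses *)

Section Stereographic.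
Variables (R : realType) (n : nat) (eps : bool).
Implicit Types (u v : 'rV[R]_n) (z : 'rV[R]_(1 + n)).

Let sg : R := (-1) ^+ eps.
Let sgsg (a : R) : sg * (sg * a) = a.
Proof. by rewrite /sg mulrA -expr2 sqrr_sign mul1r. Qed.

Let den_gt0 u : 0 < dot u u + 1. Proof. by rewrite ltr_pwDr// dot_ge0. Qed.

Lemma dot_stereo u : dot (stereo eps u) (stereo eps u) = 1.
Proof.
have d0 := lt0r_neq0 (den_gt0 u).
rewrite /stereo dotZl dotZr dot_row_mx dotZl dotZr -/sg.
rewrite (_ : sg * _ * _ = (dot u u - 1) * (dot u u - 1)); last first.
  by rewrite -[X in X * _ = _]mulrC -mulrA sgsg.
by field.
Qed.

Let id_smooth : smooth setT (fun u => u). Proof. by move=> K; exact: Ck_id. Qed.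

Let den_smooth : smooth setT (fun u => (dot u u + 1)^-1).
Proof.
move=> K; apply: (CkV openT) => [u _|]; first exact: lt0r_neq0 (den_gt0 u).
by apply: (CkD openT); [exact: (smooth_dot openT)|exact: Ck_cst].
Qed.

Lemma stereo_smooth : smooth setT (@stereo R n eps).
Proof.
apply: (smooth_scale openT den_smooth); apply: (smooth_row_mx openT).
  move=> K; apply: (CkM openT); first exact: Ck_cst.
  by apply: (CkB openT); [exact: (smooth_dot openT)|exact: Ck_cst].
by apply: (smooth_scale openT) => // K; exact: Ck_cst.
Qed.

Lemma stereo_coord0 u : (stereo eps u : 'rV[R]_(1 + n)) 0 (lshift n 0) = sg * (1 - 2 * (dot u u + 1)^-1).
Proof.
have d0 := lt0r_neq0 (den_gt0 u).
rewrite [LHS]mxE row_mxEl [_%:M _ _]mxE mulr1n -/sg; field; exact: d0.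
Qed.

(** The formula is kept on an open set of R^(1+n), not only on the sphere, so that the ordinary
    chain rule applies to it. *)
Definition stereo_inv (z : 'rV[R]_(1 + n)) : 'rV[R]_n := (1 - sg * z 0 (lshift n 0))^-1 *: rsubmx z.

Definition stereo_dom : set 'rV[R]_(1 + n) := [set z | sg * z 0 (lshift n 0) != 1].

Lemma stereo_dom_open : open stereo_dom.
Proof.
apply: (open_comp (f := fun z : 'rV[R]_(1 + n) => sg * z 0 (lshift n 0)) (D := [set x : R | x != 1])).
  move=> z _; have h : Ck 0 setT (fun z : 'rV[R]_(1 + n) => sg * z 0 (lshift n 0)).
    by apply: (CkM openT); [exact: Ck_cst|exact: (Ck_coord _ _ _ openT)].
  exact: Ck_cont h I.
exact: open_neq.
Qed.

Lemma stereo_inv_smooth : smooth stereo_dom stereo_inv.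
Proof.
have oD := stereo_dom_open.
have ids : smooth stereo_dom (fun z => z) by move=> K; exact: Ck_id.
apply: (smooth_scale oD); last exact: (smooth_rsubmx oD).
move=> K; apply: (CkV oD) => [z|].
  by rewrite /stereo_dom /= => z1; rewrite subr_eq0 eq_sym.
apply: (CkB oD); first exact: Ck_cst.
by apply: (CkM oD); [exact: Ck_cst|exact: (Ck_coord _ _ _ oD)].
Qed.

Lemma stereo_in_dom u : stereo_dom (stereo eps u).
Proof.
rewrite /stereo_dom /= stereo_coord0 sgsg -subr_eq0 addrAC subrr add0r oppr_eq0.
by rewrite mulf_neq0 ?invr_eq0 ?lt0r_neq0.
Qed.

Lemma stereoK u : stereo_inv (stereo eps u) = u.
Proof.
rewrite /stereo_inv stereo_coord0 sgsg.
have -> : rsubmx (stereo eps u : 'rV[R]_(1 + n)) = (2 * (dot u u + 1)^-1) *: u.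
  by apply/rowP => j; rewrite [LHS]mxE [LHS]mxE row_mxEr !mxE; ring.
rewrite scalerA (_ : _ * _ = 1) ?scale1r//; have d0 := lt0r_neq0 (den_gt0 u); field.
by rewrite d0 opprB addrC subrK pnatr_eq0.
Qed.

Lemma stereo_invK z : dot z z = 1 -> stereo_dom z -> stereo eps (stereo_inv z) = z.
Proof.
rewrite /stereo_dom /= [z in dot z]row_mx_split [z in dot _ z]row_mx_split dot_row_mx.
set a := z 0 _; set r := rsubmx z => E z1.
have b1 : 1 - sg * a != 0 by rewrite subr_eq0 eq_sym.
have b2 : sg * a + 1 - (sg * a) * (sg * a + 1) = dot r r.
  have sq : sg * a * (sg * a) = a * a by rewrite mulrACA -expr2 sqrr_sign mul1r.
  by rewrite mulrDr mulr1 sq; lra.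
have dE : dot (stereo_inv z) (stereo_inv z) = (1 + sg * a) / (1 - sg * a).
  rewrite /stereo_inv dotZl dotZr -/r -b2 -/a; by field.
have d2 : dot (stereo_inv z) (stereo_inv z) + 1 = 2 / (1 - sg * a) by rewrite dE; field.
rewrite [RHS]row_mx_split /stereo d2 scale_row_mx -/a -/sg dE.
apply: (congr2 (@row_mx R 1 1 n)).
  rewrite scale_scalar_mx; congr (_%:M); rewrite -[RHS]sgsg; field.
  by rewrite b1.
rewrite /stereo_inv -/r -/a !scalerA (_ : _ * _ = 1) ?scale1r//; field.
by rewrite b1.
Qed.

Lemma derive_stereo_neq0 u v : v != 0 -> 'D_v (@stereo R n eps) u != 0.
Proof.
apply: contraNneq => D0; have hs := smooth_is_derive v stereo_smooth (I : setT u).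
have h := chain_is_derive_row stereo_dom_open (stereo_inv_smooth 1%N) (stereo_in_dom u) hs.
have e : (fun u => stereo_inv (stereo eps u)) = id by apply/funext => y; exact: stereoK.
rewrite e D0 in h; have := isd_unique h (is_derive_id u v).
rewrite (derive_basis_row _ stereo_dom_open (stereo_inv_smooth 1%N) (stereo_in_dom u)) big1.
  by move=> <-.
by move=> i _; rewrite mxE scale0r.
Qed.

Lemma dot_stereo_derive u v : dot (stereo eps u) ('D_v (@stereo R n eps) u) = 0.
Proof.
have h := derive_dot_eq openT stereo_smooth stereo_smooth (fun u _ => dot_stereo u) I (isdC u v 1).
by rewrite dotC; exact: half_eq0 h.
Qed.

End Stereographic.

(** * Maps defined on the sphere *)

Section SphereMap.
Variables (R : realType) (n M : nat) (F : 'rV[R]_n.+1 -> 'rV[R]_M).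
Hypothesis Fs : sphere_smooth F.

(** [sphere_diff] differentiates the extension constant along rays. It agrees with F on unit
    vectors, hence after composition with a map g into the sphere. *)
Lemma sphere_comp (V : normedModType R) (U : set V) (g : V -> 'rV[R]_n.+1) :
  open U -> smooth U g -> (forall y, U y -> dot (g y) (g y) = 1) ->
  smooth U (fun y => F (g y)) /\
  (forall y v, U y -> 'D_v (fun y => F (g y)) y = sphere_diff F (g y) ('D_v g y)).
Proof.
move=> Uo gs g1.
have gn y : U y -> F (g y) = (F \o @normalize R n.+1) (g y) by move=> Uy /=; rewrite normalize_id ?g1.
have oN := @open_neq0 R n.+1.
have gU y : U y -> g y != 0 by move=> Uy; apply: unit_neq0; exact: g1.
split=> [K|y v Uy].
  by apply: Ck_ext (smooth_comp Uo oN gU gs Fs K) => // y Uy; rewrite gn.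
rewrite (derive_ext v Uo gn Uy).
by case: (chain_is_derive_row oN (Fs 1%N) (gU y Uy) (smooth_is_derive v gs Uy)).
Qed.

Definition chart_map eps (u : 'rV[R]_n) : 'rV[R]_M := F (stereo eps u).

Lemma chart_map_smooth eps : smooth setT (chart_map eps).
Proof. by have [h _] := sphere_comp openT (@stereo_smooth R n eps) (fun u _ => dot_stereo eps u). Qed.

Lemma derive_chart_map eps u v :
  'D_v (chart_map eps) u = sphere_diff F (stereo eps u) ('D_v (@stereo R n eps) u).
Proof.
have [_ h] := sphere_comp openT (@stereo_smooth R n eps) (fun u _ => dot_stereo eps u).
exact: h u v I.
Qed.

End SphereMap.

Section UnitMap.
Variables (R : realType) (n M : nat) (X : 'rV[R]_n -> 'rV[R]_M).
Hypotheses (Xs : smooth setT X) (X1 : forall u, dot (X u) (X u) = 1).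

Lemma dot_derive_unit i u : dot ('D_(basis R i) X u) (X u) = 0.
Proof.
apply: half_eq0; exact: (derive_dot_eq openT Xs Xs (fun u _ => X1 u) I (isdC u (basis R i) 1)).
Qed.

Lemma dot_partial2_unit i j u : dot (partial2 X u i j) (X u) = - gram X u i j.
Proof.
have h := derive_dot_eq openT (smooth_D (basis R j) Xs) Xs (fun u _ => dot_derive_unit j u) I
  (isdC u (basis R i) 0).
by rewrite gramE; apply/eqP; rewrite -addr_eq0; apply/eqP.
Qed.

End UnitMap.

(** * Minimality as an eigenvalue equation *)

Section Immersion.
Variables (R : realType) (n N : nat) (x : 'rV[R]_n.+1 -> 'rV[R]_N.+1).
Hypothesis hx : sphere_immersion x.

Let xs : sphere_smooth x. Proof. by case: hx. Qed.

Lemma in_chart_gram eps : in_chart (induced_metric x) eps = gram (chart_map x eps).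
Proof. by apply/funext => u; apply/matrixP => i j; rewrite mxE gramE !derive_chart_map. Qed.

Lemma gram_chart_unit eps u : gram (chart_map x eps) u \in unitmx.
Proof.
rewrite -row_free_unit; apply: inj_row_free => v vG; apply/eqP; apply: contraT => v0.
have D0 : 'D_v (chart_map x eps) u != 0.
  rewrite derive_chart_map//; case: hx => _ _; apply; [exact: dot_stereo|exact: dot_stereo_derive|].
  exact: derive_stereo_neq0.
rewrite -dot_eq0 -gram_form in D0; last exact: chart_map_smooth.
by move/eqP: D0; case; rewrite formE vG mul0mx mxE.
Qed.

Lemma dot_chart_map eps u : dot (chart_map x eps u) (chart_map x eps u) = 1.
Proof. by case: hx => _ h _; apply: h; exact: dot_stereo. Qed.

(** Takahashi's observation: the component of d_i d_j X along X is - g_ij by [dot_partial2_unit]. It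
    is part of the Euclidean normal component but not of [second_form], and its trace is - n X. *)
Lemma minimal_normal_dot eps u h : minimal x ->
  \sum_i \sum_j invmx (gram (chart_map x eps) u) i j *
    normal_dot (chart_map x eps) u (partial2 (chart_map x eps) u i j) h
  + n%:R * dot (chart_map x eps u) h = 0.
Proof.
move=> /(_ eps u) H; rewrite -[RHS](dot0l h) -H /mean_curvature dot_suml.
set X := chart_map x eps; set G := gram X u.
have -> : n%:R = \sum_i \sum_j invmx G i j * G i j :> R.
  rewrite -[n in LHS]card_ord -sumr_const; apply: eq_bigr => i _.
  rewrite -[RHS](_ : (invmx G *m G^T) i i = _); last by rewrite mxE; apply: eq_bigr => j _; rewrite [G^T _ _]mxE.
  have -> : G^T = G by rewrite /G /gram trmx_mul trmxK.
  by rewrite mulVmx ?gram_chart_unit// mxE eqxx.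
rewrite mulr_suml -big_split; apply: eq_bigr => i _ /=.
rewrite dot_suml mulr_suml -big_split; apply: eq_bigr => j _ /=.
rewrite dotZl -mulrA -mulrDr in_chart_gram; congr (_ * _).
rewrite /second_form -/(chart_map x eps) -/X -/(partial2 X u i j).
rewrite 2!dotBl dotZl (dot_partial2_unit (chart_map_smooth xs eps) (dot_chart_map eps)) -/X -/G mulNr opprK addrAC; congr (_ + _).
rewrite /normal_dot perp_dotE; congr (_ - _); rewrite dot_suml; apply: eq_bigr => k _.
rewrite dot_suml row_jacobian mulr_sumr; apply: eq_bigr => l _.
by rewrite dotZl row_jacobian in_chart_gram (dotC ('D_(basis R l) _ u)) mulrCA !mulrA.
Qed.

End Immersion.

(** * Polar coordinates on an open set *)

Section PolarMap.
Variables (R : realType) (n' : nat).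
Let n := n'.+1.
Variable a : R.
Implicit Types (q v : 'rV[R]_(1 + n)) (p : 'rV[R]_n).

Lemma time_slice t p : time (slice t p) = t.
Proof. by rewrite /time row_mxEl mxE mulr1n. Qed.

Lemma rsubmx_slice t p : rsubmx (slice t p) = p.
Proof. exact: row_mxKr. Qed.

Lemma slice_split q : q = slice (time q) (rsubmx q).
Proof. exact: row_mx_split. Qed.

Lemma rsubmx_e_space i : rsubmx (@e_space R n' i) = basis R i.
Proof. exact: row_mxKr. Qed.

Lemma time_is_derive q v : is_derive q v (@time R n') (time v).
Proof. exact: is_derive_coord. Qed.

Lemma rsubmx_is_derive q v : is_derive q v (fun q : 'rV[R]_(1 + n) => rsubmx q) (rsubmx v).
Proof.
apply/is_derive_mxP => i j; rewrite (_ : (fun y => _) = (fun y : 'rV[R]_(1 + n) => y i (rshift 1 j))).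
  by rewrite mxE; exact: is_derive_coord.
by apply/funext => y; rewrite mxE.
Qed.

Lemma is_derive_row_mx (V : normedModType R) (f : V -> R) (g : V -> 'rV[R]_n) (x v : V) b c :
  is_derive x v f b -> is_derive x v g c ->
  is_derive x v (fun y => row_mx (f y)%:M (g y) : 'rV[R]_(1 + n)) (row_mx b%:M c).
Proof.
move=> fb gc; apply/is_derive_mxP => i j; case: (split_ordP j) => k ->.
  rewrite (_ : (fun y => _) = f); first by rewrite row_mxEl mxE !ord1 mulr1n.
  by apply/funext => y; rewrite row_mxEl mxE !ord1 mulr1n.
rewrite (_ : (fun y => _) = (fun y => g y i k)); last by apply/funext => y; rewrite row_mxEr.
by rewrite row_mxEr; exact: (is_derive_mxP _ _ _ _).1.
Qed.

Lemma derive_dir0 k m (U : set 'rV[R]_k) (F : 'rV[R]_k -> 'rV[R]_m) x :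
  open U -> Ck 1 U F -> U x -> 'D_0 F x = 0.
Proof.
by move=> Uo Fk Ux; rewrite (derive_basis_row _ Uo Fk Ux) big1// => i _; rewrite mxE scale0r.
Qed.

(** p ranges over all nonzero vectors and only its direction counts. Polar coordinates thus live on
    an open set of R^(1+n), at the price of one degenerate direction, the radial one. *)
Definition direction q : 'rV[R]_n := normalize (rsubmx q).

Definition direction_der q v : 'rV[R]_n := 'D_(rsubmx v) (@normalize R n) (rsubmx q).

Lemma direction_is_derive q v : off_axis q -> is_derive q v direction (direction_der q v).
Proof.
move=> qo; exact: (chain_is_derive_row (@open_neq0 R n) (@normalize_smooth R n 1%N) qo (rsubmx_is_derive q v)).
Qed.

Lemma direction_smooth : smooth (@off_axis R n') direction.
Proof.
have oo := @off_axis_open R n'.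
apply: (smooth_comp oo (@open_neq0 R n)) (@normalize_smooth R n); first by [].
by apply: (smooth_rsubmx oo) => K; exact: Ck_id.
Qed.

Lemma dot_direction q : off_axis q -> dot (direction q) (direction q) = 1.
Proof. exact: dot_normalize. Qed.

Lemma direction_der_time q : off_axis q -> direction_der q (e_time R n) = 0.
Proof.
move=> qo; rewrite /direction_der row_mxKr.
exact: derive_dir0 (@open_neq0 R n) (@normalize_smooth R n 1%N) qo.
Qed.

Lemma direction_der_radial q : off_axis q -> direction_der q (row_mx 0 (rsubmx q)) = 0.
Proof. by move=> qo; rewrite /direction_der row_mxKr derive_normalize_radial. Qed.

Lemma dot_direction_der q i j : off_axis q ->
  dot (direction_der q (@e_space R n' i)) (direction_der q (@e_space R n' j)) = round_coef q i j.
Proof.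
move=> qo; rewrite /direction_der !rsubmx_e_space dot_derive_normalize// !dot_basisl /round_coef.
have -> : dot (rsubmx q) (rsubmx q) = rad2 q by apply: eq_bigr => k _; rewrite mxE expr2.
by rewrite [basis R j _ _]mxE eqxx /= [rsubmx q 0 i]mxE [rsubmx q 0 j]mxE eq_sym.
Qed.

Definition polar_map q : 'rV[R]_(1 + n) := polar a (time q) (direction q).

Definition polar_angle q : R := pi * time q / a.

Lemma polar_map_is_derive q v : off_axis q -> is_derive q v polar_map
  (row_mx (- sin (polar_angle q) * (pi * time v / a))%:M
    ((cos (polar_angle q) * (pi * time v / a)) *: direction q + sin (polar_angle q) *: direction_der q v)).
Proof.
move=> qo; have hA : is_derive q v polar_angle (pi * time v / a).
  have h := isdM (isdM (isdC q v (pi : R)) (time_is_derive q v)) (isdC q v a^-1).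
  by apply: is_derive_eq h _; rewrite mul0r add0r mulr0 addr0.
apply: is_derive_row_mx.
  exact: is_derive_comp1 hA (is_derive_cos _).
exact: isdZ_row (is_derive_comp1 hA (is_derive_sin _)) (direction_is_derive v qo).
Qed.

Lemma polar_map_smooth : smooth (@off_axis R n') polar_map.
Proof.
have oo := @off_axis_open R n'.
have hA K : Ck K (@off_axis R n') polar_angle.
  apply: (CkM oo); last exact: Ck_cst.
  by apply: (CkM oo); [exact: Ck_cst|exact: (Ck_coord _ _ _ oo)].
apply: (smooth_row_mx oo) => [K|].
  exact: (Ck_comp1 oo (fun _ _ => I) (hA K) (sin_cos_Ck R K).2).
apply: (smooth_scale oo _ direction_smooth) => K.
exact: (Ck_comp1 oo (fun _ _ => I) (hA K) (sin_cos_Ck R K).1).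
Qed.

Lemma dot_polar t (w : 'rV[R]_n) : dot w w = 1 -> dot (polar a t w) (polar a t w) = 1.
Proof. by move=> w1; rewrite dot_row_mx dotZl dotZr w1 mulr1 -!expr2 cos2Dsin2. Qed.

Lemma dot_polar_map q : off_axis q -> dot (polar_map q) (polar_map q) = 1.
Proof. by move=> qo; apply: dot_polar; exact: dot_direction. Qed.

Lemma dot_derive_polar_map q v w : off_axis q ->
  dot ('D_v polar_map q) ('D_w polar_map q) = (pi / a) ^+ 2 * time v * time w
  + sin (polar_angle q) ^+ 2 * dot (direction_der q v) (direction_der q w).
Proof.
move=> qo; have [_ ->] := polar_map_is_derive v qo; have [_ ->] := polar_map_is_derive w qo.
have d1 := dot_direction qo.
have Ev : dot (direction q) (direction_der q v) = 0 by exact: dot_normalize_derive.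
have Ew : dot (direction q) (direction_der q w) = 0 by exact: dot_normalize_derive.
move: (direction q) (direction_der q v) (direction_der q w) d1 Ev Ew => d dv dw d1 Ev Ew.
rewrite dot_row_mx !(dotDl, dotDr, dotZl, dotZr) d1 (dotC dv) Ev Ew.
have := cos2Dsin2 (polar_angle q).
move: (cos _) (sin _) (time _) (time _) (dot _ _) => c s tv tw dd h.
rewrite !mulr0 addr0 add0r mulr1 -[(pi / a) ^+ 2]mul1r -h; ring.
Qed.

Section Base.
Variable phi : 'rV[R]_n.+1 -> 'rV[R]_n.+1.
Hypotheses (phis : sphere_smooth phi) (phi1 : forall z, usphere R n.+1 z -> usphere R n.+1 (phi z)).

Definition base q : 'rV[R]_(1 + n) := phi (polar_map q).

Let baseP := sphere_comp phis (@off_axis_open R n') polar_map_smooth dot_polar_map.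

Lemma base_smooth : smooth (@off_axis R n') base.
Proof. by case: baseP. Qed.

Lemma dot_base q : off_axis q -> dot (base q) (base q) = 1.
Proof. by move=> qo; apply: phi1; exact: dot_polar_map. Qed.

Lemma base_radial q : off_axis q -> 'D_(row_mx 0 (rsubmx q)) base q = 0.
Proof.
move=> qo; rewrite baseP.2//; have [_ ->] := polar_map_is_derive (row_mx 0 (rsubmx q)) qo.
have -> : time (row_mx 0 (rsubmx q) : 'rV[R]_(1 + n)) = 0 by rewrite /time row_mxEl mxE.
rewrite !mulr0 mul0r !mulr0 scale0r direction_der_radial// scaler0 addr0.
rewrite (_ : row_mx _ _ = 0); last by rewrite raddf0 row_mx0.
exact: (derive_dir0 (@open_neq0 R n.+1) (phis 1%N)) (unit_neq0 (dot_polar_map qo)).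
Qed.

Lemma derive_base_time t p : p != 0 ->
  'D_(e_time R n) base (slice t p) = (fun s : R => phi (polar a s (normalize p)))^`() t.
Proof.
move=> p0; have qo : off_axis (slice t p) by rewrite /off_axis /= rsubmx_slice.
have hs : is_derive t (1 : R) (fun s : R => slice s p) (e_time R n).
  exact: is_derive_row_mx.
have h := @chain_is_derive_row R _ _ _ _ base (fun s : R => slice s p) t _ _ (@off_axis_open R n')
  (base_smooth 1%N) qo hs.
rewrite derive1E; have [_ <-] := h; congr ('D_1 _ t); apply/funext => s.
by rewrite /base /polar_map /direction time_slice rsubmx_slice.
Qed.

(** Idempotence of [normalize] converts derivatives in p into the [sphere_diff] used in the
    definition of rotational symmetry. *)
Lemma derive_base_space t p i : p != 0 -> 'D_(@e_space R n' i) base (slice t p) =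
  sphere_diff (fun w => phi (polar a t w)) (normalize p) ('D_(basis R i) (@normalize R n) p).
Proof.
move=> p0; have qo : off_axis (slice t p) by rewrite /off_axis /= rsubmx_slice.
have h := chain_is_derive_row (@off_axis_open R n') (base_smooth 1%N) qo (slice_is_derive t p (basis R i)).
pose H := (fun w => phi (polar a t w)) \o @normalize R n.
have Hs : smooth [set p : 'rV[R]_n | p != 0] H.
  have oN := @open_neq0 R n.
  have so : forall p : 'rV[R]_n, p != 0 -> off_axis (slice t p).
    by move=> y y0; rewrite /off_axis /= rsubmx_slice.
  have ss : smooth [set p : 'rV[R]_n | p != 0] (slice t).
    by move=> K; have h1 := @slice_Ck R n t K; exact: Ck_sub h1.
  move=> K; apply: Ck_ext (smooth_comp oN (@off_axis_open R n') so ss base_smooth K) => // y y0.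
  by rewrite /base /polar_map /direction time_slice rsubmx_slice.
have [_ <-] := h.
have E y : y != 0 -> base (slice t y) = H (normalize y).
  by move=> y0; rewrite /H /= normalizeK// /base /polar_map /direction time_slice rsubmx_slice.
apply: etrans (derive_ext (basis R i) (@open_neq0 R n) E p0) _.
have hn := smooth_is_derive (basis R i) (@normalize_smooth R n) p0.
have n0 : normalize p != 0 by apply: unit_neq0; exact: dot_normalize.
have [_ e] := chain_is_derive_row (@open_neq0 R n) (Hs 1%N) n0 hn; exact: e.
Qed.

End Base.
End PolarMap.

(** * Minimal spheres with a rotationally symmetric metric *)

Lemma dot_gram_eq0 (R : realType) m (v w : 'rV[R]_m) :
  dot v v * dot w w - dot v w ^+ 2 = 0 ->
  dot (dot w w *: v + - dot v w *: w) (dot w w *: v + - dot v w *: w) = 0.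
Proof.
move=> D0; rewrite !(dotDl, dotDr, dotZl, dotZr) (dotC w v) -[RHS](mulr0 (dot w w)) -D0; ring.
Qed.

(** * Umbilical hypersurfaces and constant curvature *)

Section SpaceForm.
Variables (R : realType) (n : nat) (X N : 'rV[R]_n -> 'rV[R]_(1 + n)) (s : R).
Hypotheses (Xs : smooth setT X) (Gu : forall u, gram X u \in unitmx).
Hypothesis N1 : forall u, dot (N u) (N u) = 1.
Hypothesis NX : forall u i, dot (N u) ('D_(basis R i) X u) = 0.
Hypothesis NX2 : forall u i j, dot (partial2 X u i j) (N u) = - s * gram X u i j.

(* The normal space is spanned by N, because N and the rows of the Jacobian
   form a basis of the whole space. *)
Lemma normal_dot_hypersurface u h h' : normal_dot X u h h' = dot h (N u) * dot h' (N u).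
Proof.
pose J := jacobian X u.
pose B : 'M[R]_(1 + n) := col_mx (N u) J.
pose C : 'M[R]_(1 + n) := block_mx 1%:M 0 0 (invmx (gram X u)).
have NJ : N u *m J^T = 0.
  apply/rowP => i; rewrite [RHS]mxE -[RHS](NX u i) dotE -row_jacobian tr_row.
  by rewrite mxE [RHS]mxE; apply: eq_bigr => k _; rewrite !mxE.
have JN : J *m (N u)^T = 0 by rewrite -[LHS]trmxK trmx_mul trmxK NJ trmx0.
have BBC : B *m (B^T *m C) = 1%:M.
  rewrite mulmxA tr_col_mx mul_col_row NJ JN mulmx_block !(mul0mx, mulmx0, addr0, add0r) mulmx1.
  rewrite [N u *m _]mx11_scalar -dotE N1 [RHS]scalar_mx_block; congr block_mx.
  exact: mulmxV (Gu u).
have := mulmx1C BBC; rewrite tr_col_mx mul_row_block !(mul0mx, mulmx0, addr0, add0r) mulmx1.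
rewrite mul_row_col => E; rewrite /normal_dot /perp_dot -/J.
have -> : 1%:M - J^T *m invmx (gram X u) *m J = (N u)^T *m N u by rewrite -E addrK.
by rewrite mulmxA -mulmxA mxE big_ord1 (dotC h') !dotE.
Qed.

Lemma hess_normal u v w : dot (hess X u v w) (N u) = - s * form (gram X u) v w.
Proof.
rewrite dot_suml /form mulr_sumr; apply: eq_bigr => i _; rewrite dot_suml mulr_sumr.
by apply: eq_bigr => j _; rewrite dotZl NX2; ring.
Qed.

Lemma space_form_curvature u v w : form (gram X u) (curvature (gram X) u v w w) v =
  s ^+ 2 * (form (gram X u) v v * form (gram X u) w w - form (gram X u) v w ^+ 2).
Proof.
by rewrite gauss_sectional// !normal_dot_hypersurface !hess_normal; ring.
Qed.

Lemma gram_det_neq0 u v w : row_free (col_mx v w) ->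
  form (gram X u) v v * form (gram X u) w w - form (gram X u) v w ^+ 2 != 0.
Proof.
move=> vw; have Dinj z : form (gram X u) z z = 0 -> z = 0.
  rewrite gram_form// => /eqP; rewrite dot_eq0 derive_jacobian// => /eqP zJ.
  by rewrite -[z]mulmx1 -(mulmxV (Gu u)) mulmxA /gram mulmxA zJ !mul0mx.
have lin a b : a *: v + b *: w = 0 -> a = 0 /\ b = 0.
  move=> E; have E' : (row_mx a%:M b%:M : 'rV[R]_(1 + 1)) *m col_mx v w = 0.
    by rewrite mul_row_col !mul_scalar_mx.
  have := row_free_inj vw (etrans E' (esym (mul0mx _ _))).
  rewrite -(row_mx0 _ 1 1 1) => /eq_row_mx[/matrixP/(_ 0 0) + /matrixP/(_ 0 0)].
  by rewrite !mxE !mulr1n.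
apply/eqP => D0; pose A := form (gram X u) w w; pose Bc := form (gram X u) v w.
have : A *: v + (- Bc) *: w = 0.
  apply: Dinj; rewrite !gram_form// in A Bc D0 *.
  (* Equality in the Cauchy-Schwarz inequality: a vanishing determinant makes this combination of
     length zero, against independence. *)
  have hz : 'D_(A *: v + - Bc *: w) X u = A *: 'D_v X u + - Bc *: 'D_w X u.
    by rewrite !derive_jacobian// mulmxDl -!scalemxAl.
  by rewrite gram_form// hz; exact: dot_gram_eq0.
move=> /lin[A0 _]; have w0 := Dinj w A0.
have [|_ /eqP] := lin 0 1; first by rewrite scale0r add0r scale1r.
by rewrite oner_eq0.
Qed.

Lemma space_form_sec u v w : row_free (col_mx v w) -> sec (gram X) u v w = s ^+ 2.
Proof.
by move=> vw; rewrite /sec space_form_curvature mulfK// gram_det_neq0.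
Qed.

End SpaceForm.

Lemma orthogonal_row_free (R : realType) n (G : 'M[R]_n) v w : form G v v != 0 -> form G w w != 0 ->
  form G v w = 0 -> form G w v = 0 -> row_free (col_mx v w).
Proof.
move=> vv ww vw wv; apply: inj_row_free => z.
rewrite -[z]hsubmxK mul_row_col [lsubmx z]mx11_scalar [rsubmx z]mx11_scalar !mul_scalar_mx.
move: (lsubmx z 0 0) (rsubmx z 0 0) => a b E.
have F y : a * form G v y + b * form G w y = 0.
  transitivity (form G (a *: v + b *: w) y); last by rewrite E formE !mul0mx mxE.
  by rewrite !formE !mulmxDl -!scalemxAl !mxE.
have := F v; rewrite wv mulr0 addr0 => /eqP; rewrite mulf_eq0 (negPf vv) orbF => /eqP ->.
have := F w; rewrite vw mulr0 add0r => /eqP; rewrite mulf_eq0 (negPf ww) orbF => /eqP ->.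
by rewrite !raddf0 row_mx0.
Qed.

Lemma sec_orthogonal (R : realType) n (G : 'rV[R]_n -> 'M[R]_n) u v w (b k : R) :
  form (G u) (curvature G u v w w) v = - (b * k) -> form (G u) v v = 1 -> form (G u) v w = 0 ->
  form (G u) w w = b ^+ 2 -> b != 0 -> sec G u v w = - k / b.
Proof. by move=> K vv vw ww b0; rewrite /sec K vv vw ww; field. Qed.

Lemma linear_congr (R : realType) (A A' T T' S S' c d b L : R) : A = A' -> T = T' -> S = S' ->
  c * A' + d * T' + b * S' + L = 0 -> c * A + d * T + b * S + L = 0.
Proof. by move=> -> -> ->. Qed.

Lemma cont_eq0_ends (R : realType) (g : R -> R) a : 0 < a -> continuous g ->
  (forall t, 0 < t < a -> g t = 0) -> g 0 = 0 /\ g a = 0.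
Proof.
move=> a0 gc g0.
have nz t : g t != 0 -> \forall s \near t, g s != 0.
  have o : open [set y : R | y != 0] by exact: open_neq.
  by move=> gt; exact: (gc t _ (open_nbhs_nbhs (conj o gt))).
split; apply/eqP; apply: contraT => gn.
  have [e /andP[e0 ea] P] := near_right (nz _ gn) a0.
  have /P : 0 <= e / 2 <= e by lra.
  by rewrite g0 ?eqxx//; lra.
have [e /andP[e0 ea] P] := near_left (nz _ gn) a0.
have /P : e <= (e + a) / 2 <= a by lra.
by rewrite g0 ?eqxx//; lra.
Qed.

Lemma formBZ (R : realType) n (A C : 'M[R]_n) (c : R) v w :
  form (A - c *: C) v w = form A v w - c * form C v w.
Proof. by rewrite !formE mulmxBr mulmxBl -scalemxAr -scalemxAl !mxE. Qed.

Lemma sqr_lt1 (R : realType) (z : R) : z ^+ 2 < 1 -> -1 < z < 1.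
Proof. by move=> h; apply/andP; split; nra. Qed.

Lemma sqr1_close (R : realType) (z y : R) : z ^+ 2 = 1 -> y ^+ 2 = 1 -> `|z - y| < 1 -> z = y.
Proof.
move=> /eqP; rewrite sqrf_eq1 => /orP[]/eqP-> /eqP; rewrite sqrf_eq1 => /orP[]/eqP-> //;
  rewrite ltr_norml => /andP[]; lra.
Qed.

Lemma scale_mxE (R : realType) m n (c : R) (A : 'M[R]_(m, n)) i j : (c *: A) i j = c * A i j.
Proof. by rewrite mxE. Qed.

Lemma derive_dotl (R : realType) (V : normedModType R) m (U : set V) (F : V -> 'rV[R]_m) h x v :
  smooth U F -> U x -> 'D_v (fun x => dot (F x) h) x = dot ('D_v F x) h.
Proof.
move=> Fs Ux; have [_ ->] := isd_dot (smooth_is_derive v Fs Ux) (is_derive_cst h x v).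
by rewrite dot0l addr0.
Qed.

Lemma dot_derive_normalize_round (R : realType) n' t (p : 'rV[R]_n'.+1) i j : p != 0 ->
  dot ('D_(basis R i) (@normalize R n'.+1) p) ('D_(basis R j) (@normalize R n'.+1) p) =
  round_coef (slice t p) i j.
Proof.
move=> p0; have qo : off_axis (slice t p) by rewrite /off_axis /= rsubmx_slice.
have := dot_direction_der i j qo.
by rewrite /direction_der !rsubmx_e_space rsubmx_slice.
Qed.

(** * The immersion in polar coordinates *)

Section WarpedSphere.
Variables (R : realType) (n' N : nat).
Let n := n'.+1.
Variables (x : 'rV[R]_n.+1 -> 'rV[R]_N.+1) (a : R) (f : R -> R) (phi psi : 'rV[R]_n.+1 -> 'rV[R]_n.+1).
Hypotheses (hx : sphere_immersion x) (a0 : 0 < a) (wf : warping_function a f).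
Hypotheses (phis : sphere_smooth phi) (psis : sphere_smooth psi).
Hypothesis phiK : forall z, usphere R n.+1 z -> usphere R n.+1 (phi z) /\ psi (phi z) = z.
Hypothesis psiK : forall z, usphere R n.+1 z -> usphere R n.+1 (psi z) /\ phi (psi z) = z.
Hypothesis hrot : forall (t : R) (w xi eta : 'rV[R]_n), 0 < t < a -> usphere R n w ->
  dot w xi = 0 -> dot w eta = 0 ->
  [/\ induced_metric x (phi (polar a t w)) ((fun s : R => phi (polar a s w))^`() t)
        ((fun s : R => phi (polar a s w))^`() t) = 1,
      induced_metric x (phi (polar a t w)) ((fun s : R => phi (polar a s w))^`() t)
        (sphere_diff (fun w => phi (polar a t w)) w xi) = 0 &
      induced_metric x (phi (polar a t w)) (sphere_diff (fun w => phi (polar a t w)) w xi)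
        (sphere_diff (fun w => phi (polar a t w)) w eta) = f t ^+ 2 * dot xi eta].

Local Notation et := (e_time R n).
Local Notation e i := (@e_space R n' i).
Local Notation B := (base a phi).
Local Notation off := (@off_axis R n').

Let phi1 z : usphere R n.+1 z -> usphere R n.+1 (phi z). Proof. by case/phiK. Qed.
Let oo : open off := @off_axis_open R n'.
Let Bs : smooth off B := base_smooth a phis.
Let xs : sphere_smooth x. Proof. by case: hx. Qed.

Definition param (q : 'rV[R]_(1 + n)) : 'rV[R]_N.+1 := x (B q).

Let paramP := sphere_comp xs oo Bs (dot_base a phi1).

Lemma param_smooth : smooth off param. Proof. by case: paramP. Qed.

Lemma derive_param q v : off q -> 'D_v param q = sphere_diff x (B q) ('D_v B q).
Proof. exact: paramP.2. Qed.

Lemma param_radial q : off q -> 'D_(row_mx 0 (rsubmx q)) param q = 0.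
Proof.
move=> qo; rewrite derive_param// (base_radial a phis)//.
exact: (derive_dir0 (@open_neq0 R n.+1) (xs 1%N)) (unit_neq0 (dot_base a phi1 qo)).
Qed.

Section Slice.
Variables (t : R) (p : 'rV[R]_n).
Hypotheses (p0 : p != 0) (ta : 0 < t < a).

Let qo : off (slice t p). Proof. by rewrite /off_axis /= rsubmx_slice. Qed.

Let BE : B (slice t p) = phi (polar a t (normalize p)).
Proof. by rewrite /base /polar_map /direction time_slice rsubmx_slice. Qed.

Let Dt : 'D_et param (slice t p) =
  sphere_diff x (phi (polar a t (normalize p))) (derive1 (fun s : R => phi (polar a s (normalize p))) t) :=
  etrans (derive_param et qo) (congr2 (sphere_diff x) BE (derive_base_time a phis t p0)).

Let Di i : 'D_(e i) param (slice t p) = sphere_diff x (phi (polar a t (normalize p)))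
    (sphere_diff (fun w => phi (polar a t w)) (normalize p) ('D_(basis R i) (@normalize R n) p)) :=
  etrans (derive_param (e i) qo) (congr2 (sphere_diff x) BE (derive_base_space a phis t i p0)).

Let H i j := hrot ta (dot_normalize p0) (dot_normalize_derive (basis R i) p0)
                                        (dot_normalize_derive (basis R j) p0).

Lemma param_tt_slice : dot ('D_et param (slice t p)) ('D_et param (slice t p)) = 1.
Proof. by have [h _ _] := H 0 0; exact: etrans (congr2 (@dot R N.+1) Dt Dt) h. Qed.

Lemma param_ti_slice i : dot ('D_et param (slice t p)) ('D_(e i) param (slice t p)) = 0.
Proof. by have [_ h _] := H i i; exact: etrans (congr2 (@dot R N.+1) Dt (Di i)) h. Qed.

Lemma param_ij_slice i j : dot ('D_(e i) param (slice t p)) ('D_(e j) param (slice t p)) =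
  f t ^+ 2 * round_coef (slice t p) i j.
Proof.
have [_ _ h] := H i j; apply: etrans (congr2 (@dot R N.+1) (Di i) (Di j)) (etrans h _).
by congr (_ * _); exact: dot_derive_normalize_round.
Qed.

End Slice.

Lemma param_tt q : off q -> 0 < time q < a -> dot ('D_et param q) ('D_et param q) = 1.
Proof. by move=> qo ta; have := param_tt_slice qo ta; rewrite -slice_split. Qed.

Lemma param_ti q i : off q -> 0 < time q < a -> dot ('D_et param q) ('D_(e i) param q) = 0.
Proof. by move=> qo ta; have := param_ti_slice qo ta i; rewrite -slice_split. Qed.

Lemma param_ij q i j : off q -> 0 < time q < a ->
  dot ('D_(e i) param q) ('D_(e j) param q) = f (time q) ^+ 2 * round_coef q i j.
Proof. by move=> qo ta; have := param_ij_slice qo ta i j; rewrite -slice_split. Qed.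

Local Notation f1 := ('D_(1 : R) f).
Local Notation f2 := ('D_(1 : R) f1).

Let fs : smooth setT f. Proof. by case: wf. Qed.

Lemma warping_is_derive (t : R) : is_derive t (1 : R) f (f1 t).
Proof. exact: smooth_is_derive fs I. Qed.

Lemma warping_is_derive2 (t : R) : is_derive t (1 : R) f1 (f2 t).
Proof. exact: smooth_is_derive (smooth_D _ fs) I. Qed.

Lemma warping_gt0 t : 0 < t < a -> 0 < f t.
Proof. by case: wf => _ h _ _ _; exact: h. Qed.

Section Chart.
Variable eps : bool.

Definition chart_dom : set 'rV[R]_(1 + n) :=
  [set q | [/\ off q, 0 < time q < a & stereo_dom eps (B q)]].

Definition chart_coord (q : 'rV[R]_(1 + n)) : 'rV[R]_n := stereo_inv eps (B q).

Lemma chart_dom_open : open chart_dom.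
Proof.
have c : continuous (@time R n') by move=> q; exact: coord_continuous.
have oT : open [set q : 'rV[R]_(1 + n) | 0 < time q < a].
  rewrite (_ : [set q | _] = (@time R n') @^-1` [set y : R | 0 < y < a]); last by [].
  apply: open_comp => [q _|]; first exact: c.
  rewrite (_ : [set y | _] = [set y : R | 0 < y] `&` [set y : R | y < a]).
    by apply: openI; [exact: open_gt|exact: open_lt].
  by apply/seteqP; split=> y /= => [/andP[]|[-> ->]].
rewrite openE => q [qo qt qs]; have Bc : {for q, continuous B} := Ck_cont (Bs 0%N) qo.
rewrite /interior /=; near=> q'; split; near: q'.
- exact: (open_nbhs_nbhs (conj oo qo)).
- exact: (open_nbhs_nbhs (conj oT qt)).
- by apply: Bc; exact: (open_nbhs_nbhs (conj (@stereo_dom_open R n eps) qs)).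
Unshelve. all: by end_near. Qed.

Let W_off q : chart_dom q -> off q. Proof. by case. Qed.

Lemma chart_coord_smooth : smooth chart_dom chart_coord.
Proof.
apply: (smooth_comp chart_dom_open (@stereo_dom_open R n eps)) (@stereo_inv_smooth R n eps).
  by move=> q [].
exact: smooth_sub W_off Bs.
Qed.

Lemma stereo_chart_coord q : chart_dom q -> stereo eps (chart_coord q) = B q.
Proof. by case=> qo _ qs; apply: stereo_invK => //; exact: (dot_base a phi1 qo). Qed.

Lemma param_chart q : chart_dom q -> param q = chart_map x eps (chart_coord q).
Proof. by move=> Wq; rewrite /chart_map stereo_chart_coord. Qed.

Lemma chart_coord_radial q : chart_dom q -> 'D_(row_mx 0 (rsubmx q)) chart_coord q = 0.
Proof.
move=> [qo _ qs]; have hB := smooth_is_derive (row_mx 0 (rsubmx q)) Bs qo.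
have [_ E] := chain_is_derive_row (@stereo_dom_open R n eps) (@stereo_inv_smooth R n eps 1%N) qs hB.
rewrite E (base_radial a phis qo).
exact: derive_dir0 (@stereo_dom_open R n eps) (@stereo_inv_smooth R n eps 1%N) qs.
Qed.

Let Xs : smooth setT (chart_map x eps) := chart_map_smooth xs eps.
Let Gu := gram_chart_unit hx eps.
Let f0 (q : 'rV[R]_(1 + n)) : chart_dom q -> f (time q) != 0.
Proof. by case=> _ qt _; rewrite gt_eqF// warping_gt0. Qed.
Let Wtt q : chart_dom q -> dot ('D_et param q) ('D_et param q) = 1.
Proof. by case=> qo qt _; exact: param_tt. Qed.
Let Wti q i : chart_dom q -> dot ('D_et param q) ('D_(e i) param q) = 0.
Proof. by case=> qo qt _; exact: param_ti. Qed.
Let Wij q i j : chart_dom q ->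
  dot ('D_(e i) param q) ('D_(e j) param q) = f (time q) ^+ 2 * round_coef q i j.
Proof. by case=> qo qt _; exact: param_ij. Qed.

Lemma param_sectional q i (u := chart_coord q) (xt := 'D_et chart_coord q)
    (xi := 'D_(e i) chart_coord q) (G := gram (chart_map x eps)) : chart_dom q ->
  form (G u) (curvature G u xt xi xi) xt = - (f (time q) * f2 (time q) * round_coef q i i).
Proof.
move=> Wq; exact: (warped_sectional Xs Gu chart_dom_open chart_coord_smooth param_chart
  warping_is_derive warping_is_derive2 W_off f0 Wtt Wti Wij chart_coord_radial Wq i).
Qed.

Lemma param_ric q (u := chart_coord q) (xt := 'D_et chart_coord q)
    (G := gram (chart_map x eps)) : chart_dom q ->
  ric G u xt xt = - (n'%:R * f2 (time q) / f (time q)).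
Proof.
move=> Wq; exact: (warped_ric Xs Gu chart_dom_open chart_coord_smooth param_chart
  warping_is_derive warping_is_derive2 W_off f0 Wtt Wti Wij chart_coord_radial Wq).
Qed.

Lemma param_pde q h : minimal x -> chart_dom q ->
  f (time q) ^+ 2 * dot ('D_et ('D_et param) q) h
    + n'%:R * f (time q) * f1 (time q) * dot ('D_et param q) h
    + rad2 q * \sum_i dot ('D_(e i) ('D_(e i) param) q) h + n%:R * f (time q) ^+ 2 * dot (param q) h = 0.
Proof.
move=> hmin Wq; exact: (warped_pde Xs Gu chart_dom_open chart_coord_smooth param_chart
  warping_is_derive W_off f0 Wtt Wti Wij chart_coord_radial Wq
  (fun u h => minimal_normal_dot hx eps u h hmin) h).
Qed.

Lemma param_form_eq0 q (D : 'M[R]_n) (xt := 'D_et chart_coord q)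
    (xi := fun i => 'D_(e i) chart_coord q) : chart_dom q ->
  form D xt xt = 0 -> (forall i, form D xt (xi i) = 0) -> (forall i, form D (xi i) xt = 0) ->
  (forall i j, form D (xi i) (xi j) = 0) -> D = 0.
Proof.
move=> Wq; exact: (warped_form_eq0 Xs Gu chart_dom_open chart_coord_smooth param_chart
  W_off f0 Wtt Wti Wij chart_coord_radial Wq).
Qed.

Lemma param_gram q v w : chart_dom q ->
  form (gram (chart_map x eps) (chart_coord q)) ('D_v chart_coord q) ('D_w chart_coord q) =
  dot ('D_v param q) ('D_w param q).
Proof.
move=> Wq; rewrite gram_form//.
have D z := chart_derive Xs chart_dom_open chart_coord_smooth param_chart z Wq.
exact: (esym (congr2 (@dot R N.+1) (D v) (D w))).
Qed.

End Chart.

Lemma chart_cover q : off q -> 0 < time q < a -> exists eps, chart_dom eps q.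
Proof.
move=> qo qt; have [s1|s1] := eqVneq (B q 0 (lshift n 0)) 1; [exists true|exists false]; split=> //.
  by rewrite /stereo_dom /= s1 expr1 mulr1 lt_eqF// ltrN10.
by rewrite /stereo_dom /= expr0 mul1r.
Qed.

(** * From curvature bounds to bounds on f'' *)

Section CurvatureBounds.
Hypothesis n'0 : (0 < n')%N.
Variable t : R.
Hypothesis ta : 0 < t < a.

Let p : 'rV[R]_n := basis R 0.
Let q := slice t p.

Let qo : off q.
Proof.
rewrite /off_axis /= rsubmx_slice; apply/eqP => /rowP/(_ 0).
by rewrite !mxE eqxx => /eqP; rewrite oner_eq0.
Qed.

Let qt : time q = t. Proof. exact: time_slice. Qed.

(** At the unit vector p = e_0 the last coordinate direction is tangent to the unit sphere, being
    different from e_0 because n' > 0. *)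
Let round1 : round_coef q ord_max ord_max = 1.
Proof.
have z : (ord_max : 'I_n) != 0 by rewrite -val_eqE /= -lt0n.
rewrite /round_coef eqxx /q /slice row_mxEr [p _ _]mxE (negPf z) andbF !mul0r subr0.
rewrite rad2_slice (bigD1 0)//= big1 => [|i /negPf i0]; last by rewrite mxE i0 andbF expr0n.
by rewrite mxE !eqxx expr1n addr0 invr1 mulr1.
Qed.

(** A plane spanned by d_t and a vector tangent to the sphere t = const has curvature - f'' / f. *)
Lemma warping_le c0 : sec_le (induced_metric x) c0 -> - f2 t <= c0 * f t.
Proof.
have ta' : 0 < time q < a by rewrite qt.
have [eps Wq] := chart_cover qo ta'; have fp := warping_gt0 ta.
have fpn : f t != 0 by rewrite gt_eqF.
move=> /(_ eps (chart_coord eps q) ('D_et (chart_coord eps) q) ('D_(e ord_max) (chart_coord eps) q)).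
have g11 := etrans (param_gram et et Wq) (param_tt qo ta').
have g12 := etrans (param_gram et (e ord_max) Wq) (param_ti ord_max qo ta').
have g21 := etrans (param_gram (e ord_max) et Wq) (etrans (dotC _ _) (param_ti ord_max qo ta')).
have g22 := etrans (param_gram (e ord_max) (e ord_max) Wq) (param_ij ord_max ord_max qo ta').
have K := param_sectional ord_max Wq.
rewrite round1 qt mulr1 in g22; rewrite round1 qt mulr1 in K.
have S := sec_orthogonal K g11 g12 g22 fpn.
have n1 : form (gram (chart_map x eps) (chart_coord eps q)) ('D_et (chart_coord eps) q)
  ('D_et (chart_coord eps) q) != 0 by rewrite g11 oner_eq0.
have n2 : form (gram (chart_map x eps) (chart_coord eps q)) ('D_(e ord_max) (chart_coord eps) q)
  ('D_(e ord_max) (chart_coord eps) q) != 0 by rewrite g22 expf_neq0.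
rewrite (in_chart_gram hx) => /(_ (orthogonal_row_free n1 n2 g12 g21)).
by rewrite S ler_pdivrMr.
Qed.

Lemma warping_ge c1 : ric_ge (induced_metric x) (n'%:R * c1) -> c1 * f t <= - f2 t.
Proof.
have ta' : 0 < time q < a by rewrite qt.
have [eps Wq] := chart_cover qo ta'; have fp := warping_gt0 ta.
move=> /(_ eps (chart_coord eps q) ('D_et (chart_coord eps) q)).
have g11 := etrans (param_gram et et Wq) (param_tt qo ta').
rewrite (in_chart_gram hx) g11 mulr1 (param_ric Wq) qt -mulrA -mulrN ler_pM2l ?ltr0n//.
by rewrite -mulNr ler_pdivlMr.
Qed.

End CurvatureBounds.

(** [polar a 0 0] is the pole t = 0: the factor sin 0 removes the direction, so the zero vector can
    stand for it. *)
Definition height (q : 'rV[R]_(1 + n)) : R := dot (param q) (x (phi (polar a 0 (0 : 'rV[R]_n)))).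

Lemma derive_height q v (h := x (phi (polar a 0 (0 : 'rV[R]_n)))) : off q ->
  'D_v height q = dot ('D_v param q) h.
Proof. exact: derive_dotl param_smooth. Qed.

Lemma derive2_height q v (h := x (phi (polar a 0 (0 : 'rV[R]_n)))) : off q ->
  'D_v ('D_v height) q = dot ('D_v ('D_v param) q) h.
Proof.
move=> qo; apply: etrans (derive_dotl h v (smooth_D v param_smooth) qo).
by apply: derive_ext oo _ qo => y yo; exact: derive_height.
Qed.

Lemma height_mean : minimal x -> exists g p1 p2 : R -> R,
  [/\ (forall t, is_derive t (1 : R) g (p1 t)), (forall t, is_derive t (1 : R) p1 (p2 t)),
      continuous p2, (forall t, 0 < t < a -> f t * p2 t + n'%:R * f1 t * p1 t + n%:R * f t * g t = 0) &
      g 0 != 0].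
Proof.
move=> hmin; apply: (@spherical_mean R n' height f f1 a n'%:R n%:R).
- move=> K; apply: (smooth_dot oo param_smooth) => {}K; exact: Ck_cst.
- by move=> q qo; rewrite derive_height// param_radial// dot0l.
- by move=> t ta; rewrite gt_eqF// warping_gt0.
- move=> t p ta p0; have qo : off (slice t p) by rewrite /off_axis /= rsubmx_slice.
  have qt : 0 < time (slice t p) < a by rewrite time_slice.
  have [eps Wq] := chart_cover qo qt.
  have := param_pde (x (phi (polar a 0 (0 : 'rV[R]_n)))) hmin Wq; rewrite time_slice.
  have e3 : \sum_i 'D_(e i) ('D_(e i) height) (slice t p) =
      \sum_i dot ('D_(e i) ('D_(e i) param) (slice t p)) (x (phi (polar a 0 (0 : 'rV[R]_n)))).
    by apply: eq_bigr => i _; exact: derive2_height.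
  exact: linear_congr (derive2_height et qo) (derive_height et qo) e3.
- move=> p p0; have E w : polar a 0 (w : 'rV[R]_n) = polar a 0 0.
    by rewrite /polar mulr0 mul0r sin0 !scale0r.
  rewrite /height /param /base /polar_map /direction time_slice rsubmx_slice E.
  have [_ hx1 _] := hx; apply: hx1; apply: phi1; rewrite -(E (normalize p)).
  by apply: dot_polar; exact: dot_normalize.
Qed.

Let f00 : f 0 = 0. Proof. by case: wf => _ _ h _ _; exact: (h 0%N).1. Qed.
Let fa0 : f a = 0. Proof. by case: wf => _ _ h _ _; exact: (h 0%N).2. Qed.
Let f10 : f1 0 = 1. Proof. by case: wf => _ _ _ h _; rewrite -derive1E. Qed.
Let f1a : f1 a = -1. Proof. by case: wf => _ _ _ _ h; rewrite -derive1E. Qed.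

Lemma warping_solution m r c0 c1 : n' = m.+2 -> minimal x -> 0 < c1 ->
  c0 * geg_eig R m.+3 r = m.+3%:R -> c1 * geg_eig R m.+3 r.+1 = m.+3%:R ->
  sec_le (induced_metric x) c0 -> ric_ge (induced_metric x) (n'%:R * c1) ->
  (forall t, 0 < t < a -> f2 t = - c0 * f t) \/ (forall t, 0 < t < a -> f2 t = - c1 * f t).
Proof.
move=> nE hmin c1_gt0 c0E c1E hsec hric.
have n'0 : (0 < n')%N by rewrite nE.
have [g [p1 [p2 [gd p1d p2c ode g0]]]] := height_mean hmin.
have p1c : continuous p1 by move=> t; exact: is_derive_cont (p1d t).
have f1c : continuous f1 by move=> t; exact: is_derive_cont (warping_is_derive2 t).
have fc : continuous f by move=> t; exact: is_derive_cont (warping_is_derive t).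
have gc : continuous g by move=> t; exact: is_derive_cont (gd t).
(* At the ends f = 0 and f' is 1 or -1, so the equation reduces to the vanishing of the derivative
   of g. *)
have [E0 Ea] : (f 0 * p2 0 + n'%:R * f1 0 * p1 0 + n%:R * f 0 * g 0 = 0) /\
    (f a * p2 a + n'%:R * f1 a * p1 a + n%:R * f a * g a = 0).
  apply: (cont_eq0_ends (g := fun t => f t * p2 t + n'%:R * f1 t * p1 t + n%:R * f t * g t)) => // t.
  have C (h : R -> R) : continuous h -> Ck 0 setT h by move=> hc; split=> // z _; exact: hc.
  have oT : open (setT : set R) by exact: openT.
  have K (z : R) : Ck 0 (setT : set R) (fun=> z) by exact: Ck_cst.
  exact: (Ck_cont (CkD oT (CkD oT (CkM oT (C _ fc) (C _ p2c)) (CkM oT (CkM oT (K _) (C _ f1c)) (C _ p1c)))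
    (CkM oT (CkM oT (K _) (C _ fc)) (C _ gc))) I).
have nn : n'%:R != 0 :> R by rewrite pnatr_eq0 -lt0n.
have p10 : p1 0 = 0.
  move: E0; rewrite f00 f10 !(mul0r, mulr0) addr0 add0r mulr1 => /eqP.
  by rewrite mulf_eq0 (negPf nn) => /eqP.
have p1a : p1 a = 0.
  move: Ea; rewrite fa0 f1a !(mul0r, mulr0) addr0 add0r mulrN1 mulNr => /eqP.
  by rewrite oppr_eq0 mulf_eq0 (negPf nn) => /eqP.
have f2c : continuous f2 by move=> t; exact: Ck_cont (smooth_D _ (smooth_D _ fs) 0%N) I.
rewrite /n nE in ode.
apply: (warping_rigidity a0 warping_is_derive warping_is_derive2 f2c warping_gt0 f00 f10 fa0 f1a
  gd p1d p2c ode g0 p10 p1a c1_gt0 c0E c1E) => t ta.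
- exact: (warping_ge n'0 ta hric).
- exact: (warping_le n'0 ta hsec).
Qed.

(** * The case f'' = - s^2 f *)

Section RoundCase.
Variable s : R.
Hypotheses (s0 : 0 < s) (fss : forall t, 0 < t < a -> f2 t = - s ^+ 2 * f t).

(** The squared distance between (f', s f) and (cos st, sin st) is conserved and starts at 0. *)
Lemma warping_sin t : 0 <= t <= a -> s * f t = sin (s * t).
Proof.
move=> /andP[t0 ta].
pose E t := (f1 t - cos (s * t)) ^+ 2 + (s * f t - sin (s * t)) ^+ 2.
have st (z : R) : is_derive z (1 : R) (fun z => s * z) s.
  by apply: is_derive_eq (isdM (isdC z (1 : R) s) (isd_id z)) _; rewrite mul0r add0r mulr1.
have Ed (z : R) := isdD (isdX 1 (isdB (warping_is_derive2 z) (isd_cos (st z))))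
  (isdX 1 (isdB (isdM (isdC z (1 : R) s) (warping_is_derive z)) (isd_sin (st z)))).
have E0 : E t = E 0.
  apply: (@der_eq0_cst R E _ 0 t t0 (fun z _ => Ed z) (fun z _ => is_derive_cont (Ed z))) => z hz.
  rewrite fss; last by case/andP: hz => -> /= h; exact: lt_le_trans h ta.
  ring.
move/eqP: E0; rewrite /E f10 f00 !mulr0 cos0 sin0 !subrr expr0n addr0.
rewrite paddr_eq0 ?sqr_ge0// => /andP[_]; rewrite sqrf_eq0 subr_eq0 => /eqP; exact.
Qed.

(** s a is a positive zero of the sine; if it exceeded pi, f would vanish at pi / s, inside the
    interval. *)
Lemma warping_length : s * a = pi.
Proof.
have aa : 0 <= a <= a by rewrite lexx ltW.
have sa : sin (s * a) = 0 by rewrite -warping_sin// fa0 mulr0.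
have sa0 : 0 < s * a by rewrite mulr_gt0.
have [h|h|//] := ltgtP (s * a) pi.
  have hs : 0 < s * a < pi by rewrite sa0 h.
  by have := sin_gt0_pi hs; rewrite sa ltxx.
have p0 : 0 < (pi : R) by exact: pi_gt0.
have t1 : 0 < pi / s < a by rewrite divr_gt0//= ltr_pdivrMr// mulrC.
have t2 : 0 <= pi / s <= a by case/andP: t1 => /ltW -> /ltW.
have := warping_sin t2; rewrite mulrCA mulfV ?gt_eqF// mulr1 sinpi => /eqP.
by rewrite mulf_eq0 !gt_eqF// warping_gt0.
Qed.

Let psi1 z : usphere R n.+1 z -> usphere R n.+1 (psi z). Proof. by case/psiK. Qed.
Let Ps eps : smooth setT (chart_map psi eps) := chart_map_smooth psis eps.

Lemma psi_chart eps q : chart_dom eps q -> polar_map a q = chart_map psi eps (chart_coord eps q).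
Proof.
move=> Wq; rewrite /chart_map stereo_chart_coord// /base (phiK _).2//.
by apply: dot_polar_map; case: Wq.
Qed.

Lemma psi_gram eps q v w : chart_dom eps q ->
  form (gram (chart_map psi eps) (chart_coord eps q)) ('D_v (chart_coord eps) q) ('D_w (chart_coord eps) q) =
  (pi / a) ^+ 2 * time v * time w
  + sin (polar_angle a q) ^+ 2 * dot (direction_der q v) (direction_der q w).
Proof.
move=> Wq; have [qo _ _] := Wq; rewrite -dot_derive_polar_map// gram_form//.
have D z := chart_derive (Ps eps) (@chart_dom_open eps) (@chart_coord_smooth eps) (@psi_chart eps) z Wq.
exact: (esym (congr2 (@dot R (1 + n)) (D v) (D w))).
Qed.

(** Since s^2 (dt^2 + f^2 m) = (s dt)^2 + sin^2(st) m, the two forms agree on the frame of polar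
    coordinates, and [param_form_eq0] concludes. *)
Lemma gram_chart_coord eps q : chart_dom eps q ->
  gram (chart_map psi eps) (chart_coord eps q) = s ^+ 2 *: gram (chart_map x eps) (chart_coord eps q).
Proof.
move=> Wq; have [qo qt _] := Wq; apply/eqP; rewrite -subr_eq0; apply/eqP.
have pa : pi / a = s by rewrite -warping_length mulfK// gt_eqF.
have sq : sin (polar_angle a q) ^+ 2 = s ^+ 2 * f (time q) ^+ 2.
  rewrite -exprMn warping_sin; last by case/andP: qt => /ltW -> /ltW.
  by rewrite /polar_angle mulrAC pa.
have t1 : time et = 1 :> R by rewrite /time row_mxEl mxE.
have ti i : time (e i) = 0 :> R by rewrite /time row_mxEl mxE.
apply: (param_form_eq0 Wq) => [|i|i|i j]; rewrite formBZ psi_gram// param_gram//.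
- by rewrite param_tt// direction_der_time// dot0l mulr0 addr0 t1 pa !mulr1 subrr.
- by rewrite param_ti// direction_der_time// dot0l !mulr0 addr0 ti mulr0 subrr.
- rewrite (etrans (dotC _ _) (param_ti i qo qt)).
  by rewrite direction_der_time// dot0r !mulr0 addr0 ti mulr0 mul0r subrr.
- by rewrite param_ij// dot_direction_der// sq !ti !mulr0 add0r mulrA subrr.
Qed.

Lemma gram_off_poles eps u : rsubmx (psi (stereo eps u) : 'rV[R]_(1 + n)) != 0 ->
  gram (chart_map psi eps) u = s ^+ 2 *: gram (chart_map x eps) u.
Proof.
set z := (psi (stereo eps u) : 'rV[R]_(1 + n)); move=> r0.
have z1 : dot z z = 1 by apply: psi1; exact: dot_stereo.
have phz : phi z = stereo eps u by apply: (psiK _).2; exact: dot_stereo.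
pose z0 := z 0 (lshift n 0); pose r := rsubmx z.
have E : z0 ^+ 2 + dot r r = 1 by rewrite -z1 [z in RHS]row_mx_split dot_row_mx -expr2.
have rr : 0 < dot r r by rewrite dot_gt0.
have z01 : -1 < z0 < 1 by apply: sqr_lt1; rewrite -E ltrDl.
have z01' : -1 <= z0 <= 1 by case/andP: z01 => /ltW -> /ltW.
(* The colatitude of z on the unit sphere, rescaled from [0, pi] to [0, a]. *)
pose t := acos z0 * a / pi.
have p0 : 0 < (pi : R) by exact: pi_gt0.
have at_ : pi * t / a = acos z0 by rewrite /t (mulrC pi) divfK ?mulfK ?gt_eqF.
have ta : 0 < t < a.
  have [/andP[l1 l2]] : -1 < z0 < 1 by [].
  rewrite divr_gt0 ?mulr_gt0 ?acos_gt0//=; last by rewrite (ltW l1).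
  by rewrite ltr_pdivrMr// mulrC ltr_pM2l// acos_ltpi// l1 ltW.
pose q := slice t r.
have qo : off q by rewrite /off_axis /= rsubmx_slice.
have qz : polar_map a q = z.
  rewrite /polar_map /direction time_slice rsubmx_slice /polar at_ acosK// sin_acos//.
  rewrite [RHS]row_mx_split -/z0 -/r; congr row_mx; rewrite /normalize scalerA.
  rewrite (_ : 1 - z0 ^+ 2 = dot r r); last by rewrite -E addrAC subrr add0r.
  by rewrite mulfV ?scale1r// gt_eqF// sqrtr_gt0.
have Bq : B q = stereo eps u by rewrite /base qz phz.
have Wq : chart_dom eps q.
  by split=> //; [rewrite time_slice|rewrite Bq; exact: stereo_in_dom].
have <- : chart_coord eps q = u by rewrite /chart_coord Bq stereoK.
exact: gram_chart_coord.
Qed.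

Let psi_unit eps u : dot (chart_map psi eps u) (chart_map psi eps u) = 1.
Proof. by apply: psi1; exact: dot_stereo. Qed.

Lemma psi_chart_inj eps u y : chart_map psi eps u = chart_map psi eps y -> u = y.
Proof.
have K z : phi (chart_map psi eps z) = stereo eps z by apply: (psiK _).2; exact: dot_stereo.
by move=> /(congr1 phi); rewrite !K => /(congr1 (stereo_inv eps)); rewrite !stereoK.
Qed.

(* The two poles have isolated preimages under the chart, so the identity
   extends to them by continuity. *)
Lemma gram_round eps u :
  gram (chart_map psi eps) u = s ^+ 2 *: gram (chart_map x eps) u.
Proof.
apply/matrixP => i j; apply/eqP; rewrite -subr_eq0; apply: contraT => D0.
rewrite scale_mxE in D0.
pose g y := gram (chart_map psi eps) y i j - s ^+ 2 * gram (chart_map x eps) y i j.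
have gc : {for u, continuous g}.
  apply: (Ck_cont (k := 0) (U := setT) _ I).
  apply: (CkB openT); first exact: (gram_smooth (Ps eps)).
  apply: (CkM openT); first exact: Ck_cst.
  exact: (gram_smooth (chart_map_smooth xs eps)).
pose z0 y := chart_map psi eps y 0 (lshift n (0 : 'I_1)).
have zc : {for u, continuous z0}.
  exact: (Ck_cont ((smooth_mxP _ openT).1 (Ps eps) 0 (lshift n (0 : 'I_1)) 0%N) I).
have on0 : open [set y : R | y != 0] by exact: open_neq.
have N1 : \forall y \near u, g y != 0 := gc _ (open_nbhs_nbhs (conj on0 D0)).
have N2 : \forall y \near u, `|z0 u - z0 y| < 1 by exact: (cvgrPdist_lt _ _).1 zc _ ltr01.
have N12 : \forall y \near u, g y != 0 /\ `|z0 u - z0 y| < 1 by exact: filterI N1 N2.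
move/(@nbhs_normP R 'rV[R]_n): N12 => [d /= d0 dP].
(* A failure at u persists at the neighbour y, so both are sent to poles. Their first coordinates, 1
   or -1, are less than 1 apart, so the pole is the same, against injectivity. *)
pose y := u + (d / 2) *: basis R (0 : 'I_n).
have [|gy zy] := dP y.
  rewrite /ball_ /= /y opprD addrA subrr add0r normrN normrZ.
  apply: (@le_lt_trans _ _ (d / 2)); last by rewrite ltr_pdivrMr// ltr_pMr// ltr1n.
  rewrite gtr0_norm ?divr_gt0// ler_piMr//; first by rewrite ltW// divr_gt0.
  by apply: mx_norm_le => // k; rewrite mxE eqxx /=; case: eqP => _; rewrite ?normr1 ?normr0.
have bad v : g v != 0 -> rsubmx (chart_map psi eps v : 'rV[R]_(1 + n)) = 0.
  by apply: contraNeq => r0; rewrite /g gram_off_poles// scale_mxE subrr.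
have Z v : g v != 0 -> z0 v ^+ 2 = 1.
  move=> /bad r0; rewrite -(psi_unit eps v).
  rewrite [in RHS](row_mx_split (chart_map psi eps v)) dot_row_mx r0 dot0l addr0 -expr2 //.
have zz : z0 u = z0 y := sqr1_close (Z u D0) (Z y gy) zy.
have /psi_chart_inj uy : chart_map psi eps u = chart_map psi eps y.
  rewrite (row_mx_split (chart_map psi eps u)) (row_mx_split (chart_map psi eps y)).
  by rewrite (bad u D0) (bad y gy) -/(z0 u) -/(z0 y) zz.
have := congr1 (fun w : 'rV[R]_n => w 0 0) uy; rewrite /y !mxE !eqxx mulr1 => /eqP.
by rewrite -subr_eq0 opprD addrA subrr add0r oppr_eq0 gt_eqF// divr_gt0.
Qed.

(** The immersion x may have high codimension. Curvature depends only on the metric, so x is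
    replaced by [Z], which parametrizes the hypersphere of radius 1/s in R^(n+1) with the same Gram
    matrices. *)
Lemma round_sec : sec_eq (induced_metric x) (s ^+ 2).
Proof.
move=> eps u v w vw; rewrite (in_chart_gram hx).
pose Z y := s^-1 *: chart_map psi eps y.
have s0' : s != 0 by rewrite gt_eqF.
have Zs : smooth setT Z by apply: (smooth_scale openT _ (Ps eps)) => K; exact: Ck_cst.
have scale_derive (F : 'rV[R]_n -> 'rV[R]_(1 + n)) y z : smooth setT F ->
    'D_z (fun y => s^-1 *: F y) y = s^-1 *: 'D_z F y.
  move=> Fs; have [_ ->] := isdZ_row (isdC y z s^-1) (smooth_is_derive z Fs (I : setT y)).
  by rewrite scale0r add0r.
have ZD z y : 'D_z Z y = s^-1 *: 'D_z (chart_map psi eps) y by exact: scale_derive.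
have Zg : gram (chart_map x eps) = gram Z.
  apply/funext => y; apply/matrixP => i j; rewrite [RHS]gramE !ZD dotZl dotZr -gramE gram_round scale_mxE.
  by field.
rewrite Zg; apply: (@space_form_sec R n Z (chart_map psi eps) s Zs) => //.
- by move=> y; rewrite -Zg; exact: gram_chart_unit.
- by move=> y i; rewrite ZD dotZr dotC dot_derive_unit ?mulr0//.
move=> y i j; rewrite -Zg /partial2.
have -> : 'D_(basis R j) Z = fun y => s^-1 *: 'D_(basis R j) (chart_map psi eps) y.
  by apply/funext => z; exact: ZD.
rewrite scale_derive; last exact: smooth_D.
rewrite dotZl -/(partial2 (chart_map psi eps) y i j) dot_partial2_unit// gram_round scale_mxE.
by field.
Qed.

End RoundCase.

Theorem warped_sphere_rigidity m r c0 c1 : n' = m.+2 -> minimal x -> 0 < c0 -> 0 < c1 ->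
  c0 * geg_eig R m.+3 r = m.+3%:R -> c1 * geg_eig R m.+3 r.+1 = m.+3%:R ->
  sec_le (induced_metric x) c0 -> ric_ge (induced_metric x) (n'%:R * c1) ->
  sec_eq (induced_metric x) c0 \/ sec_eq (induced_metric x) c1.
Proof.
move=> nE hmin c0_gt0 c1_gt0 c0E c1E hsec hric.
have round c : 0 < c -> (forall t, 0 < t < a -> f2 t = - c * f t) -> sec_eq (induced_metric x) c.
  move=> c_gt0 H; rewrite -(sqr_sqrtr (ltW c_gt0)); apply: round_sec; first by rewrite sqrtr_gt0.
  by move=> t ta; rewrite sqr_sqrtr ?ltW// H.
have [H|H] := warping_solution nE hmin c1_gt0 c0E c1E hsec hric; [left|right]; exact: round H.
Qed.

End WarpedSphere.

Theorem theorem1p5 (R : realType) (n r N : nat)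
    (hn : (3 <= n)%N) (hr : (1 <= r)%N)
    (x : 'rV[R]_n.+1 -> 'rV[R]_N.+1)
    (hx : sphere_immersion x)
    (hmin : minimal x)
    (hrot : rotationally_symmetric (induced_metric x))
    (hric : ric_ge (induced_metric x)
      ((n%:R - 1) * (n%:R / ((r%:R + 1) * (r%:R + n%:R)))))
    (hsec : sec_le (induced_metric x)
      (n%:R / (r%:R * (r%:R + n%:R - 1)))) :
  sec_eq (induced_metric x) (n%:R / (r%:R * (r%:R + n%:R - 1))) \/
  sec_eq (induced_metric x) (n%:R / ((r%:R + 1) * (r%:R + n%:R))).
Proof.
move: n hn x hx hmin hrot hric hsec => [|[|[|m]]]// _ x hx hmin hrot hric hsec.
have [a [f [phi [a0 wf [psi [phis psis phiK psiK]] hr']]]] := hrot.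
have r0 : 0 < r%:R :> R by rewrite ltr0n.
have m0 : 0 <= m%:R :> R by rewrite ler0n.
have nE : m.+3%:R = m%:R + 3 :> R by rewrite -addn3 natrD.
have d0 : 0 < r%:R * (r%:R + m.+3%:R - 1) :> R by rewrite mulr_gt0// nE; lra.
have d1 : 0 < (r%:R + 1) * (r%:R + m.+3%:R) :> R by rewrite mulr_gt0// ?nE; lra.
have n0 : 0 < m.+3%:R :> R by rewrite ltr0n.
have hric' : ric_ge (induced_metric x) (m.+2%:R * (m.+3%:R / ((r%:R + 1) * (r%:R + m.+3%:R)))).
  by rewrite (_ : m.+2%:R = m.+3%:R - 1)// -[m.+3]addn1 natrD addrK.
apply: (warped_sphere_rigidity (r := r) hx a0 wf phis psis phiK psiK hr' (erefl m.+2) hmin _ _ _ _ hsec hric').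
- by rewrite divr_gt0.
- by rewrite divr_gt0.
- by rewrite /geg_eig divfK// gt_eqF.
- have -> : geg_eig R m.+3 r.+1 = (r%:R + 1) * (r%:R + m.+3%:R).
    by rewrite /geg_eig -[r.+1]addn1 natrD; ring.
  by rewrite divfK// gt_eqF.
Qed.
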